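(* Let $F$ be a strongly convex norm on $\mathbb{R}^n$ (in the sense of the context), let $\Omega\subset\mathbb{R}^n$ be a piecewise $C^2$ domain with non-empty boundary, let $d_F$ be the anisotropic distance function to $\partial\Omega$, suppose $\sup_{x\in\Omega}d_F(x)<+\infty$, and set $D=e\cdot\sup_{x\in\Omega}d_F(x)$. Suppose that for some constants $A>0$, $B\ge0$, $\gamma>0$ the inequality $$\int_\Omega F(\nabla u)^2\,dx-A\int_\Omega\frac{u^2}{d_F^2}\,dx\;\ge\;B\int_\Omega\frac{u^2}{d_F^2}\left(\log\frac{D}{d_F}\right)^{-\gamma}dx$$ holds for all $u\in H_0^1(\Omega)$. Then: 1. $A\le\frac14$; 2. if $A=\frac14$ and $B>0$, then $\gamma\ge2$; 3. if $A=\frac14$ and $\gamma=2$, then $B\le\frac14$.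
   Context: Standing assumptions on $F$: $F:\mathbb{R}^n\to[0,+\infty)$ is convex, satisfies $F(t\xi)=|t|F(\xi)$ for all $t\in\mathbb{R}$, $\xi\in\mathbb{R}^n$, and $\alpha_1|\xi|\le F(\xi)$ for all $\xi$ for some constant $\alpha_1>0$; moreover $F\in C^2(\mathbb{R}^n\setminus\{0\})$ and the Hessian $\nabla^2_\xi F^2$ is positive definite on $\mathbb{R}^n\setminus\{0\}$. Polar function: $F^o(x)=\sup_{\xi\ne0}\frac{\xi\cdot x}{F(\xi)}$. A domain is a connected open set; ''piecewise $C^2$ domain'' means that its boundary is piecewise of class $C^2$. For a domain $\Omega$ with non-empty boundary, the anisotropic distance to the boundary is $d_F(x)=\inf_{y\in\partial\Omega}F^o(x-y)$, $x\in\overline\Omega$. *)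

(* Defs.v *)
From HB Require Import structures.
From mathcomp Require Import all_boot all_order all_algebra.
From mathcomp Require Import all_classical all_reals all_analysis.

Set Implicit Arguments.
Unset Strict Implicit.
Unset Printing Implicit Defensive.

Import Order.TTheory GRing.Theory Num.Theory.
Import numFieldNormedType.Exports.

Local Open Scope classical_set_scope.
Local Open Scope ring_scope.

Definition measure_rV_display : measure_display -> measure_display.
Proof. exact. Qed.

Section measurable_rV.
Context {R : realType} {n : nat}.

Let coors (i : 'I_n) (x : 'rV[R]_n) : R := x ord0 i.

Let rV_set0 : g_sigma_preimage coors set0.
Proof. exact: sigma_algebra0. Qed.

Let rV_setC A : g_sigma_preimage coors A -> g_sigma_preimage coors (~` A).
Proof. exact: sigma_algebraC. Qed.

Let rV_bigcup (A : (set 'rV[R]_n)^nat) :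
  (forall i, g_sigma_preimage coors (A i)) ->
  g_sigma_preimage coors (\bigcup_i (A i)).
Proof. exact: sigma_algebra_bigcup. Qed.

HB.instance Definition _ :=
  @isMeasurable.Build (measure_rV_display default_measure_display)
  'rV[R]_n (g_sigma_preimage coors) rV_set0 rV_setC rV_bigcup.

End measurable_rV.

Lemma measurable_coord {R : realType} {n : nat} (i : 'I_n) :
  measurable_fun setT (fun x : 'rV[R]_n => x ord0 i).
Proof.
move=> _ Y mY; rewrite setTI; apply: sub_sigma_algebra => /=.
rewrite -bigcup_seq/=; exists i => /=; first by rewrite mem_index_enum.
by exists Y => //; rewrite setTI.
Qed.

Lemma measurable_fun_coordP {R : realType} {n : nat} d (T : measurableType d)
    (f : T -> 'rV[R]_n) :
  (forall i, measurable_fun setT (fun x => f x ord0 i)) -> measurable_fun setT f.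
Proof.
move=> mf _ A mA; rewrite setTI.
have : g_sigma_preimage (fun (i : 'I_n) (x : 'rV[R]_n) => x ord0 i) `<=`
    [set B | measurable (f @^-1` B)].
  apply: smallest_sub.
    split=> /=.
    - by rewrite preimage_set0; exact: measurable0.
    - by move=> B mB; rewrite setTD preimage_setC; exact: measurableC.
    - by move=> F mF; rewrite preimage_bigcup; exact: bigcup_measurable.
  rewrite -bigcup_seq => B [i _ [C mC <-]] /=.
  rewrite setTI; have := mf i measurableT C mC.
  by rewrite setTI.
by move=> /(_ A mA).
Qed.

Section lebesgue_rV.
Context {R : realType}.

Definition rV_cons n (p : R * 'rV[R]_n) : 'rV[R]_n.+1 :=
  \row_i oapp (p.2 ord0) p.1 (unlift ord0 i).

Definition rV_uncons n (x : 'rV[R]_n.+1) : R * 'rV[R]_n :=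
  (x ord0 ord0, \row_i x ord0 (lift ord0 i)).

Lemma rV_consK n : cancel (@rV_cons n) (@rV_uncons n).
Proof.
case=> a x; rewrite /rV_uncons /rV_cons mxE unlift_none /=; congr pair.
by apply/rowP => i; rewrite !mxE liftK.
Qed.

Lemma measurable_rV_cons n : measurable_fun setT (@rV_cons n).
Proof.
apply: measurable_fun_coordP => i; rewrite /rV_cons.
under eq_fun do rewrite mxE.
case: (unlift ord0 i) => [j|] /=; last exact: measurable_fst.
exact: (measurableT_comp (measurable_coord j) measurable_snd).
Qed.

Lemma measurable_rV_uncons n : measurable_fun setT (@rV_uncons n).
Proof.
apply: measurable_fun_pair => /=; first exact: measurable_coord.
apply: measurable_fun_coordP => i.
by under eq_fun do rewrite mxE; exact: measurable_coord.
Qed.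

Section step.
Local Open Scope ereal_scope.
Context (n : nat) (m : {sigma_finite_measure set 'rV[R]_n -> \bar R}).

Let leb : {sigma_finite_measure set _ -> \bar R} := @lebesgue_measure R.

Definition rV_cons_measure : set 'rV[R]_n.+1 -> \bar R :=
  pushforward (leb \x m) (@rV_cons n).

Let rV_cons_measure0 : rV_cons_measure set0 = 0.
Proof. by rewrite /rV_cons_measure /pushforward preimage_set0 measure0. Qed.

Let rV_cons_measure_ge0 A : 0 <= rV_cons_measure A.
Proof. by rewrite /rV_cons_measure /pushforward measure_ge0. Qed.

Let rV_cons_measure_sigma_additive : semi_sigma_additive rV_cons_measure.
Proof.
move=> F mF tF mUF; rewrite /rV_cons_measure /pushforward preimage_bigcup.
have mpre A : measurable A -> measurable (@rV_cons n @^-1` A).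
  by move=> mA; rewrite -[X in measurable X]setTI; exact: measurable_rV_cons.
apply: measure_semi_sigma_additive => [k||]; first exact: mpre.
  apply/trivIsetP => /= i j _ _ ij; rewrite -preimage_setI.
  by move/trivIsetP : tF => /(_ _ _ _ _ ij) ->//; rewrite preimage_set0.
by rewrite -preimage_bigcup; exact: mpre.
Qed.

HB.instance Definition _ := isMeasure.Build _ _ _ rV_cons_measure
  rV_cons_measure0 rV_cons_measure_ge0 rV_cons_measure_sigma_additive.

Let rV_cons_measure_sigma_finite : sigma_finite setT rV_cons_measure.
Proof.
have /sigma_finiteP[F [FT Fnd Foo]] := sigma_finiteT leb.
have /sigma_finiteP[G [GT Gnd Goo]] := sigma_finiteT m.
exists (fun k => @rV_uncons n @^-1` (F k `*` G k)) => [|k].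
  rewrite -preimage_bigcup -[LHS](@preimage_setT _ _ (@rV_uncons n)).
  congr (_ @^-1` _); rewrite -setXTT FT GT predeqE => -[x y]; split.
    move=> [/= [i _ Fix] [j _ Gjy]]; exists (maxn i j) => //; split.
    - by move: x Fix; exact/subsetPset/Fnd/leq_maxl.
    - by move: y Gjy; exact/subsetPset/Gnd/leq_maxr.
  by move=> [i _ []/= ? ?]; split; exists i.
have [mF Fk] := Foo k; have [mG Gk] := Goo k.
have mFG : measurable (F k `*` G k) by exact: measurableX.
split.
  by rewrite -[X in measurable X]setTI; exact: measurable_rV_uncons.
rewrite /rV_cons_measure /pushforward -comp_preimage.
rewrite (_ : _ \o _ = id); last by apply/funext => p; exact: rV_consK.
rewrite preimage_id; rewrite product_measure1E//.
by rewrite lte_mul_pinfty// ge0_fin_numE.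
Qed.

HB.instance Definition _ := @Measure_isSigmaFinite.Build _ _ _ rV_cons_measure
  rV_cons_measure_sigma_finite.

End step.

(* Lebesgue measure on the Borel sets of R^n, as the iterated product of the
   one-dimensional Lebesgue measure. *)
Fixpoint lebesgue_rV n : {sigma_finite_measure set 'rV[R]_n -> \bar R} :=
  match n with
  | 0 => [the {sigma_finite_measure set _ -> \bar R} of \d_ (0 : 'rV[R]_0)]
  | k.+1 => [the {sigma_finite_measure set _ -> \bar R} of
              rV_cons_measure (lebesgue_rV k)]
  end.

End lebesgue_rV.

Section statement_notions.
Context {R : realType}.

Section calculus.
Context {n : nat}.
Implicit Types (f : 'rV[R]_n -> R) (U : set 'rV[R]_n).

Definition dotp (x y : 'rV[R]_n) : R := \sum_(i < n) x ord0 i * y ord0 i.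

(* The library's norm on row vectors is the maximum norm. *)
Definition enorm (x : 'rV[R]_n) : R := Num.sqrt (dotp x x).

Definition partial (i : 'I_n) f : 'rV[R]_n -> R :=
  fun x => 'D_(delta_mx ord0 i) f x.

Fixpoint Ck_on (k : nat) U f : Prop :=
  (forall x, U x -> {for x, continuous f}) /\
  if k is k'.+1 then
    forall i : 'I_n, (forall x, U x -> derivable f x (delta_mx ord0 i)) /\
      Ck_on k' U (partial i f)
  else True.

Definition hessian f (x : 'rV[R]_n) : 'M[R]_n :=
  \matrix_(i, j) partial i (partial j f) x.

Definition positive_definite (M : 'M[R]_n) : Prop :=
  forall v : 'rV[R]_n, v != 0 -> 0 < (v *m M *m v^T) ord0 ord0.

End calculus.

Definition strongly_convex_norm n (F : 'rV[R]_n -> R) : Prop :=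
  [/\ (forall x, 0 <= F x) /\ convex_function setT F,
      forall t x, F (t *: x) = `|t| * F x,
      exists2 a, 0 < a & forall x, a * enorm x <= F x,
      Ck_on 2 [set x | x != 0] F
    & forall x, x != 0 -> positive_definite (hessian (fun y => F y ^+ 2) x)].

Definition polar n (F : 'rV[R]_n -> R) (x : 'rV[R]_n) : R :=
  sup [set dotp xi x / F xi | xi in [set xi | xi != 0]].

Definition boundary n (A : set 'rV[R]_n) : set 'rV[R]_n :=
  closure A `\` interior A.

Definition C2_defining n (U : set 'rV[R]_n) (rho : 'rV[R]_n -> R) : Prop :=
  [/\ open U, Ck_on 2 U rho &
      forall x, U x -> exists i : 'I_n, partial i rho x != 0].

(* Gamma is a locally finite union of closures of (possibly empty) pieces S k.
   Each piece is open in Gamma and a C^2 hypersurface (second clause), and is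
   of class C^2 up to its edges (last clause). When Gamma is the boundary of a
   domain, the domain may lie on both sides of a piece. *)
Definition piecewise_C2 n (Gamma : set 'rV[R]_n) : Prop :=
  exists S : nat -> set 'rV[R]_n,
  [/\ Gamma = \bigcup_k closure (S k),
      forall k p, S k p -> exists (U : set 'rV[R]_n) rho,
        [/\ U p, C2_defining U rho, S k `&` U = Gamma `&` U
          & Gamma `&` U = U `&` [set x | rho x = 0]],
      forall p : 'rV[R]_n,
        exists2 U, nbhs p U & finite_set [set k | S k `&` U !=set0]
    & forall k p, closure (S k) p -> exists (U : set 'rV[R]_n) rho,
        [/\ U p, C2_defining U rho
          & closure (S k) `&` U `<=` [set x | rho x = 0]]].

Definition anisotropic_dist n (F : 'rV[R]_n -> R) (Omega : set 'rV[R]_n)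
    (x : 'rV[R]_n) : R :=
  inf [set polar F (x - y) | y in boundary Omega].

Section sobolev.
Context {n : nat}.
Implicit Types (Omega : set 'rV[R]_n) (u : 'rV[R]_n -> R)
  (g : 'rV[R]_n -> 'rV[R]_n).
Local Notation mu := (@lebesgue_rV R n).

Definition test_function Omega (phi : 'rV[R]_n -> R) : Prop :=
  [/\ forall k, Ck_on k setT phi,
      compact (closure [set x | phi x != 0])
    & closure [set x | phi x != 0] `<=` Omega].

Definition L2 Omega u : Prop :=
  measurable_fun Omega u /\
  (\int[mu]_(x in Omega) ((u x) ^+ 2)%:E < +oo)%E.

Definition weak_gradient Omega u g : Prop :=
  forall phi, test_function Omega phi -> forall i,
  (\int[mu]_(x in Omega) (u x * partial i phi x)%:E =
   - \int[mu]_(x in Omega) (g x ord0 i * phi x)%:E)%E.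

Definition H1 Omega u g : Prop :=
  [/\ L2 Omega u, forall i, L2 Omega (fun x => g x ord0 i)
    & weak_gradient Omega u g].

(* [H10 Omega u g]: u is in H^1_0(Omega), the closure of the test functions in
   the norm of H^1(Omega), and g represents its weak gradient, which is unique
   up to a null set. *)
Definition H10 Omega u g : Prop :=
  H1 Omega u g /\
  exists2 phi : nat -> 'rV[R]_n -> R, forall k, test_function Omega (phi k) &
    (\int[mu]_(x in Omega) ((phi k x - u x) ^+ 2)%:E @[k --> \oo] --> 0)%E /\
    forall i, (\int[mu]_(x in Omega)
      ((partial i (phi k) x - g x ord0 i) ^+ 2)%:E @[k --> \oo] --> 0)%E.

End sobolev.

End statement_notions.

(* Main.v *)
Require Import Defs.
From HB Require Import structures.
From mathcomp Require Import all_boot all_order all_algebra.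
From mathcomp Require Import ring lra.
From mathcomp Require Import all_classical all_reals all_analysis measurable_realfun.
Import Order.TTheory GRing.Theory Num.Theory.
Import numFieldNormedType.Exports.
Set Implicit Arguments.
Unset Strict Implicit.
Unset Printing Implicit Defensive.
Local Open Scope classical_set_scope.
Local Open Scope ring_scope.

(** The three bounds have one source: if A + B l^(-gamma) is at least
    1/4 + B'/l^2 for all large l and some B' > 1/4, the inequality fails
    ([no_hardy_beyond_quarter]). Each violated bound produces such a B': the
    constant A - 1/4 and, for gamma < 2, the function B l^(-gamma) both dominate
    l^(-2), and for gamma = 2 one takes B' = B.

    Why B' > 1/4 is impossible is seen on the half line, with s the distance to
    the boundary and tau = ln (D/s). For f = sqrt (s tau) phi (ln tau), the
    integral of f'^2 - f^2/(4 s^2) - B' f^2/(s tau)^2 equals that of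
    phi'^2 - (B' - 1/4) phi^2 in the variable ln tau, which is negative for a bump
    phi on a long enough interval. In n dimensions the profile f is used in a collar
    of a smooth boundary point p, cut off tangentially, and the support is pushed
    towards the boundary so that the curvature effects disappear.

    No change of variables is made. In the collar, [boundary_chart] gives a C^1
    function delta, vanishing exactly on the boundary, with s = |delta| such that
    F(grad delta) <= 1 + O(s) and d_F <= s (1 + O(s)), and a function iota with
    iota * d_i delta = 1 + O(s) for one coordinate i. With tau = ln (D/s),
    a window P = max (0, 1 - ((ln tau - sigma0)/L)^2), a cutoff zeta and
    u = sqrt (tau s/D) P^2 zeta^k, every one-dimensional identity becomes a
    pointwise inequality ([collar_pointwise])
        D F(grad u)^2 + gain <= D u^2/d_F^2 (A + B l^(-gamma)) - d_i w + loss,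
    with l = ln (D/d_F) and w an explicit C^1 function of compact support, so that
    the integral of d_i w is zero. The gain is a positive multiple of
    P^2 zeta^(2k)/(s tau); the loss comes from the O(s) terms and from the
    derivatives of zeta, and Young's inequality turns it into a high power of s.

    Let tau0 be the value of tau at the centre x0 of the window. The gain is
    bounded below on a ball of radius of order e^(-tau0) ([gain_ball]), hence
    contributes at least c e^(-N tau0), N being the dimension; on the support
    tau >= tau0 e^(-L), so that for k large the loss is at most
    C e^(-(N + 1) tau0) ([window_estimate]). The Hardy inequality says that the
    integral of F(grad u)^2 is at least that of the potential term, hence
    c e^(-N tau0) <= C e^(-(N + 1) tau0) ([concentration_inequality]), which is
    absurd when x0 is close enough to p.

    That u belongs to H^1_0 is proved by sampling instead of convolution: a
    tensor product quasi-interpolant of a compactly supported C^1 function is a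
    test function, and its partial derivatives are quasi-interpolants of
    difference quotients ([quasi_partial], [C1_approx], [C1_H10]). *)

(** * C^1 functions and their gradients *)

Section vectors.
Context {R : realType} {n : nat}.
Implicit Types (x y v : 'rV[R]_n) (i j : 'I_n) (f g : 'rV[R]_n -> R).

Definition ebase i : 'rV[R]_n := delta_mx ord0 i.

Lemma ebaseE i j : ebase i ord0 j = (j == i)%:R.
Proof. by rewrite /ebase mxE eqxx. Qed.

Lemma coord_le_norm x i : `|x ord0 i| <= `|x|.
Proof.
by rewrite [leRHS]/Num.norm/= mx_normrE; apply/bigmax_geP; right => /=; exists (ord0, i).
Qed.

Lemma norm_le_coord x (c : R) : 0 <= c -> (forall i, `|x ord0 i| <= c) -> `|x| <= c.
Proof.
move=> c0 h; rewrite [leLHS]/Num.norm/= mx_normrE; apply/bigmax_leP; split=> //.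
by case=> a b _ /=; rewrite (ord1 a).
Qed.

Lemma norm_ebase i : `|ebase i| = 1.
Proof.
apply/eqP; rewrite eq_le; apply/andP; split.
  by apply: norm_le_coord => // j; rewrite ebaseE; case: eqP => _; rewrite ?normr1 ?normr0.
by have := coord_le_norm (ebase i) i; rewrite ebaseE eqxx normr1.
Qed.

Lemma row_sum_ebase x : x = \sum_i x ord0 i *: ebase i.
Proof.
apply/rowP => j; rewrite summxE (bigD1 j)//= mxE ebaseE eqxx mulr1 big1 ?addr0// => i ij.
by rewrite mxE ebaseE eq_sym (negbTE ij) mulr0.
Qed.

(** Directional derivatives are derivatives of one-variable slices, which gives
    access to the calculus of functions of one variable. *)
Lemma slice_derivable f x v t :
  derivable f (x + t *: v) v <-> derivable (fun s : R => f (x + s *: v)) t 1.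
Proof.
apply: (iff_trans (derivable1P _ _ _)).
apply: (iff_trans _ (iff_sym (derivable1P _ _ _))).
rewrite (_ : (fun h => f (h *: v + (x + t *: v))) =
  (fun h => f (x + (h *: 1 + t) *: v)))//.
by apply/funext => h; rewrite addrCA -scalerDl [_%:A]mulr1.
Qed.

Lemma slice_derive f x v t :
  'D_v f (x + t *: v) = 'D_1 (fun s : R => f (x + s *: v)) t.
Proof.
rewrite /derive; set g1 := fun h => h^-1 *: _; set g2 := fun h => h^-1 *: _.
suff -> : g1 = g2 by [].
apply/funext => h; rewrite /g1 /g2 /=.
by rewrite addrCA -scalerDl [_%:A]mulr1.
Qed.

Lemma is_derive_slice f x v t d :
  is_derive (x + t *: v) v f d -> is_derive t (1 : R) (fun s : R => f (x + s *: v)) d.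
Proof.
move=> [h1 h2]; split; first exact/slice_derivable.
by rewrite -slice_derive.
Qed.

Lemma is_derive_unslice f x v d :
  is_derive (0 : R) (1 : R) (fun s : R => f (x + s *: v)) d -> is_derive x v f d.
Proof.
move=> [h1 h2]; have e : x + 0 *: v = x by rewrite scale0r addr0.
split; first by rewrite -e; apply/slice_derivable.
by rewrite -[in LHS]e slice_derive.
Qed.

Lemma is_derive_comp1 f (h : R -> R) x v d e :
  is_derive x v f d -> is_derive (f x) (1 : R) h e -> is_derive x v (h \o f) (e * d).
Proof.
move=> fd hd; apply: is_derive_unslice.
have e0 : x = x + 0 *: v by rewrite scale0r addr0.
rewrite e0 in fd hd.
have := is_derive_slice fd => fd'.
have := @is_derive1_comp R h (fun s => f (x + s *: v)) 0 e d hd fd'.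
by [].
Qed.

End vectors.

Section C1.
Context {R : realType} {n : nat}.
Implicit Types (x y v : 'rV[R]_n) (i j : 'I_n) (f g : 'rV[R]_n -> R)
  (df dg : 'I_n -> 'rV[R]_n -> R) (U : set 'rV[R]_n).

(** The gradient is part of the data, so that product and chain rules yield it in
    the form needed later without any computation of [partial]. *)
Definition C1_grad U f df : Prop :=
  open U /\ forall x, U x -> {for x, continuous f} /\
    forall i, is_derive x (ebase i) f (df i x) /\ {for x, continuous (df i)}.

Lemma continuous_near_eq (T S : topologicalType) (p q : T -> S) (z : T) :
  (\near z, p z = q z) -> {for z, continuous p} -> {for z, continuous q}.
Proof.
move=> pq cp; rewrite /prop_for /continuous_at -(nbhs_singleton pq).
exact: cvg_trans (near_eq_cvg pq) cp.
Qed.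

Lemma Ck1_C1_grad U f : open U -> Ck_on 1 U f -> C1_grad U f (fun i => partial i f).
Proof.
move=> oU [cf df]; split=> // x Ux; split; first exact: cf.
move=> i; have [d [c _]] := df i; split; last exact: c.
exact/derivableP/d.
Qed.

Lemma C1_gradS U V f df : open V -> V `<=` U -> C1_grad U f df -> C1_grad V f df.
Proof. by move=> oV VU [oU h]; split=> // x /VU /h. Qed.

Lemma C1_grad_eq U f g df dg : C1_grad U f df -> (forall x, U x -> f x = g x) ->
  (forall i x, U x -> df i x = dg i x) -> C1_grad U g dg.
Proof.
move=> [oU h] fg dfg; split=> // x Ux; have [cf hi] := h _ Ux; split.
  by apply: continuous_near_eq cf; near=> y; apply: fg; near: y; exact: open_nbhs_nbhs.
move=> i; have [d c] := hi i; split.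
  rewrite -dfg//; apply: near_eq_is_derive d.
  by near=> y; apply: fg; near: y; exact: open_nbhs_nbhs.
by apply: continuous_near_eq c; near=> y; apply: dfg; near: y; exact: open_nbhs_nbhs.
Unshelve. all: by end_near. Qed.

Lemma C1_grad_cst U (c : R) : open U -> C1_grad U (fun=> c) (fun _ _ => 0).
Proof.
move=> oU; split=> // x _; split; first exact: cst_continuous.
by move=> i; split; [exact: is_derive_cst|exact: cst_continuous].
Qed.

Lemma C1_gradD U f g df dg : C1_grad U f df -> C1_grad U g dg ->
  C1_grad U (fun x => f x + g x) (fun i x => df i x + dg i x).
Proof.
move=> [oU hf] [_ hg]; split=> // x Ux.
have [cf hfi] := hf _ Ux; have [cg hgi] := hg _ Ux.
split; first exact: (@continuousD _ _ _ f g).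
move=> i; have [d c] := hfi i; have [d' c'] := hgi i; split; first exact: is_deriveD.
exact: (@continuousD _ _ _ (df i) (dg i)).
Qed.

Lemma C1_gradM U f g df dg : C1_grad U f df -> C1_grad U g dg ->
  C1_grad U (fun x => f x * g x) (fun i x => f x * dg i x + g x * df i x).
Proof.
move=> [oU hf] [_ hg]; split=> // x Ux.
have [cf hfi] := hf _ Ux; have [cg hgi] := hg _ Ux.
split; first exact: (@continuousM _ _ f g).
move=> i; have [d c] := hfi i; have [d' c'] := hgi i; split; first exact: is_deriveM.
apply: (@continuousD _ _ _ (fun x => f x * dg i x) (fun x => g x * df i x)).
  exact: (@continuousM _ _ f (dg i)).
exact: (@continuousM _ _ g (df i)).
Qed.

Lemma C1_grad_comp U f df (h h' : R -> R) : C1_grad U f df ->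
  (forall x, U x -> is_derive (f x) (1 : R) h (h' (f x)) /\ {for f x, continuous h'}) ->
  C1_grad U (fun x => h (f x)) (fun i x => h' (f x) * df i x).
Proof.
move=> [oU hf] hh; split=> // x Ux.
have [cf hfi] := hf _ Ux; have [hd hc] := hh _ Ux.
have ch : {for f x, continuous h}.
  by apply/differentiable_continuous/derivable1_diffP; case: hd.
split; first exact: (@continuous_comp _ _ _ f h).
move=> i; have [d c] := hfi i; split; first exact: is_derive_comp1.
apply: (@continuousM _ _ (fun x => h' (f x)) (df i)) => //.
exact: (@continuous_comp _ _ _ f h').
Qed.

Lemma C1_gradV U f df : C1_grad U f df -> (forall x, U x -> f x != 0) ->
  C1_grad U (fun x => (f x)^-1) (fun i x => - (f x) ^- 2 * df i x).
Proof.
move=> h f0; apply: (@C1_grad_comp U f df (fun t => t^-1) (fun t => - t ^- 2)) => // x Ux.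
have fx0 := f0 _ Ux; split.
  apply: DeriveDef; first exact: (@derivableV _ _ id).
  by rewrite (@deriveV _ _ id)// derive_id [LHS]mulr1.
apply: (@continuousN _ _ _ (fun t : R => t ^- 2)).
apply: continuousV; first by rewrite expf_neq0.
exact: exprn_continuous.
Qed.

Lemma C1_grad_coord U i : open U ->
  C1_grad U (fun x => x ord0 i) (fun j _ => (i == j)%:R).
Proof.
move=> oU; split=> // x _; split; first exact: coord_continuous.
move=> j; split; last exact: cst_continuous.
apply: is_derive_unslice.
rewrite (_ : (fun s => _) = (fun s : R => s * (i == j)%:R + x ord0 i)).
  have h1 := @is_deriveM R R id (cst (i == j)%:R) 0 1 _ _ (is_derive_id _ _)
    (is_derive_cst _ _ _).
  have h2 := @is_deriveD R R R _ (cst (x ord0 i)) 0 1 _ _ h1 (is_derive_cst _ _ _).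
  by apply: (is_derive_eq h2); rewrite addr0 scaler0 add0r [LHS]mulr1.
by apply/funext => s; rewrite !mxE eqxx/= addrC.
Qed.

End C1.

Section strict.
Context {R : realType} {n : nat}.
Implicit Types (x y z v : 'rV[R]_n) (i j : 'I_n) (f g : 'rV[R]_n -> R)
  (df dg : 'I_n -> 'rV[R]_n -> R) (U : set 'rV[R]_n).

Lemma rV_near_ball x (P : 'rV[R]_n -> Prop) :
  (\near x, P x) -> exists2 r, 0 < r & forall y, `|y - x| < r -> P y.
Proof.
move=> /nbhs_ballP[r r0 h]; exists r => // y yx; apply: h.
by rewrite -ball_normE/= distrC.
Qed.

Lemma slice_MVT U f df i x (a b : R) : C1_grad U f df -> a <= b ->
  (forall t, a <= t <= b -> U (x + t *: ebase i)) ->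
  exists2 c, a <= c <= b &
    f (x + b *: ebase i) - f (x + a *: ebase i) = df i (x + c *: ebase i) * (b - a).
Proof.
move=> [oU hf] ab hU.
have hd t : a <= t <= b ->
    is_derive t (1 : R) (fun s => f (x + s *: ebase i)) (df i (x + t *: ebase i)).
  by move=> /hU /hf[_ /(_ i)[d _]]; exact: is_derive_slice.
have [||c cab e] := @MVT_segment R (fun s => f (x + s *: ebase i))
    (fun t => df i (x + t *: ebase i)) a b ab.
- by move=> t; rewrite in_itv/= => /andP[/ltW ? /ltW ?]; apply: hd; apply/andP.
- apply: derivable_within_continuous => t; rewrite in_itv/= => /hd.
  by case.
by exists c.
Qed.

(** A path from y to z parallel to the axes: it reduces an increment of f to n
    one-dimensional increments, each governed by one partial derivative. *)
Definition stair y z (k : nat) : 'rV[R]_n :=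
  \row_j (if (j < k)%N then z ord0 j else y ord0 j).

Lemma stair0 y z : stair y z 0 = y.
Proof. by apply/rowP => j; rewrite mxE. Qed.

Lemma stairn y z : stair y z n = z.
Proof. by apply/rowP => j; rewrite mxE ltn_ord. Qed.

Lemma stairS y z (k : 'I_n) :
  stair y z k.+1 = stair y z k + (z ord0 k - y ord0 k) *: ebase k.
Proof.
apply/rowP => j; rewrite !mxE eqxx/= ltnS leq_eqVlt.
have [->|jk] := eqVneq j k; first by rewrite eqxx ltnn/= mulr1 addrC subrK.
by rewrite mulr0 addr0 (negbTE (jk : (j != k :> nat))).
Qed.

(** Balls of the maximum norm are boxes, so the path does not leave them. *)
Lemma stair_ball y z x r (k : 'I_n) t : 0 < r -> `|y - x| < r -> `|z - x| < r ->
  0 <= t <= 1 -> `|stair y z k + (t * (z ord0 k - y ord0 k)) *: ebase k - x| < r.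
Proof.
move=> r0 yx zx /andP[t0 t1].
pose m := Num.max `|y - x| `|z - x|.
have my : `|y - x| <= m by rewrite le_max lexx.
have mz : `|z - x| <= m by rewrite le_max lexx orbT.
have mr : m < r by rewrite gt_max yx zx.
apply: le_lt_trans mr; apply: norm_le_coord; first exact: le_trans my.
move=> j; rewrite !mxE eqxx/=.
have ylej := le_trans (coord_le_norm (y - x) j) my.
have zlej := le_trans (coord_le_norm (z - x) j) mz.
rewrite !mxE in ylej zlej.
have [jk|jk] := eqVneq j k; last by rewrite mulr0 addr0; case: ifP.
rewrite -jk ltnn mulr1; move: ylej zlej; rewrite !ler_norml.
move=> /andP[a1 a2] /andP[b1 b2].
move: (y ord0 j) (z ord0 j) (x ord0 j) a1 a2 b1 b2 => Y Z X a1 a2 b1 b2.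
have t1' : 0 <= 1 - t by rewrite subr_ge0.
move: (m) a1 a2 b1 b2 => M a1 a2 b1 b2.
have p1 : 0 <= t * (Z - X + M) by rewrite mulr_ge0//; lra.
have p2 : 0 <= (1 - t) * (Y - X + M) by rewrite mulr_ge0//; lra.
have p3 : 0 <= t * (M - (Z - X)) by rewrite mulr_ge0//; lra.
have p4 : 0 <= (1 - t) * (M - (Y - X)) by rewrite mulr_ge0//; lra.
by apply/andP; split; lra.
Qed.

(** Strict differentiability from continuity of the partial derivatives: apply the
    mean value theorem on each step of the path from y to z. *)
Lemma C1_strict U f df x0 : C1_grad U f df -> U x0 -> forall e, 0 < e ->
  exists2 r, 0 < r & forall y z, `|y - x0| < r -> `|z - x0| < r ->
    `|f z - f y - \sum_i df i x0 * (z ord0 i - y ord0 i)| <= e * `|z - y|.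
Proof.
move=> hC Ux e e0; have [oU hf] := hC.
have n1 : (0 : R) < n.+1%:R by rewrite ltr0n.
have en : 0 < e / n.+1%:R by rewrite divr_gt0.
have /rV_near_ball[r r0 hr] :
    \forall w \near x0, U w /\ forall i, `|df i w - df i x0| <= e / n.+1%:R.
  near=> y; split; first by near: y; exact: open_nbhs_nbhs.
  near: y; apply: filter_forall => i.
  have [_ /(_ i)[_ ci]] := hf _ Ux.
  by near=> y; rewrite distrC; near: y; move/cvgrPdist_le : ci; exact.
exists r => // y z yx zx.
rewrite -[in f z](stairn y z) -[in f y](stair0 y z) -(@telescope_sumr _ 0 n (fun k => f (stair y z k)) (leq0n n)).
rewrite big_mkord -sumrB (le_trans (ler_norm_sum _ _ _))//.
have hk (k : 'I_n) : `|f (stair y z k.+1) - f (stair y z k)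
    - df k x0 * (z ord0 k - y ord0 k)| <= e / n.+1%:R * `|z - y|.
  set d := z ord0 k - y ord0 k.
  pose f' t := f (stair y z k + (t * d) *: ebase k).
  have hd (t : R) : 0 <= t <= 1 -> is_derive t (1:R) f' (df k (stair y z k + (t * d) *: ebase k) * d).
    move=> t01; have [Uw _] := hr _ (stair_ball k r0 yx zx t01).
    have [_ /(_ k)[dk _]] := hf _ Uw.
    have := is_derive_slice dk => dk'.
    apply: (@is_derive1_comp R _ (fun t => t * d) _ _ _ dk').
    have h1 := @is_deriveM R R id (cst d) t 1 _ _ (is_derive_id _ _)
      (is_derive_cst _ _ _).
    by apply: (is_derive_eq h1); rewrite scaler0 add0r [LHS]mulr1.
  have [||c c01 e1] := @MVT_segment R f'
    (fun t => df k (stair y z k + (t * d) *: ebase k) * d) 0 1 ler01.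
  - by move=> t; rewrite in_itv/= => /andP[/ltW ? /ltW ?]; apply: hd; apply/andP.
  - apply: derivable_within_continuous => t; rewrite in_itv/= => /hd.
    by case.
  move: e1; rewrite /f' mul1r mul0r scale0r addr0 -stairS subr0 mulr1 => ->.
  rewrite -mulrBl normrM; apply: ler_pM => //.
    by have [_] := hr _ (stair_ball k r0 yx zx c01); exact.
  by have := coord_le_norm (z - y) k; rewrite !mxE.
apply: le_trans (ler_sum _ (fun k _ => hk k)) _.
rewrite sumr_const card_ord -[leLHS]mulr_natl mulrA ler_wpM2r//.
by rewrite mulrCA ger_pMr// ler_pdivrMr// mul1r ler_nat.
Unshelve. all: by end_near. Qed.
End strict.

Section continuity.
Context {R : realType}.

Lemma continuous_sum_ord (T : topologicalType) m (F : 'I_m -> T -> R) (x : T) :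
  (forall i, {for x, continuous (F i)}) -> {for x, continuous (fun y => \sum_i F i y)}.
Proof.
move=> h; elim: (index_enum _) => [|i r ih].
  rewrite (_ : (fun _ => _) = cst 0); first exact: cst_continuous.
  by apply/funext => y; rewrite big_nil.
rewrite (_ : (fun _ => _) = (fun y => F i y + \sum_(j <- r) F j y)).
  exact: (@continuousD _ _ _ (F i) (fun y => \sum_(j <- r) F j y)).
by apply/funext => y; rewrite big_cons.
Qed.

Lemma continuous_row (T : topologicalType) m (F : 'I_m -> T -> R) (x : T) :
  (forall i, {for x, continuous (F i)}) ->
  {for x, continuous (fun y => \row_i F i y : 'rV[R]_m)}.
Proof.
move=> h; apply/cvgrPdist_le => e e0; near=> y.
apply: norm_le_coord; first exact: ltW.
move=> i; rewrite !mxE; move: i; near: y; apply: filter_forall => i.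
by have /cvgrPdist_le/(_ _ e0) := h i.
Unshelve. all: by end_near. Qed.

End continuity.

Section differentiability.
Context {R : realType} {n : nat}.
Implicit Types (x y z v : 'rV[R]_n) (i j : 'I_n) (f g : 'rV[R]_n -> R)
  (df dg : 'I_n -> 'rV[R]_n -> R) (U : set 'rV[R]_n).

Lemma C1_differentiable U f df x : C1_grad U f df -> U x ->
  differentiable f x /\ forall v, 'd f x v = \sum_i v ord0 i * df i x.
Proof.
move=> hC Ux.
pose L (v : 'rV[R]_n) : R := \sum_i v ord0 i * df i x.
have Ll : linear L.
  move=> a u v; rewrite /L scaler_sumr -big_split/=; apply: eq_bigr => i _.
  by rewrite !mxE mulrDl -mulrA.
pose L' : {linear 'rV[R]_n -> R} := HB.pack L (GRing.isLinear.Build _ _ _ _ L Ll).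
have cL : continuous L'.
  move=> y; apply: (@continuous_sum_ord _ _ _ (fun i (v : 'rV[R]_n) => v ord0 i * df i x)).
  move=> i; apply: (@continuousM _ _ (fun v : 'rV[R]_n => v ord0 i) (cst (df i x))).
    exact: coord_continuous.
  exact: cst_continuous.
pose g (h : 'rV[R]_n) : R := f x + L h.
pose fx (h : 'rV[R]_n) : R := f (h + x).
have e : fx = g +o_ (0 : 'rV[R]_n) id.
  apply/eqaddoP => e e0.
  have [r r0 hr] := C1_strict hC Ux e0.
  near=> h; rewrite !fctE/= /fx /g.
  have hh : `|h| < r.
    by near: h; apply/nbhs_ballP; exists r => // h; rewrite -ball_normE/= sub0r normrN.
  have := hr x (h + x); rewrite subrr normr0 addrK => /(_ r0 hh).
  rewrite (_ : \sum_i _ = L h)//=.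
    by rewrite opprD addrA.
  by apply: eq_bigr => i _; rewrite mxE addrK mulrC.
have d := diff_unique cL e.
split; last by move=> v; rewrite d.
by apply/diff_locallyP; rewrite d.
Unshelve. all: by end_near. Qed.

Lemma C1_is_derive U f df x v : C1_grad U f df -> U x ->
  is_derive x v f (\sum_i v ord0 i * df i x).
Proof.
move=> hC Ux; have [d e] := C1_differentiable hC Ux.
by split; [exact: diff_derivable|rewrite deriveE// e].
Qed.

(** The chain rule along a curve whose coordinates are differentiable. *)
Lemma C1_curve U f df (c : R -> 'rV[R]_n) (dc : 'I_n -> R) t : C1_grad U f df ->
  U (c t) -> (forall i, is_derive t (1 : R) (fun s => c s ord0 i) (dc i)) ->
  is_derive t (1 : R) (fun s => f (c s)) (\sum_i dc i * df i (c t)).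
Proof.
move=> hC Ux hc; have [d e] := C1_differentiable hC Ux.
have cd : derivable c t 1.
  by apply/derivable_mxP => i j; rewrite (ord1 i); case: (hc j).
have cdi : differentiable c t by apply/derivable1_diffP.
have fc : differentiable (f \o c) t by exact: differentiable_comp.
split; first exact/derivable1_diffP.
rewrite deriveE// diff_comp//= e; apply: eq_bigr => i _; congr (_ * _).
rewrite -deriveE// derive_mx// mxE.
by case: (hc i).
Qed.

Lemma line_MVT U f df x v (b : R) : C1_grad U f df -> 0 <= b ->
  (forall t, 0 <= t <= b -> U (x + t *: v)) ->
  exists2 c, 0 <= c <= b &
    f (x + b *: v) - f x = (\sum_i v ord0 i * df i (x + c *: v)) * b.
Proof.
move=> hC b0 hU.
have hd (t : R) : 0 <= t <= b ->
    is_derive t (1 : R) (fun s => f (x + s *: v)) (\sum_i v ord0 i * df i (x + t *: v)).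
  by move=> /hU Uw; apply: is_derive_slice; exact: C1_is_derive Uw.
have [||c cab e] := @MVT_segment R (fun s => f (x + s *: v))
    (fun t => \sum_i v ord0 i * df i (x + t *: v)) 0 b b0.
- by move=> t; rewrite in_itv/= => /andP[/ltW ? /ltW ?]; apply: hd; apply/andP.
- by apply: derivable_within_continuous => t; rewrite in_itv/= => /hd[].
by exists c => //; move: e; rewrite scale0r addr0 subr0.
Qed.

End differentiability.

Section chain.
Context {R : realType} {n : nat}.

Lemma C1_chain m (U : set 'rV[R]_n) (V : set 'rV[R]_m) f df
    (xi : 'I_m -> 'rV[R]_n -> R) dxi :
  open U -> C1_grad V f df -> (forall k, C1_grad U (xi k) (dxi k)) ->
  (forall x, U x -> V (\row_k xi k x)) ->
  C1_grad U (fun x => f (\row_k xi k x))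
    (fun j x => \sum_k dxi k j x * df k (\row_l xi l x)).
Proof.
move=> oU hC hxi UV; split=> // x Ux.
have cxi : {for x, continuous (fun y => \row_k xi k y : 'rV[R]_m)}.
  by apply: continuous_row => k; have [_ /(_ _ Ux)[]] := hxi k.
have [_ /(_ _ (UV _ Ux))[cf hf]] := hC.
split; first exact: (@continuous_comp _ _ _ (fun y => \row_k xi k y : 'rV[R]_m) f).
move=> j; split.
  apply: is_derive_unslice.
  have x0 : x = x + 0 *: ebase j by rewrite scale0r addr0.
  have := @C1_curve _ _ V f df (fun s => \row_k xi k (x + s *: ebase j))
    (fun k => dxi k j x) 0 hC.
  rewrite -x0; apply; first exact: UV.
  move=> k; rewrite (_ : (fun s => _) = (fun s => xi k (x + s *: ebase j))); last first.
    by apply/funext => s; rewrite mxE.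
  by apply: is_derive_slice; rewrite -x0; have [_ /(_ _ Ux)[_ /(_ j)[]]] := hxi k.
apply: (@continuous_sum_ord _ _ _ (fun k y => dxi k j y * df k (\row_l xi l y))) => k.
apply: (@continuousM _ _ (dxi k j) (fun y => df k (\row_l xi l y))).
  by have [_ /(_ _ Ux)[_ /(_ j)[]]] := hxi k.
apply: (@continuous_comp _ _ _ (fun y => \row_k xi k y : 'rV[R]_m) (df k)) => //.
by have [] := hf k.
Qed.

Lemma locally_bounded (T : topologicalType) (f : T -> R) (p : T) :
  {for p, continuous f} -> exists2 C, 0 < C & \forall x \near p, `|f x| <= C.
Proof.
move=> cf; exists (`|f p| + 1); first by rewrite ltr_wpDl.
near=> x; rewrite -lerBlDl; apply: (le_trans (lerB_dist _ _)).
rewrite distrC; near: x; move/cvgrPdist_le: cf; apply.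
exact: ltr01.
Unshelve. all: by end_near. Qed.

End chain.

(** * The norm F, its polar and the distance to the boundary *)

Section norm.
Context {R : realType} {n : nat} (F : 'rV[R]_n.+1 -> R).
Hypothesis hF : strongly_convex_norm F.
Implicit Types (x y z v w xi eta : 'rV[R]_n.+1).

Lemma finsler_ge0 x : 0 <= F x. Proof. by case: hF => -[]. Qed.

Lemma finslerZ t x : F (t *: x) = `|t| * F x. Proof. by case: hF. Qed.

Lemma finsler0 : F 0 = 0. Proof. by rewrite -(scale0r (0 : 'rV[R]_n.+1)) finslerZ normr0 mul0r. Qed.

(** Convexity at the midpoint together with homogeneity. *)
Lemma finsler_triangle x y : F (x + y) <= F x + F y.
Proof.
have [[_ cF] _ _ _ _] := hF.
have h0 : (0 : R) <= 2^-1 by rewrite invr_ge0.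
have h1 : (2^-1 : R) <= 1 by rewrite invf_le1// ler1n.
have := cF (Itv01 h0 h1) x y; rewrite !inE => /(_ I I).
rewrite convRE/= /unstable.onem => h.
have e : F (2^-1 *: (x + y)) <= 2^-1 * F x + (1 - 2^-1) * F y.
  by rewrite scalerDr; have -> : 2^-1 *: y = (1 - 2^-1) *: y by congr (_ *: _); lra.
by move: e; rewrite finslerZ ger0_norm//; lra.
Qed.

Definition finsler_ub : R := \sum_i F (ebase i).

Lemma finsler_ub_ge0 : 0 <= finsler_ub.
Proof. by apply: sumr_ge0 => i _; exact: finsler_ge0. Qed.

Lemma finsler_sum m (f : 'I_m -> 'rV[R]_n.+1) : F (\sum_i f i) <= \sum_i F (f i).
Proof.
elim/big_ind2 : _ => //; first by rewrite finsler0.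
by move=> a b c d ha hb; apply: le_trans (finsler_triangle _ _) _; rewrite lerD.
Qed.

Lemma finsler_le_ub x : F x <= finsler_ub * `|x|.
Proof.
rewrite [in F x](row_sum_ebase x); apply: le_trans (finsler_sum _) _.
rewrite /finsler_ub mulr_suml; apply: ler_sum => i _; rewrite finslerZ mulrC.
by rewrite ler_wpM2l ?finsler_ge0// coord_le_norm.
Qed.

Lemma finsler_dist x y : `|F x - F y| <= finsler_ub * `|x - y|.
Proof.
rewrite ler_norml; apply/andP; split.
  rewrite lerNl opprB lerBlDr; apply: le_trans (_ : F (y - x) + F x <= _).
    by rewrite -[in leLHS](subrK x y) finsler_triangle.
  by rewrite lerD2r distrC finsler_le_ub.
rewrite lerBlDr; apply: le_trans (_ : F (x - y) + F y <= _).
  by rewrite -[in leLHS](subrK y x) finsler_triangle.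
by rewrite lerD2r finsler_le_ub.
Qed.

Lemma lipschitz_continuous (V : normedModType R) (f : V -> R) (C : R) :
  (forall x y : V, `|f x - f y| <= C * `|x - y|) -> continuous f.
Proof.
move=> h x; apply/cvgrPdist_le => e e0.
have C1 : 0 < `|C| + 1 by rewrite ltr_wpDl.
near=> y; apply: le_trans (h _ _) _.
apply: (@le_trans _ _ ((`|C| + 1) * `|x - y|)).
  by rewrite ler_wpM2r// (le_trans (ler_norm _))// lerDl.
rewrite -ler_pdivlMl// mulrC.
near: y; apply: cvgr_dist_le; first exact: cvg_id.
by rewrite divr_gt0.
Unshelve. all: by end_near. Qed.

Lemma finsler_continuous : continuous F.
Proof. exact: (@lipschitz_continuous 'rV[R]_n.+1 F finsler_ub finsler_dist). Qed.

Lemma norm_le_enorm m (x : 'rV[R]_m) : `|x| <= enorm x.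
Proof.
apply: norm_le_coord; first exact: sqrtr_ge0.
move=> i; rewrite -sqrtr_sqr ler_sqrt; last first.
  by apply: sumr_ge0 => j _; rewrite -expr2 sqr_ge0.
rewrite /dotp (bigD1 i)//= -expr2 lerDl; apply: sumr_ge0 => j _.
by rewrite -expr2 sqr_ge0.
Qed.

Lemma finsler_lb : exists2 a, 0 < a & forall x, a * `|x| <= F x.
Proof.
have [_ _ [a a0 h] _ _] := hF; exists a => // x; apply: le_trans (h x).
by rewrite ler_pM2l// norm_le_enorm.
Qed.

Lemma finsler_gt0 x : x != 0 -> 0 < F x.
Proof.
by have [a a0 h] := finsler_lb => x0; apply: lt_le_trans (h x); rewrite mulr_gt0// normr_gt0.
Qed.

Lemma nonzero_open m : open [set x : 'rV[R]_m | x != 0].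
Proof.
rewrite (_ : [set _ | _] = ~` [set 0]); last by apply/seteqP; split => x /= /eqP.
by rewrite openC; exact: (@accessible_closed_set1 _ (@hausdorff_accessible _ (@norm_hausdorff _ _))).
Qed.

Lemma finsler_C1 : C1_grad [set x | x != 0] F (fun i => partial i F).
Proof.
apply: Ck1_C1_grad; first exact: nonzero_open.
have [_ _ _ [c h] _] := hF; split=> // i; have [d [c' _]] := h i.
by split.
Qed.

Definition finsler_grad xi : 'rV[R]_n.+1 := \row_i partial i F xi.

(** Differentiability of F along one direction, in the form used to pass to the
    limit in inequalities for difference quotients. *)
Lemma finsler_grad_approx xi eta e : xi != 0 -> 0 < e ->
  exists2 h, 0 < h < 1 & `|F (xi + h *: eta) - F xi - h * dotp eta (finsler_grad xi)| <= h * e.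
Proof.
move=> xi0 e0.
have E1 : 0 < `|eta| + 1 by rewrite ltr_wpDl.
have e1 : 0 < e / (`|eta| + 1) by rewrite divr_gt0.
have [r r0 hr] := C1_strict finsler_C1 xi0 e1.
pose h := Num.min 2^-1 (r / (2 * (`|eta| + 1))).
have h0 : 0 < h by rewrite lt_min invr_gt0 ltr0n/= divr_gt0// mulr_gt0.
have hr2 : h * (`|eta| + 1) < r.
  have : h <= r / (2 * (`|eta| + 1)) by rewrite ge_min lexx orbT.
  rewrite ler_pdivlMr ?mulr_gt0// => hh.
  by move: hh (mulr_gt0 h0 E1); rewrite mulrCA; move: (h * _) => X; lra.
exists h; first by rewrite h0/= gt_min invf_lt1// ltr1n.
have hn : `|xi + h *: eta - xi| <= h * `|eta| by rewrite addrC addKr normrZ gtr0_norm.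
have := hr xi (xi + h *: eta); rewrite subrr normr0 => /(_ r0).
have -> : \sum_i partial i F xi * ((xi + h *: eta) ord0 i - xi ord0 i) =
    h * dotp eta (finsler_grad xi).
  rewrite /dotp mulr_sumr; apply: eq_bigr => i _.
  by rewrite !mxE [_ + h * _]addrC addrK mulrC mulrA.
have hlt : `|xi + h *: eta - xi| < r.
  by apply: le_lt_trans hn _; apply: le_lt_trans hr2; rewrite ler_pM2l// lerDl.
move=> /(_ hlt) H; apply: le_trans H _.
rewrite mulrAC ler_pdivrMr//.
apply: (@le_trans _ _ (e * (h * `|eta|))); first by rewrite ler_pM2l.
rewrite [h * e]mulrC -!mulrA ler_pM2l// ler_pM2l// lerDl//.
Qed.

(** Subadditivity bounds the difference quotients of F in the direction eta by
    F(eta): the gradient of F lies in the unit ball of the polar norm. *)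
Lemma finsler_grad_le xi eta : xi != 0 -> dotp eta (finsler_grad xi) <= F eta.
Proof.
move=> xi0; apply/ler_addgt0Pr => e e0.
have [h /andP[h0 h1] H] := finsler_grad_approx eta xi0 e0.
rewrite -(ler_pM2l h0) mulrDr.
have := finsler_triangle xi (h *: eta); rewrite finslerZ gtr0_norm// => T.
by move: H; rewrite ler_norml => /andP[H _]; lra.
Qed.

(** Euler's identity for a function homogeneous of degree one. *)
Lemma finsler_grad_self xi : xi != 0 -> dotp xi (finsler_grad xi) = F xi.
Proof.
move=> xi0; apply/eqP; rewrite eq_le finsler_grad_le//=.
apply/ler_addgt0Pr => e e0.
have [h /andP[h0 h1] H] := finsler_grad_approx xi xi0 e0.
have e1 : F (xi + h *: xi) = (1 + h) * F xi.
  by rewrite -[X in X + _]scale1r -scalerDl finslerZ gtr0_norm// ltr_wpDr// ltW.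
rewrite -(ler_pM2l h0) mulrDr.
by move: H; rewrite e1 ler_norml => /andP[_ H]; lra.
Qed.

Lemma finsler_grad_coord xi i : xi != 0 -> `|finsler_grad xi ord0 i| <= finsler_ub.
Proof.
move=> xi0.
have h (s : R) : dotp (s *: ebase i) (finsler_grad xi) = s * finsler_grad xi ord0 i.
  rewrite /dotp (bigD1 i)//= big1 ?addr0; first by rewrite !mxE !eqxx mulr1.
  by move=> j ji; rewrite !mxE eqxx (negbTE ji) mulr0 mul0r.
have b : F (ebase i) <= finsler_ub.
  by rewrite /finsler_ub (bigD1 i)//= lerDl; apply: sumr_ge0 => j _; exact: finsler_ge0.
have h1 := finsler_grad_le (1 *: ebase i) xi0.
have h2 := finsler_grad_le ((-1) *: ebase i) xi0.
rewrite !h !finslerZ normrN1 normr1 !mul1r mulN1r in h1 h2.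
rewrite ler_norml; apply/andP; split; first by rewrite lerNl (le_trans h2).
exact: le_trans h1 b.
Qed.

End norm.

Section polar.
Context {R : realType} {n : nat} (F : 'rV[R]_n.+1 -> R).
Hypothesis hF : strongly_convex_norm F.
Implicit Types (x y z v w xi eta : 'rV[R]_n.+1).

Lemma dotp_le xi x : dotp xi x <= n.+1%:R * `|xi| * `|x|.
Proof.
rewrite /dotp; apply: (@le_trans _ _ (\sum_(i < n.+1) (`|xi| * `|x|))).
  apply: ler_sum => i _; apply: le_trans (ler_norm _) _; rewrite normrM.
  by rewrite ler_pM// coord_le_norm.
by rewrite sumr_const card_ord -[leLHS]mulr_natl mulrA.
Qed.

Lemma dotpDr xi x y : dotp xi (x + y) = dotp xi x + dotp xi y.
Proof. by rewrite /dotp -big_split/=; apply: eq_bigr => i _; rewrite mxE mulrDr. Qed.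

Lemma dotpZr xi t x : dotp xi (t *: x) = t * dotp xi x.
Proof. by rewrite /dotp mulr_sumr; apply: eq_bigr => i _; rewrite mxE mulrCA. Qed.

Lemma dotpC x y : dotp x y = dotp y x.
Proof. by apply: eq_bigr => i _; rewrite mulrC. Qed.

Lemma ebase_neq0 (i : 'I_n.+1) : ebase i != 0 :> 'rV[R]_n.+1.
Proof. by rewrite -normr_gt0 norm_ebase ltr01. Qed.

Lemma polar_set_nonempty x : [set dotp xi x / F xi | xi in [set xi | xi != 0]] !=set0.
Proof. by exists (dotp (ebase ord0) x / F (ebase ord0)), (ebase ord0) => //=; exact: ebase_neq0. Qed.

Lemma polar_le x c : (forall xi, dotp xi x <= c * F xi) -> polar F x <= c.
Proof.
move=> h; apply: ge_sup; first exact: polar_set_nonempty.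
by move=> _ [xi xi0 <-]; rewrite ler_pdivrMr// finsler_gt0.
Qed.

Lemma polar_ubound x : has_ubound [set dotp xi x / F xi | xi in [set xi | xi != 0]].
Proof.
have [a a0 h] := finsler_lb hF; exists (n.+1%:R * `|x| / a) => _ [xi xi0 <-].
rewrite ler_pdivrMr ?finsler_gt0//; apply: le_trans (dotp_le _ _) _.
rewrite mulrAC [_ / a * _]mulrAC ler_pdivlMr// -!mulrA.
by rewrite ler_pM2l ?ltr0n// ler_wpM2l// mulrC.
Qed.

Lemma dotp_polar xi x : dotp xi x <= polar F x * F xi.
Proof.
have [->|xi0] := eqVneq xi 0.
  by rewrite (finsler0 hF) mulr0 /dotp big1// => i _; rewrite mxE mul0r.
rewrite -ler_pdivrMr ?finsler_gt0//; apply: ub_le_sup; first exact: polar_ubound.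
by exists xi.
Qed.

Lemma polarD x y : polar F (x + y) <= polar F x + polar F y.
Proof. by apply: polar_le => xi; rewrite dotpDr mulrDl lerD// dotp_polar. Qed.

Lemma polar_ub : exists2 C, 0 < C & forall x, polar F x <= C * `|x|.
Proof.
have [a a0 h] := finsler_lb hF; exists (n.+1%:R / a); first by rewrite divr_gt0// ltr0n.
move=> x; apply: polar_le => xi; apply: le_trans (dotp_le _ _) _.
by rewrite -!mulrA ler_pM2l ?ltr0n// ler_pdivlMl// mulrA [leRHS]mulrC ler_wpM2r.
Qed.

Lemma finsler_ub_gt0 : 0 < finsler_ub F.
Proof.
apply: lt_le_trans (finsler_gt0 hF (ebase_neq0 ord0)) _.
by rewrite /finsler_ub (bigD1 ord0)//= lerDl; apply: sumr_ge0 => j _; exact: finsler_ge0.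
Qed.

Lemma dotp_self_ge x : `|x| ^+ 2 <= dotp x x.
Proof.
rewrite -(@sqr_sqrtr _ (dotp x x)); last first.
  by apply: sumr_ge0 => i _; rewrite -expr2 sqr_ge0.
by rewrite ler_pXn2r ?nnegrE ?sqrtr_ge0//; exact: norm_le_enorm.
Qed.

(** Test the supremum with x itself; this is what makes the distance to the
    boundary positive inside the domain. *)
Lemma polar_lb x : (finsler_ub F)^-1 * `|x| <= polar F x.
Proof.
have [->|x0] := eqVneq x 0.
  have := dotp_polar (ebase ord0) 0; rewrite normr0 mulr0.
  rewrite (_ : dotp _ _ = 0); last by rewrite /dotp big1// => i _; rewrite !mxE mulr0.
  by rewrite pmulr_lge0// finsler_gt0// ebase_neq0.
have xp : 0 < `|x| by rewrite normr_gt0.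
have h : `|x| ^+ 2 <= polar F x * (finsler_ub F * `|x|).
  apply: le_trans (dotp_self_ge x) _; apply: le_trans (dotp_polar x x) _.
  rewrite ler_wpM2l ?finsler_le_ub//.
  have := le_trans (sqr_ge0 _) (le_trans (dotp_self_ge x) (dotp_polar x x)).
  by rewrite pmulr_lge0// finsler_gt0.
rewrite ler_pdivrMl ?finsler_ub_gt0// -(ler_pM2r xp) -expr2.
by apply: le_trans h _; rewrite mulrA [_ * finsler_ub F]mulrC.
Qed.

Lemma polar_ge0 x : 0 <= polar F x.
Proof. by apply: le_trans (polar_lb x); rewrite mulr_ge0// invr_ge0 ltW// finsler_ub_gt0. Qed.

End polar.

Section distance.
Context {R : realType} {n : nat} (F : 'rV[R]_n.+1 -> R) (Omega : set 'rV[R]_n.+1).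
Hypotheses (hF : strongly_convex_norm F) (oO : open Omega) (hb : boundary Omega !=set0).
Implicit Types (x y z v w xi eta : 'rV[R]_n.+1).
Let dF := anisotropic_dist F Omega.

Let dset_nonempty x : [set polar F (x - y) | y in boundary Omega] !=set0.
Proof. by have [y hy] := hb; exists (polar F (x - y)), y. Qed.

Let dset_lb x : has_lbound [set polar F (x - y) | y in boundary Omega].
Proof. by exists 0 => _ [y _ <-]; exact: polar_ge0. Qed.

Lemma dist_le x y : boundary Omega y -> dF x <= polar F (x - y).
Proof. by move=> hy; apply: ge_inf => //; exists y. Qed.

Lemma dist_ge x c : (forall y, boundary Omega y -> c <= polar F (x - y)) -> c <= dF x.
Proof. by move=> h; apply: lb_le_inf => // _ [y hy <-]; exact: h. Qed.

Lemma dist_le_add x y : dF x <= polar F (x - y) + dF y.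
Proof.
rewrite -lerBlDl; apply: dist_ge => z hz; rewrite lerBlDl.
apply: le_trans (dist_le _ hz) _.
have -> : x - z = (x - y) + (y - z) by rewrite addrA subrK.
exact: polarD.
Qed.

(** The triangle inequality for the polar norm. *)
Lemma dist_lipschitz : exists C, forall x y, `|dF x - dF y| <= C * `|x - y|.
Proof.
have [C C0 h] := polar_ub hF; exists C => x y.
rewrite ler_norml lerNl opprB lerBlDr lerBlDr; apply/andP; split.
  by apply: le_trans (dist_le_add _ x) _; rewrite lerD2r distrC h.
by apply: le_trans (dist_le_add _ y) _; rewrite lerD2r h.
Qed.

Lemma dist_continuous : continuous dF.
Proof. by have [C h] := dist_lipschitz; exact: (@lipschitz_continuous _ 'rV[R]_n.+1 dF C h). Qed.

Lemma boundary_not_in x : boundary Omega x -> ~ Omega x.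
Proof. by move=> [_ h] Ox; apply: h; rewrite (interior_id _).1. Qed.

Lemma dist_gt0 x : Omega x -> 0 < dF x.
Proof.
move=> Ox; have /rV_near_ball[r r0 hr] : \forall y \near x, Omega y by exact: open_nbhs_nbhs.
apply: (@lt_le_trans _ _ ((finsler_ub F)^-1 * r)).
  by rewrite mulr_gt0// invr_gt0 finsler_ub_gt0.
apply: dist_ge => y hy; apply: le_trans (polar_lb hF _).
rewrite ler_pM2l ?invr_gt0 ?finsler_ub_gt0// leNgt distrC; apply/negP => /hr.
exact: boundary_not_in.
Qed.

End distance.

(** * Borel sets and integrals over R^n *)

Section borel.
Context {R : realType} {n : nat}.
Implicit Types (x y : 'rV[R]_n).

Lemma ball_rVP x r y : ball x r y <-> `|y - x| < r.
Proof. by rewrite -ball_normE/= distrC. Qed.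

Lemma ball_coord x r : 0 < r ->
  ball x r = \bigcap_(i in [set: 'I_n]) [set y : 'rV[R]_n | ball (x ord0 i) r (y ord0 i)].
Proof.
move=> r0; apply/seteqP; split => y /=.
  by move=> /= [_ h] i _; exact: h.
by move=> h; split=> // i j; rewrite (ord1 i); exact: h.
Qed.

Lemma measurable_ball_rV x r : measurable (ball x r).
Proof.
have [r0|r0] := leP r 0.
  rewrite (_ : ball x r = set0)//; apply/seteqP; split => // y /ball_rVP h.
  by have := le_lt_trans (normr_ge0 _) (lt_le_trans h r0); rewrite ltxx.
rewrite ball_coord//; apply: fin_bigcap_measurable => // i _.
rewrite -[X in measurable X]setTI; apply: (measurable_coord i measurableT).
by rewrite ball_itv; exact: measurable_itv.
Qed.

(** The sigma-algebra is generated by the coordinates, so open sets have to be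
    written as countable unions of boxes with rational centres. *)
Lemma open_measurable_rV (U : set 'rV[R]_n) : open U -> measurable U.
Proof.
move=> oU.
pose q2x (q : 'rV[rat]_n) : 'rV[R]_n := map_mx ratr q.
pose B (p : 'rV[rat]_n * nat) : set 'rV[R]_n :=
  [set y | ball (q2x p.1) p.2.+1%:R^-1 y /\ ball (q2x p.1) p.2.+1%:R^-1 `<=` U].
have -> : U = \bigcup_p B p.
  apply/seteqP; split => x; last by move=> [p _ [h]]; exact.
  move=> Ux; have /rV_near_ball[r r0 hr] : \forall y \near x, U y by exact: open_nbhs_nbhs.
  have [k hk] : exists k : nat, k.+1%:R^-1 < r / 2.
    have r2 : 0 < r / 2 by rewrite divr_gt0.
    have := @near_infty_natSinv_lt R (PosNum r2) => -[N _ hN].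
    by exists N; exact: (hN N (leqnn N)).
  have k0 : 0 < k.+1%:R^-1 :> R by rewrite invr_gt0.
  have hq i : {q : rat | `|x ord0 i - ratr q| < k.+1%:R^-1}.
    apply: cid; have [|q] := @rat_in_itvoo R (x ord0 i - k.+1%:R^-1) (x ord0 i + k.+1%:R^-1).
      by rewrite ltrD2l (lt_trans _ k0)// oppr_lt0.
    by rewrite in_itv/= => /andP[h1 h2]; exists q; rewrite distrC ltr_distl h1 h2.
  pose q := \row_i sval (hq i).
  have hqx : `|x - q2x q| < k.+1%:R^-1.
    have [n0|/negP n0] := pselect (n == 0)%N.
      rewrite (_ : x - q2x q = 0) ?normr0//; apply/rowP => -[j jn].
      by exfalso; move: jn; rewrite (eqP n0).
    rewrite [ltLHS]/Num.norm/= mx_normrE; apply/bigmax_ltP; split=> // -[a b] _ /=.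
    by rewrite (ord1 a) !mxE; exact: (svalP (hq b)).
  exists (q, k) => //; split=> /=; first exact/ball_rVP.
  move=> y /ball_rVP hy; apply: hr.
  have -> : y - x = (y - q2x q) - (x - q2x q) by rewrite opprB addrA subrK.
  by apply: (le_lt_trans (ler_normB _ _)); rewrite (splitr r) ltrD// (lt_trans _ hk).
apply: countable_bigcupT_measurable => [|p]; first exact: countableP.
have [h|h] := pselect (ball (q2x p.1) p.2.+1%:R^-1 `<=` U).
  rewrite (_ : B p = ball (q2x p.1) p.2.+1%:R^-1); first exact: measurable_ball_rV.
  by apply/seteqP; split => y; [case|].
rewrite (_ : B p = set0)//; apply/seteqP; split => // y [_ h']; exact: h.
Qed.

Lemma continuous_measurable_rV (f : 'rV[R]_n -> R) : continuous f -> measurable_fun setT f.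
Proof.
move=> /continuousP cf; apply: (measurability _ (RGenOpens.measurableE R)).
move=> _ [_ [a [b ->] <-]]; rewrite setTI.
by apply: open_measurable_rV; apply: cf; exact: interval_open.
Qed.

End borel.

Section ball_measure.
Context {R : realType}.

Lemma rV_cons_ord0 n (p : R * 'rV[R]_n) : rV_cons p ord0 ord0 = p.1.
Proof. by rewrite /rV_cons mxE unlift_none. Qed.

Lemma rV_cons_lift n (p : R * 'rV[R]_n) j : rV_cons p ord0 (lift ord0 j) = p.2 ord0 j.
Proof. by rewrite /rV_cons mxE liftK. Qed.

Lemma rV_consP n (x y : 'rV[R]_n.+1) : x ord0 ord0 = y ord0 ord0 ->
  (forall j, x ord0 (lift ord0 j) = y ord0 (lift ord0 j)) -> x = y.
Proof.
by move=> h0 h; apply/rowP => i; case: (unliftP ord0 i) => [j ->|->].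
Qed.

Lemma norm_rV_cons n (p : R * 'rV[R]_n) (c : R) : 0 <= c ->
  `|rV_cons p| <= c <-> `|p.1| <= c /\ `|p.2| <= c.
Proof.
move=> c0; split=> [h|[h1 h2]].
  split; first by have := le_trans (coord_le_norm _ ord0) h; rewrite rV_cons_ord0.
  apply: norm_le_coord => // j.
  by have := le_trans (coord_le_norm _ (lift ord0 j)) h; rewrite rV_cons_lift.
apply: norm_le_coord => // i; case: (unliftP ord0 i) => [j ->|->].
  by rewrite rV_cons_lift (le_trans (coord_le_norm _ _)).
by rewrite rV_cons_ord0.
Qed.

Lemma rV_consB n (p q : R * 'rV[R]_n) :
  rV_cons p - rV_cons q = rV_cons (p.1 - q.1, p.2 - q.2).
Proof.
apply: rV_consP => [|j]; first by rewrite rV_cons_ord0 !mxE !unlift_none.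
by rewrite rV_cons_lift !mxE !liftK.
Qed.

Lemma preimage_ball_cons n (a : R * 'rV[R]_n) r : 0 < r ->
  @rV_cons R n @^-1` ball (rV_cons a) r = ball a.1 r `*` ball a.2 r.
Proof.
move=> r0; rewrite !ball_coord//; apply/seteqP; split => -[t y] /=.
  move=> h; split; first by have := h ord0 I; rewrite /= !rV_cons_ord0.
  by move=> i _; have := h (lift ord0 i) I; rewrite /= !rV_cons_lift.
move=> [h1 h2] i _; case: (unliftP ord0 i) => [j ->|->] /=.
  by rewrite !rV_cons_lift; exact: h2.
by rewrite !rV_cons_ord0.
Qed.

(** A ball of the maximum norm is a cube, so its measure factors through the
    iterated product defining the measure. *)
Lemma lebesgue_rV_ball n (x : 'rV[R]_n) r : 0 < r ->
  lebesgue_rV n (ball x r) = ((r *+ 2) ^+ n)%:E.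
Proof.
elim: n x => [|n ih] x r0.
  rewrite expr0 /= diracE mem_set//= (_ : 0 = x)//; first exact: ballxx.
  by apply/rowP => -[].
have -> : x = rV_cons (rV_uncons x).
  apply: rV_consP => [|j]; first by rewrite rV_cons_ord0.
  by rewrite rV_cons_lift mxE.
transitivity ((@lebesgue_measure R \x lebesgue_rV n)%E
    (@rV_cons R n @^-1` ball (rV_cons (rV_uncons x)) r)); first by [].
rewrite preimage_ball_cons// product_measure1E//; first last.
- exact: measurable_ball_rV.
- by rewrite ball_itv; exact: measurable_itv.
by rewrite exprS EFinM; congr (_ * _)%E; [exact/lebesgue_measure_ball/ltW|exact: ih].
Qed.

End ball_measure.

Section compact_support.
Context {R : realType}.

Lemma bounded_support_integrable d (T : measurableType d)
    (mu : {measure set T -> \bar R}) (f : T -> R) (A D : set T) (C : R) :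
  measurable D -> measurable A -> (mu A < +oo)%E -> measurable_fun setT f ->
  (forall x, `|f x| <= C) -> (forall x, ~ A x -> f x = 0) ->
  mu.-integrable D (EFin \o f).
Proof.
move=> mD mA Afin mf fC f0.
suff : mu.-integrable setT (EFin \o f) by apply: integrableS.
have -> : EFin \o f = (EFin \o f) \_ A.
  apply/funext => x; rewrite patchE; case: ifPn => // /negP xA /=.
  by rewrite f0// => Ax; apply: xA; rewrite inE.
apply/(integrable_mkcond _ mA); apply: measurable_bounded_integrable => //.
  exact: measurable_funS mf.
by exists C; split; [exact: num_real|move=> M CM x _ /=; exact: le_trans (fC x) (ltW CM)].
Qed.

Lemma bounded_support_bounded n (f : 'rV[R]_n -> R) (M : R) : continuous f ->
  (forall x, M <= `|x| -> f x = 0) -> exists2 C, 0 <= C & forall x, `|f x| <= C.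
Proof.
move=> cf f0.
have cB : compact [set x : 'rV[R]_n | `|x| <= M].
  apply: bounded_closed_compact.
    by exists M; split; [exact: num_real|move=> N MN x /= xM; exact: le_trans xM (ltW MN)].
  rewrite (_ : [set _ | _] = Num.norm @^-1` [set t | t <= M])//.
  by apply: closed_comp => [x _|]; [exact: norm_continuous|exact: closed_le].
have : compact (f @` [set x : 'rV[R]_n | `|x| <= M]).
  by apply: continuous_compact => //; exact: continuous_subspaceT.
move=> /compact_bounded[C [_ hC]].
have C1 : C < `|C| + 1 by rewrite (le_lt_trans (ler_norm _))// ltrDl.
exists (`|C| + 1); first by rewrite addr_ge0.
move=> x; have [h|/ltW h] := leP `|x| M.
  by apply: (hC _ C1); exists x.
by rewrite f0// normr0 addr_ge0.
Qed.

Lemma continuous_support_integrable n (f : 'rV[R]_n -> R) (M : R) D : measurable D ->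
  continuous f -> (forall x, M <= `|x| -> f x = 0) ->
  (lebesgue_rV n).-integrable D (EFin \o f).
Proof.
move=> mD cf f0; have [C C0 hC] := bounded_support_bounded cf f0.
have N0 : 0 < `|M| + 1 by rewrite ltr_wpDl.
apply: (@bounded_support_integrable _ _ (lebesgue_rV n) f (ball 0 (`|M| + 1)) D C) => //.
- exact: measurable_ball_rV.
- by move: (lebesgue_rV_ball (0 : 'rV[R]_n) N0) => /= ->; exact: ltry.
- exact: continuous_measurable_rV.
- move=> x h; apply: f0; rewrite leNgt; apply/negP => xM; apply: h.
  by apply/ball_rVP; rewrite subr0 (lt_trans xM)// (le_lt_trans (ler_norm _))// ltrDl.
Qed.

Lemma measurable_rV_consR n :
  measurable_fun [set: (measurableTypeR R * 'rV[R]_n)%type] (@rV_cons R n).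
Proof. by move=> _ A mA; exact: measurable_rV_cons. Qed.

(** Splits off the first coordinate; compact support provides the integrability
    that Fubini's theorem asks for. *)
Lemma integral_rV_cons n (f : 'rV[R]_n.+1 -> R) (M : R) :
  continuous f -> (forall x, M <= `|x| -> f x = 0) ->
  (lebesgue_measure \x lebesgue_rV n)%E.-integrable setT
    (EFin \o (f \o @rV_cons R n)) /\
  (\int[lebesgue_rV n.+1]_x (f x)%:E =
   \int[(lebesgue_measure \x lebesgue_rV n)]_p (EFin \o (f \o @rV_cons R n)) p)%E.
Proof.
move=> cf f0; have [C C0 hC] := bounded_support_bounded cf f0.
have mf := continuous_measurable_rV cf.
have N0 : 0 < `|M| + 1 by rewrite ltr_wpDl.
have i1 : (lebesgue_measure \x lebesgue_rV n)%E.-integrable setT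
    (EFin \o (f \o @rV_cons R n)).
  apply: (@bounded_support_integrable _ _ (lebesgue_measure \x lebesgue_rV n)%E
    (f \o @rV_cons R n) (@rV_cons R n @^-1` ball 0 (`|M| + 1)) _ C) => //.
  - rewrite -[X in measurable X]setTI; apply: measurable_rV_cons => //.
    exact: measurable_ball_rV.
  - have := @lebesgue_rV_ball R n.+1 0 _ N0; rewrite /= /rV_cons_measure /pushforward => ->.
    exact: ltry.
  - by apply: measurableT_comp => //; exact: measurable_rV_consR.
  - by move=> x; exact: hC.
  - move=> x h; apply: f0; rewrite leNgt; apply/negP => xM; apply: h.
    by apply/ball_rVP; rewrite subr0 (lt_trans xM)// (le_lt_trans (ler_norm _))// ltrDl.
split=> //.
have mEf : measurable_fun setT (EFin \o f) by exact/measurable_EFinP.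
exact: (integral_pushforward (@measurable_rV_consR n) mEf i1 measurableT).
Qed.

End compact_support.

(** * Integrals of partial derivatives *)

Section divergence.
Context {R : realType}.

Lemma derive_support n (w dw : 'rV[R]_n -> R) (v : 'rV[R]_n) M :
  (forall x, is_derive x v w (dw x)) -> (forall x, M <= `|x| -> w x = 0) ->
  forall x, M < `|x| -> dw x = 0.
Proof.
move=> hw w0 x Mx.
have h : \forall y \near x, (cst 0 : 'rV[R]_n -> R) y = w y.
  near=> y; rewrite w0//; apply/ltW; near: y.
  have cn : {for x, continuous (Num.norm : 'rV[R]_n -> R)} by exact: norm_continuous.
  exact: (cvgr_gt _ cn).
have := near_eq_is_derive h (is_derive_cst 0 x v) => -[_ <-].
by have [_ ->] := hw x.
Unshelve. all: by end_near. Qed.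

Lemma integral_derive0 (g dg : R -> R) (M : R) : continuous dg ->
  (forall t, is_derive t (1 : R) g (dg t)) -> (forall t, M <= `|t| -> g t = 0) ->
  (\int[lebesgue_measure]_t (dg t)%:E = 0)%E.
Proof.
move=> cdg hg g0.
have dg0 t : M < `|t| -> dg t = 0.
  move=> Mt; have h : \forall y \near t, (cst 0 : R -> R) y = g y.
    near=> y; rewrite g0//; apply/ltW; near: y.
    have cn : {for t, continuous (Num.norm : R -> R)} by exact: norm_continuous.
    exact: (cvgr_gt _ cn).
  have := near_eq_is_derive h (is_derive_cst 0 t 1) => -[_ <-].
  by have [_ ->] := hg t.
pose N : R := `|M| + 1.
have N0 : 0 < N by rewrite ltr_wpDl.
have MN : M < N by rewrite (le_lt_trans (ler_norm _))// ltrDl.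
transitivity (\int[lebesgue_measure]_(t in `[(- N)%R, N%R]) (dg t)%:E)%E.
  rewrite [RHS]integral_mkcond; apply: eq_integral => t _.
  rewrite patchE; case: ifPn => // /negP h; congr (_%:E); apply: dg0.
  rewrite (lt_le_trans MN)// leNgt; apply/negP => tN; apply: h.
  by rewrite inE/= in_itv/= -ler_norml ltW.
have cg t : {for t, continuous g}.
  by apply/differentiable_continuous/derivable1_diffP; case: (hg t).
rewrite (@continuous_FTC2 R dg g)//.
- by rewrite !g0 ?subee// ?normrN gtr0_norm// ltW.
- by rewrite (lt_trans _ N0)// oppr_lt0.
- by apply: continuous_subspaceT.
- split; first by move=> t _; case: (hg t).
    exact/cvg_at_right_filter/cg.
  exact/cvg_at_left_filter/cg.
- by move=> t _; rewrite derive1E; case: (hg t).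
Unshelve. all: by end_near. Qed.

Lemma rV_cons_continuousl n (y : 'rV[R]_n) (f : 'rV[R]_n.+1 -> R) : continuous f ->
  continuous (fun t : R => f (rV_cons (t, y))).
Proof.
move=> cf t; apply: (@continuous_comp _ _ _ (fun t : R => rV_cons (t, y)) f); last exact: cf.
apply/cvgrPdist_le => e e0; near=> s; rewrite rV_consB/= subrr.
apply/norm_rV_cons; first exact: ltW.
rewrite /= normr0; split; last exact: ltW.
by near: s; apply: cvgr_dist_le; first exact: cvg_id.
Unshelve. all: by end_near. Qed.

Lemma rV_cons_continuousr n (t : R) (f : 'rV[R]_n.+1 -> R) : continuous f ->
  continuous (fun y : 'rV[R]_n => f (rV_cons (t, y))).
Proof.
move=> cf y; apply: (@continuous_comp _ _ _ (fun y : 'rV[R]_n => rV_cons (t, y)) f); last exact: cf.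
apply/(@cvgrPdist_le R _ _ (nbhs (y : 'rV[R]_n))) => e e0; near=> s; rewrite rV_consB/= subrr.
apply/norm_rV_cons; first exact: ltW.
rewrite /= normr0; split; first exact: ltW.
by near: s; apply: cvgr_dist_le; first exact: cvg_id.
Unshelve. all: by end_near. Qed.

Lemma rV_cons_add0 n (t s : R) (y : 'rV[R]_n) :
  (rV_cons (t, y) + s *: ebase ord0)%R = rV_cons (t + s, y) :> 'rV[R]_n.+1.
Proof.
apply: rV_consP => [|j].
  by rewrite rV_cons_ord0 mxE rV_cons_ord0 !mxE eqxx mulr1.
by rewrite rV_cons_lift mxE rV_cons_lift !mxE/= mulr0 addr0.
Qed.

Lemma rV_cons_add n (t s : R) (y : 'rV[R]_n) j :
  rV_cons (t, y) + s *: ebase (lift ord0 j) = rV_cons (t, y + s *: ebase j).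
Proof.
apply: rV_consP => [|k].
  by rewrite rV_cons_ord0 mxE rV_cons_ord0 !mxE/= mulr0 addr0.
rewrite rV_cons_lift mxE rV_cons_lift !mxE/= (inj_eq lift_inj).
by [].
Qed.

Lemma norm_rV_cons_ge n (p : R * 'rV[R]_n) (M : R) :
  (M <= `|p.1| -> M <= `|rV_cons p|) /\ (M <= `|p.2| -> M <= `|rV_cons p|).
Proof.
have [h1 h2] := (norm_rV_cons p (normr_ge0 (rV_cons p))).1 (lexx _).
by split=> h; exact: le_trans h _.
Qed.

(** Integrate first in the i-th variable, where the fundamental theorem of calculus
    gives zero. The first coordinate is split off by Fubini's theorem; either it
    is the i-th one, or the dimension decreases. *)
Lemma integral_partial0 n i (w dw : 'rV[R]_n -> R) M :
  continuous w -> continuous dw -> (forall x, is_derive x (ebase i) w (dw x)) ->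
  (forall x, M <= `|x| -> w x = 0) -> (\int[lebesgue_rV n]_x (dw x)%:E = 0)%E.
Proof.
elim: n i w dw => [[]//|n ih] i w dw cw cdw hw w0.
have dw0 x : M + 1 <= `|x| -> dw x = 0.
  by move=> h; apply: (derive_support hw w0); rewrite (lt_le_trans _ h)// ltrDl.
have [i1 ->] := integral_rV_cons cdw dw0.
case: (unliftP ord0 i) => [j|] ei; rewrite {}ei in hw.
- rewrite -integral12_prod_meas1// /fubini_F; apply: integral0_eq => t _.
  apply: (ih j (fun y => w (rV_cons (t, y))) (fun y => dw (rV_cons (t, y)))).
  + exact: rV_cons_continuousr.
  + exact: rV_cons_continuousr.
  + move=> y; apply: is_derive_unslice.
    rewrite (_ : (fun s => _) = (fun s : R => w (rV_cons (t, y) + s *: ebase (lift ord0 j)))).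
      by apply: is_derive_slice; rewrite scale0r addr0.
    by apply/funext => s; rewrite rV_cons_add.
  + by move=> y hy; apply: w0; apply: (norm_rV_cons_ge (t, y) M).2.
- rewrite -integral21_prod_meas1// /fubini_G; apply: integral0_eq => y _.
  apply: (@integral_derive0 (fun t => w (rV_cons (t, y))) (fun t => dw (rV_cons (t, y))) M).
  + exact: rV_cons_continuousl.
  + move=> t.
    have := @is_derive_slice R _ w (rV_cons (0, y)) (ebase ord0) t (dw (rV_cons (t, y))).
    rewrite rV_cons_add0 add0r => /(_ (hw _)).
    rewrite (_ : (fun s => _) = (fun s : R => w (rV_cons (s, y))))//.
    by apply/funext => s; rewrite rV_cons_add0 add0r.
  + by move=> t ht; apply: w0; apply: (norm_rV_cons_ge (t, y) M).1.
Qed.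

End divergence.

(** * Smooth kernels on the line *)

Section derivative_rules.
Context {R : realType}.
Implicit Types (f g : R -> R) (x a b : R).

Lemma derM f g x a b : is_derive x (1:R) f a -> is_derive x (1:R) g b ->
  is_derive x (1:R) (fun t => f t * g t) (f x * b + g x * a).
Proof. exact: is_deriveM. Qed.

Lemma derD f g x a b : is_derive x (1:R) f a -> is_derive x (1:R) g b ->
  is_derive x (1:R) (fun t => f t + g t) (a + b).
Proof. exact: is_deriveD. Qed.

Lemma derC (c x : R) : is_derive x (1:R) (fun=> c) 0.
Proof. exact: is_derive_cst. Qed.

Lemma derI x : is_derive x (1:R) (fun t => t) 1.
Proof. exact: is_derive_id. Qed.

Lemma derE f x a b : is_derive x (1:R) f a -> a = b -> is_derive x (1:R) f b.
Proof. by move=> ? <-. Qed.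

Lemma derMl c f x a : is_derive x (1:R) f a -> is_derive x (1:R) (fun t => c * f t) (c * a).
Proof. by move=> h; apply: (derE (derM (derC c x) h)); rewrite mulr0 addr0. Qed.

Lemma derN f x a : is_derive x (1:R) f a -> is_derive x (1:R) (fun t => - f t) (- a).
Proof. exact: is_deriveN. Qed.

Lemma derB f g x a b : is_derive x (1:R) f a -> is_derive x (1:R) g b ->
  is_derive x (1:R) (fun t => f t - g t) (a - b).
Proof. by move=> h1 h2; apply: derD => //; exact: derN. Qed.

Lemma derComp (h : R -> R) f x a b : is_derive x (1:R) f a -> is_derive (f x) (1:R) h b ->
  is_derive x (1:R) (fun t => h (f t)) (b * a).
Proof. by move=> h1 h2; exact: (@is_derive1_comp R h f x b a). Qed.

Lemma derAff (h : R -> R) c d x b : is_derive (c * x + d) (1:R) h b ->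
  is_derive x (1:R) (fun t => h (c * t + d)) (c * b).
Proof.
move=> hb; have h1 := derD (derMl c (derI x)) (derC d x).
by apply: (derE (derComp h1 hb)); rewrite mulr1 addr0 mulrC.
Qed.

Lemma derV f x a : f x != 0 -> is_derive x (1:R) f a ->
  is_derive x (1:R) (fun t => (f t)^-1) (- (f x) ^- 2 * a).
Proof.
by move=> h0 [h1 <-]; split; [exact: derivableV|rewrite deriveV].
Qed.

Lemma derX f m x a : is_derive x (1:R) f a ->
  is_derive x (1:R) (fun t => f t ^+ m) (m%:R * f x ^+ m.-1 * a).
Proof.
move=> h; have -> : (fun t => f t ^+ m) = f ^+ m.
  by apply/funext => t; rewrite exprfctE.
exact: is_deriveX.
Qed.

Lemma der_near f g x a : (\forall t \near x, f t = g t) ->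
  is_derive x (1:R) f a -> is_derive x (1:R) g a.
Proof. exact: near_eq_is_derive. Qed.

Lemma der_continuous f x a : is_derive x (1:R) f a -> {for x, continuous f}.
Proof. by move=> [h _]; apply/differentiable_continuous/derivable1_diffP. Qed.

Lemma der_const f (a b : R) : (forall t, a <= t <= b -> is_derive t (1:R) f 0) ->
  a <= b -> f b = f a.
Proof.
move=> h ab; have [||c _ e] := @MVT_segment R f (fun=> 0) a b ab.
- by move=> t; rewrite in_itv/= => /andP[/ltW ? /ltW ?]; apply: h; apply/andP.
- by apply: derivable_within_continuous => t; rewrite in_itv/= => /h[].
by apply/eqP; rewrite -subr_eq0 e mul0r.
Qed.

End derivative_rules.

Section smooth.
Context {R : realType}.
Implicit Types (f g : R -> R) (x a b : R).

Fixpoint smoothk (k : nat) f : Prop :=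
  (forall x, derivable f x 1) /\ if k is k'.+1 then smoothk k' (fun x => 'D_1 f x) else True.

Definition smooth f := forall k, smoothk k f.

Lemma smoothkS k f df : (forall x, is_derive x (1:R) f (df x)) -> smoothk k df ->
  smoothk k.+1 f.
Proof.
move=> h s; split=> [x|]; first by case: (h x).
by rewrite (_ : (fun x => _) = df)//; apply/funext => x; case: (h x).
Qed.

Lemma smoothk_der k f x : smoothk k f -> is_derive x (1:R) f ('D_1 f x).
Proof. by case: k => [|k] [h _]; exact: derivableP. Qed.

Lemma smoothk_le k f : smoothk k.+1 f -> smoothk k f.
Proof. by elim: k f => [|k ih] f /= [h1 h2]; split=> //; exact: ih. Qed.

Lemma smoothkD k f g : smoothk k f -> smoothk k g -> smoothk k (fun x => f x + g x).
Proof.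
elim: k f g => [|k ih] f g hf hg.
  by split=> // x; case: (derD (smoothk_der x hf) (smoothk_der x hg)).
apply: (@smoothkS _ _ (fun x => 'D_1 f x + 'D_1 g x)).
  by move=> x; exact: derD (smoothk_der x hf) (smoothk_der x hg).
by case: hf hg => [_ hf] [_ hg]; exact: ih.
Qed.

Lemma smoothkM k f g : smoothk k f -> smoothk k g -> smoothk k (fun x => f x * g x).
Proof.
elim: k f g => [|k ih] f g hf hg.
  by split=> // x; case: (derM (smoothk_der x hf) (smoothk_der x hg)).
apply: (@smoothkS _ _ (fun x => f x * 'D_1 g x + g x * 'D_1 f x)).
  by move=> x; exact: derM (smoothk_der x hf) (smoothk_der x hg).
have [_ hf'] := hf; have [_ hg'] := hg.
by apply: smoothkD; apply: ih => //; exact: smoothk_le.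
Qed.

Lemma smoothkC k (c : R) : smoothk k (fun=> c).
Proof.
elim: k c => [|k ih] c; first by split=> // x; case: (derC c x).
by apply: (smoothkS _ (ih 0)) => x; exact: derC.
Qed.

Lemma smoothk_aff k f c d : smoothk k f -> smoothk k (fun x => f (c * x + d)).
Proof.
elim: k f => [|k ih] f hf.
  by split=> // x; case: (derAff (smoothk_der (c * x + d) hf)).
apply: (@smoothkS _ _ (fun x => c * 'D_1 f (c * x + d))).
  by move=> x; apply: derAff; exact: smoothk_der hf.
have [_ hf'] := hf; apply: smoothkM; first exact: smoothkC.
exact: (ih (fun x => 'D_1 f x)).
Qed.

Lemma smoothkV k f : (forall x, f x != 0) -> smoothk k f -> smoothk k (fun x => (f x)^-1).
Proof.
move=> f0; elim: k => [|k ih] hf.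
  by split=> // x; case: (derV (f0 x) (smoothk_der x hf)).
apply: (@smoothkS _ _ (fun x => - 1 * ((f x)^-1 * (f x)^-1) * 'D_1 f x)).
  move=> x; apply: (derE (derV (f0 x) (smoothk_der x hf))).
  by rewrite expr2 invfM mulN1r.
have [_ hf'] := hf; have hi := ih (smoothk_le hf).
apply: smoothkM => //; apply: smoothkM; first exact: smoothkC.
exact: smoothkM.
Qed.

(** The functions x^(-m) exp(-1/x) extended by zero are closed under
    differentiation up to linear combinations, so they are all smooth. *)
Definition flat (m : nat) x : R := if 0 < x then x^-1 ^+ m * expR (- x^-1) else 0.

Lemma flat_ge0 m x : 0 <= flat m x.
Proof.
rewrite /flat; case: ifPn => // x0.
by rewrite mulr_ge0 ?expR_ge0// exprn_ge0// invr_ge0 ltW.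
Qed.

(** The factor exp(-1/x) beats any power of 1/x, by the Taylor lower bound of exp. *)
Lemma flat_le m x : `|flat m x| <= m.+1`!%:R * `|x|.
Proof.
rewrite ger0_norm ?flat_ge0// /flat; case: ifPn => [x0|_]; last by rewrite mulr_ge0.
rewrite gtr0_norm//.
have y0 : 0 < x^-1 by rewrite invr_gt0.
have := expR_ge1Dxn m (ltW y0) => h.
have f0 : 0 < m.+1`!%:R :> R by rewrite ltr0n fact_gt0.
have h2 : x^-1 ^+ m.+1 <= m.+1`!%:R * expR x^-1.
  rewrite mulrC -ler_pdivrMr//; apply: le_trans h; rewrite lerDr//.
rewrite expRN -ler_pdivlMr ?invr_gt0 ?expR_gt0// invrK.
rewrite mulrAC -ler_pdivrMr// -exprSr//.
Qed.

Lemma flat_derive m x : is_derive x (1:R) (flat m) (flat m.+2 x - m%:R * flat m.+1 x).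
Proof.
have [x0|x0|<-] := ltgtP 0 x.
- have h : is_derive x (1:R) (fun t => t^-1 ^+ m * expR (- t^-1))
      (flat m.+2 x - m%:R * flat m.+1 x).
    have hV := derV (lt0r_neq0 x0) (derI x).
    have h1 := derX m hV.
    have h2 := derComp (derN hV) (is_derive_expR (- x^-1)).
    apply: (derE (derM h1 h2)); rewrite /flat x0 mulr1 opprK -exprVn.
    by case: m {h1 h2} => [|m] /=; rewrite !exprS; ring.
  apply: der_near h; near=> t; rewrite /flat ifT//; near: t.
  exact: lt_nbhsr.
- have -> : flat m.+2 x - m%:R * flat m.+1 x = 0.
    by rewrite /flat ltNge (ltW x0)/= mulr0 subr0.
  apply: der_near (derC 0 x); near=> t; rewrite /flat ifF//.
  by apply/negbTE; rewrite -leNgt ltW//; near: t; exact: lt_nbhsl.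
- have -> : flat m.+2 0 - m%:R * flat m.+1 0 = 0 by rewrite /flat ltxx mulr0 subr0.
  have f0 : flat m 0 = 0 by rewrite /flat ltxx.
  have hc : h^-1 *: ((flat m \o shift 0) (h *: (1 : R)) - flat m 0) @[h --> 0^'] --> (0 : R).
    apply/cvgrPdist_le => e e0.
    have f1 : 0 < m.+2`!%:R :> R by rewrite ltr0n fact_gt0.
    near=> h.
    have h0 : h != 0 by near: h; exact: nbhs_dnbhs_neq.
    rewrite sub0r normrN f0 subr0 /= addr0 [h *: 1]mulr1.
    have -> : h^-1 *: flat m h = flat m.+1 h.
      by rewrite /flat; case: ifP => _; [rewrite exprS -mulrA|exact: mulr0].
    apply: le_trans (flat_le _ _) _; rewrite -ler_pdivlMl// mulrC.
    near: h; apply: dnbhs0_le; exact: divr_gt0.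
  by split; [apply/cvg_ex; exists 0|exact/cvg_lim].
Unshelve. all: by end_near. Qed.

Lemma smooth_flat m : smooth (flat m).
Proof.
move=> k; elim: k m => [|k ih] m; first by split=> // x; case: (flat_derive m x).
apply: (smoothkS (flat_derive m)); apply: smoothkD; first exact: ih.
rewrite (_ : (fun x => _) = (fun x => (- m%:R) * flat m.+1 x)).
  by apply: smoothkM; [exact: smoothkC|exact: ih].
by apply/funext => x; rewrite mulNr.
Qed.

End smooth.

Section step.
Context {R : realType}.
Implicit Types (f g : R -> R) (x a b : R).

Lemma flat_gt0 m x : 0 < x -> 0 < flat m x.
Proof. by move=> x0; rewrite /flat x0 mulr_gt0 ?expR_gt0// exprn_gt0// invr_gt0. Qed.

Lemma flat_le0 m x : x <= 0 -> flat m x = 0.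
Proof. by rewrite /flat ltNge => ->. Qed.

Definition step x : R := flat 0 x / (flat 0 x + flat 0 (1 - x)).

Lemma step_den_gt0 x : 0 < flat 0 x + flat 0 (1 - x).
Proof.
have [x0|x0] := leP x 0.
  by rewrite ltr_wpDl ?flat_ge0// flat_gt0// subr_gt0 (le_lt_trans x0).
by rewrite ltr_wpDr ?flat_ge0// flat_gt0.
Qed.

Lemma smooth_step : smooth step.
Proof.
move=> k; apply: smoothkM; first exact: smooth_flat.
apply: smoothkV; first by move=> x; rewrite gt_eqF// step_den_gt0.
apply: smoothkD; first exact: smooth_flat.
rewrite (_ : (fun x => _) = (fun x => flat 0 ((-1) * x + 1))).
  by apply: smoothk_aff; exact: smooth_flat.
by apply/funext => x; rewrite mulN1r addrC.
Qed.

Lemma step0 x : x <= 0 -> step x = 0.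
Proof. by move=> x0; rewrite /step flat_le0// mul0r. Qed.

Lemma step1 x : 1 <= x -> step x = 1.
Proof.
move=> x1; rewrite /step [flat 0 (1 - x)]flat_le0 ?subr_le0// addr0 divff//.
by rewrite gt_eqF// flat_gt0// (lt_le_trans _ x1).
Qed.

Lemma step_ge0 x : 0 <= step x.
Proof. by rewrite divr_ge0 ?flat_ge0// ltW// step_den_gt0. Qed.

Lemma step_le1 x : step x <= 1.
Proof. by rewrite ler_pdivrMr ?step_den_gt0// mul1r lerDl flat_ge0. Qed.

Lemma smooth_der f x : smooth f -> is_derive x (1:R) f ('D_1 f x).
Proof. by move=> h; exact: smoothk_der (h 0%N). Qed.

(** The primitive is built by integration from -1, where [step] already vanishes,
    and patched by zero to the left. *)
Lemma step_primitive : exists2 P : R -> R,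
  (forall x, is_derive x (1:R) P (step x)) & forall x, x <= 0 -> P x = 0.
Proof.
have cs x : {for x, continuous step} by exact: der_continuous (smooth_der x smooth_step).
pose mu := @lebesgue_measure R.
pose I x := (\int[mu]_(t in `[(-1)%R, x]) step t)%R.
have I0 x : x <= 0 -> I x = 0.
  move=> x0; rewrite /I /Rintegral integral0_eq// => t /=; rewrite in_itv/= => /andP[_ tx].
  by rewrite step0// (le_trans tx).
have dI x : -1 < x -> is_derive x (1:R) I (step x).
  move=> x1; have xu : x < x + 1 by rewrite ltrDl.
  have ii : mu.-integrable `[(-1)%R, x + 1] (EFin \o step).
    apply: continuous_compact_integrable; first exact: segment_compact.
    exact: continuous_subspaceT.
  have [h1 h2] := continuous_FTC1_closed xu ii x1 (cs x).
  by split; [exact: h1|rewrite -derive1E].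
exists (fun x => if x <= 0 then 0 else I x); last by move=> x ->.
have e x : -1 < x -> (if x <= 0 then 0 else I x) = I x by case: ifP => // /I0->.
move=> x; have [x1|x1] := ltP (-1) x.
  apply: der_near (dI _ x1); near=> t; rewrite e//; near: t; exact: lt_nbhsr.
have x0 : x < 0 by apply: (le_lt_trans x1); rewrite oppr_lt0.
rewrite step0 ?(ltW x0)//; apply: der_near (derC 0 x); near=> t; rewrite ifT//.
by apply/ltW; near: t; exact: lt_nbhsl.
Unshelve. all: by end_near. Qed.

(** Finitely many translates are summed; restricting to [2, m] ensures that all
    translates meeting x are among them. *)
Definition pou (kap : R -> R) : Prop :=
  [/\ smooth kap, forall x, 0 <= kap x, forall x, kap x != 0 -> 0 <= x <= 3 &
      forall m x, 2 <= x <= m%:R -> \sum_(k < m) kap (x - k%:R) = 1].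

Lemma smooth_sub f c : smooth f -> smooth (fun x => f (x - c)).
Proof.
move=> hf k; rewrite (_ : (fun x => _) = (fun x => f (1 * x + - c))).
  by apply: smoothk_aff; exact: hf.
by apply/funext => x; rewrite mul1r.
Qed.

Lemma smoothB f g : smooth f -> smooth g -> smooth (fun x => f x - g x).
Proof.
move=> hf hg k; rewrite (_ : (fun x => _) = (fun x => f x + (-1) * g x)).
  by apply: smoothkD => //; apply: smoothkM => //; exact: smoothkC.
by apply/funext => x; rewrite mulN1r.
Qed.

Lemma der_sub f c x a : is_derive (x - c) (1:R) f a -> is_derive x (1:R) (fun t => f (t - c)) a.
Proof.
move=> h; have := @derAff R f 1 (- c) x a; rewrite !mul1r => /(_ h).
by rewrite (_ : (fun t => f (1 * t - c)) = (fun t => f (t - c)))//; apply/funext => t; rewrite mul1r.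
Qed.

(** A telescoping sum: a kernel of the form f(x) - f(x - 1) is a partition of unity
    as soon as f goes from 0 to 1. *)
Lemma sum_step f m x :
  \sum_(k < m) (f (x - k%:R) - f (x - k%:R - 1)) = f x - f (x - m%:R).
Proof.
elim: m => [|m ih]; first by rewrite big_ord0 subr0 subrr.
rewrite big_ord_recr/= ih -addn1 natrD.
have -> : x - (m%:R + 1) = x - m%:R - 1 by ring.
ring.
Qed.

(** The two kernels are first differences of functions going from 0 to 1: theta of
    the smooth step, eta of a function with derivative theta. This relation
    between eta' and theta turns the derivative of a sum of samples against eta
    into a sum of difference quotients against theta. *)
Lemma kernels : exists eta theta : R -> R, [/\ pou eta, pou theta &
  forall x, is_derive x (1:R) eta (theta x - theta (x - 1))].
Proof.
have [P dP P0] := step_primitive.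
pose th x := step x - step (x - 1).
pose De x := P x - P (x - 1).
pose et x := De x - De (x - 1).
have sP : smooth P.
  move=> [|k]; first by split=> // x; case: (dP x).
  exact: (smoothkS dP (smooth_step k)).
have sth : smooth th by apply: smoothB; [exact: smooth_step|exact: smooth_sub smooth_step].
have sDe : smooth De by apply: smoothB => //; exact: smooth_sub.
have dDe x : is_derive x (1:R) De (th x) by apply: derB => //; exact: der_sub.
have det x : is_derive x (1:R) et (th x - th (x - 1)) by apply: derB => //; exact: der_sub.
have th0 x : 0 <= th x.
  rewrite /th subr_ge0; have [x1|x1] := leP x 1; first by rewrite step0 ?subr_le0// step_ge0.
  by rewrite [leRHS]step1 ?(ltW x1)// step_le1.
have thz x : x <= 0 \/ 2 <= x -> th x = 0.
  case=> h; rewrite /th; first by rewrite !step0 ?subrr//; lra.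
  by rewrite !step1 ?subrr//; lra.
have De_mono x y : x <= y -> De x <= De y.
  move=> xy; have [|c _ e] := @MVT_segment R De th x y xy.
    by apply: derivable_within_continuous => t _; case: (dDe t).
  by rewrite -subr_ge0 e mulr_ge0// subr_ge0.
have De0 x : x <= 0 -> De x = 0 by move=> x0; rewrite /De !P0 ?subrr//; lra.
have De2 x : 2 <= x -> De x = 1.
  move=> x2.
  have -> : De x = De 2.
    apply: der_const => // t /andP[t2 _]; apply: (derE (dDe t)).
    by apply: thz; right.
  have := @der_const R (fun t => P t - t) 1 2.
  have h (t : R) : 1 <= t <= 2 -> is_derive t (1:R) (fun t => P t - t) 0.
    move=> /andP[t1 _]; apply: (derE (derB (dP t) (derI t))).
    by rewrite step1// subrr.
  move=> /(_ h); rewrite ler1n => /(_ isT).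
  by rewrite /De (_ : 2 - 1 = 1 :> R); lra.
exists et, th; split=> //; split=> //.
- by apply: smoothB => //; exact: smooth_sub.
- by move=> x; rewrite subr_ge0 De_mono// lerBlDr lerDl.
- move=> x; apply: contraNT; rewrite negb_and -!ltNge => /orP[h|h].
    by rewrite /et !De0 ?subrr//; lra.
  by rewrite /et !De2 ?subrr//; lra.
- move=> m x /andP[x2 xm].
  rewrite (_ : \sum_(k < m) _ = \sum_(k < m) (De (x - k%:R) - De (x - k%:R - 1)))//.
  by rewrite sum_step De2// De0 ?subr0// subr_le0.
- move=> x; apply: contraNT; rewrite negb_and -!ltNge => /orP[h|h].
    by apply/eqP; apply: thz; left; exact: ltW.
  by apply/eqP; apply: thz; right; lra.
- move=> m x /andP[x2 xm].
  rewrite (_ : \sum_(k < m) _ = \sum_(k < m) (step (x - k%:R) - step (x - k%:R - 1)))//.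
  by rewrite sum_step step1 ?step0 ?subr0 ?subr_le0//; lra.
Qed.

End step.

(** * Quasi-interpolation and density of test functions *)

Section Ck.
Context {R : realType} {n : nat}.
Implicit Types (f g : 'rV[R]_n -> R) (i j : 'I_n) (x y z : 'rV[R]_n).

Lemma CkS k f (df : 'I_n -> 'rV[R]_n -> R) : continuous f ->
  (forall i x, is_derive x (ebase i) f (df i x)) ->
  (forall i, Ck_on k setT (df i)) -> Ck_on k.+1 setT f.
Proof.
move=> cf hd hk; split; first by move=> x _; exact: cf.
move=> i; split; first by move=> x _; case: (hd i x).
by rewrite (_ : partial i f = df i)//; apply/funext => x; case: (hd i x).
Qed.

Lemma Ck_continuous k f : Ck_on k setT f -> continuous f.
Proof. by case: k => [|k] [h _] x; exact: h. Qed.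

Lemma Ck_der k f i x : Ck_on k.+1 setT f -> is_derive x (ebase i) f (partial i f x).
Proof. by move=> [_ /(_ i)[h _]]; exact/derivableP/h. Qed.

Lemma Ck_partial k f i : Ck_on k.+1 setT f -> Ck_on k setT (partial i f).
Proof. by move=> [_ /(_ i)[]]. Qed.

Lemma Ck_le k f : Ck_on k.+1 setT f -> Ck_on k setT f.
Proof.
elim: k f => [|k ih] f [h1 h2]; first by split.
by split=> // i; have [h3 h4] := h2 i; split=> //; exact: ih.
Qed.

Lemma CkD k f g : Ck_on k setT f -> Ck_on k setT g -> Ck_on k setT (fun x => f x + g x).
Proof.
elim: k f g => [|k ih] f g hf hg.
  split=> // x _; apply: (@continuousD _ _ _ f g); [exact: Ck_continuous hf x|exact: Ck_continuous hg x].
apply: (@CkS _ _ (fun i x => partial i f x + partial i g x)).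
- by move=> x; apply: (@continuousD _ _ _ f g); [exact: Ck_continuous hf x|exact: Ck_continuous hg x].
- by move=> i x; exact: (is_deriveD (Ck_der i x hf) (Ck_der i x hg)).
- by move=> i; apply: ih; exact: Ck_partial.
Qed.

Lemma CkM k f g : Ck_on k setT f -> Ck_on k setT g -> Ck_on k setT (fun x => f x * g x).
Proof.
elim: k f g => [|k ih] f g hf hg.
  split=> // x _; apply: (@continuousM _ _ f g); [exact: Ck_continuous hf x|exact: Ck_continuous hg x].
apply: (@CkS _ _ (fun i x => f x * partial i g x + g x * partial i f x)).
- by move=> x; apply: (@continuousM _ _ f g); [exact: Ck_continuous hf x|exact: Ck_continuous hg x].
- by move=> i x; exact: (is_deriveM (Ck_der i x hf) (Ck_der i x hg)).
- by move=> i; apply: CkD; apply: ih; by [exact: Ck_le|exact: Ck_partial].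
Qed.

Lemma CkC k (c : R) : Ck_on k setT (fun _ : 'rV[R]_n => c).
Proof.
elim: k c => [|k ih] c; first by split=> // x _; exact: cst_continuous.
apply: (@CkS _ _ (fun (_ : 'I_n) (_ : 'rV[R]_n) => 0 : R)).
- by move=> x; exact: cst_continuous.
- by move=> i; apply: (ih (0 : R)).
Qed.

Lemma Ck_sum k m (f : 'I_m -> 'rV[R]_n -> R) : (forall l, Ck_on k setT (f l)) ->
  Ck_on k setT (fun x => \sum_l f l x).
Proof.
move=> h; elim: (index_enum _) => [|l r ih].
  rewrite (_ : (fun x => _) = (fun=> 0)); first exact: CkC.
  by apply/funext => x; rewrite big_nil.
rewrite (_ : (fun x => _) = (fun x => f l x + \sum_(j <- r) f j x)); first exact: CkD.
by apply/funext => x; rewrite big_cons.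
Qed.

Lemma is_derive_coord (f : R -> R) i j (c d : R) x a :
  is_derive (c * x ord0 i + d) (1:R) f a ->
  is_derive x (ebase j) (fun y => f (c * y ord0 i + d)) (a * (c * (i == j)%:R)).
Proof.
move=> h.
have [_ /(_ x I)[_ /(_ j)[hc _]]] := C1_grad_coord i (@openT 'rV[R]_n).
apply: (@is_derive_comp1 _ _ (fun y : 'rV[R]_n => c * y ord0 i + d) f) => //.
apply: (@is_derive_comp1 _ _ (fun y : 'rV[R]_n => y ord0 i) (fun t => c * t + d)) => //.
by apply: (derE (derD (derMl c (derI _)) (derC d _))); rewrite mulr1 addr0.
Qed.

Lemma Ck_smooth k (f : R -> R) i (c d : R) : smooth f ->
  Ck_on k setT (fun x : 'rV[R]_n => f (c * x ord0 i + d)).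
Proof.
have cont (g : R -> R) : smooth g -> continuous (fun x : 'rV[R]_n => g (c * x ord0 i + d)).
  move=> sg x.
  apply: (@continuous_comp _ _ _ (fun x : 'rV[R]_n => x ord0 i) (fun t => g (c * t + d))).
    exact: coord_continuous.
  apply: der_continuous; apply: derAff; exact: smooth_der sg.
elim: k f => [|k ih] f sf; first by split=> // x _; exact: cont.
apply: (@CkS _ _ (fun j x => 'D_1 f (c * x ord0 i + d) * (c * (i == j)%:R))).
- exact: cont.
- by move=> j x; apply: is_derive_coord; exact: smooth_der.
- move=> j; apply: CkM; last exact: CkC.
  by apply: (ih (fun t => 'D_1 f t)) => l; case: (sf l.+1).
Qed.

End Ck.

Section quasi_interpolation.
Context {R : realType} {n : nat}.
Implicit Types (u v : 'rV[R]_n -> R) (i j : 'I_n) (x y z : 'rV[R]_n) (a : R).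

Definition upd x i a : 'rV[R]_n := \row_j (if j == i then a else x ord0 j).

Lemma upd_same x i a : upd x i a ord0 i = a. Proof. by rewrite mxE eqxx. Qed.

Lemma upd_other x i a j : j != i -> upd x i a ord0 j = x ord0 j.
Proof. by rewrite mxE => /negbTE ->. Qed.

Lemma upd_comm x i j a b : i != j -> upd (upd x i a) j b = upd (upd x j b) i a.
Proof.
move=> ij; apply/rowP => l; rewrite !mxE; have [->|//] := eqVneq l j.
by rewrite eq_sym (negbTE ij).
Qed.

Variables (h : R) (N : nat).
Hypothesis h0 : 0 < h.

Definition node (k : R) : R := h * (k - N%:R).

(** The coordinates listed in I are treated one after the other: each is replaced
    by the nodes h(k - N), with weights given by a kernel at scale h. *)
Fixpoint quasi (kap : 'I_n -> R -> R) (I : seq 'I_n) u x : R :=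
  if I is i :: I' then
    \sum_(k < 2 * N) kap i (h^-1 * x ord0 i + (N%:R - k%:R)) *
      quasi kap I' (fun z => u (upd z i (node k%:R))) x
  else u x.

(** Once every coordinate has been sampled, x occurs only in the kernels. *)
Lemma quasi_smooth kap I u : (forall i, smooth (kap i)) ->
  (forall x y, (forall j, j \in I -> x ord0 j = y ord0 j) -> u x = u y) ->
  forall k, Ck_on k setT (quasi kap I u).
Proof.
move=> sk; elim: I u => [|i I ih] u hu k.
  rewrite (_ : quasi _ _ _ = fun=> u 0); first exact: CkC.
  by apply/funext => x; apply: hu.
apply: Ck_sum => l; apply: CkM; first exact: Ck_smooth.
apply: ih => x y hxy; apply: hu => j; rewrite inE => /predU1P[->|jI].
  by rewrite !upd_same.
by have [->|ji] := eqVneq j i; rewrite ?upd_same// !upd_other// hxy.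
Qed.

Lemma node_dist x i k : 0 <= h^-1 * x ord0 i + (N%:R - k) <= 3 ->
  `|node k - x ord0 i| <= 3 * h.
Proof.
move=> /andP[h1 h2]; rewrite distrC /node.
have -> : x ord0 i - h * (k - N%:R) = h * (h^-1 * x ord0 i + (N%:R - k)).
  by rewrite [RHS]mulrDr mulVKf ?gt_eqF//; ring.
by rewrite normrM gtr0_norm// ger0_norm// mulrC ler_pM2r.
Qed.

Lemma quasi_support kap I v x : (forall i, pou (kap i)) ->
  (forall y, (forall j, `|y ord0 j - x ord0 j| <= 3 * h) -> v y = 0) ->
  quasi kap I v x = 0.
Proof.
move=> pk; elim: I v => [|i I ih] v hv /=.
  by apply: hv => j; rewrite subrr normr0 mulr_ge0// ltW.
apply: big1 => k _; have [->|k0] := eqVneq (kap i (h^-1 * x ord0 i + (N%:R - k%:R))) 0.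
  by rewrite mul0r.
rewrite ih ?mulr0// => y hy; apply: hv => j.
have [->|ji] := eqVneq j i; last by rewrite upd_other.
by rewrite upd_same; apply: node_dist; have [_ _ hk _] := pk i; exact: hk.
Qed.

(** The weights are nonnegative and sum to 1, so the value is an average of v over
    points at distance at most 3h from x. *)
Lemma quasi_approx kap I v x c e : (forall i, pou (kap i)) ->
  (forall i, i \in I -> `|x ord0 i| <= h * (N%:R - 2)) ->
  (forall y, (forall j, `|y ord0 j - x ord0 j| <= 3 * h) -> `|v y - c| <= e) ->
  `|quasi kap I v x - c| <= e.
Proof.
move=> pk; elim: I v => [|i I ih] v hI hv /=.
  by apply: hv => j; rewrite subrr normr0 mulr_ge0// ltW.
have [_ kge0 kz ksum] := pk i.
have xi := hI i (mem_head _ _).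
have k1 : \sum_(k < 2 * N) kap i (h^-1 * x ord0 i + (N%:R - k%:R)) = 1.
  rewrite (eq_bigr (fun k : 'I_(2 * N) => kap i (h^-1 * x ord0 i + N%:R - k%:R))); last first.
    by move=> k _; rewrite addrA.
  apply: ksum.
  have : `|h^-1 * x ord0 i| <= N%:R - 2.
    by rewrite normrM gtr0_norm ?invr_gt0// ler_pdivrMl.
  rewrite ler_norml natrM => /andP[a1 a2].
  by apply/andP; split; lra.
set S := \sum_(k < 2 * N) _.
have -> : S - c = \sum_(k < 2 * N) kap i (h^-1 * x ord0 i + (N%:R - k%:R)) *
    (quasi kap I (fun z => v (upd z i (node k%:R))) x - c).
  rewrite (eq_bigr _ (fun k _ => mulrBr _ _ _)) sumrB -[X in _ = _ - X]mulr_suml k1.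
  by rewrite mul1r.
apply: (le_trans (ler_norm_sum _ _ _)).
apply: (@le_trans _ _ (\sum_(k < 2 * N) kap i (h^-1 * x ord0 i + (N%:R - k%:R)) * e)); last first.
  by rewrite -mulr_suml k1 mul1r.
apply: ler_sum => k _; rewrite normrM ger0_norm ?kge0//.
have [->|k0] := eqVneq (kap i (h^-1 * x ord0 i + (N%:R - k%:R))) 0; first by rewrite !mul0r.
rewrite ler_wpM2l ?kge0//; apply: ih.
  by move=> j jI; apply: hI; rewrite inE jI orbT.
move=> y hy; apply: hv => j.
have [->|ji] := eqVneq j i; last by rewrite upd_other.
by rewrite upd_same; apply: node_dist; exact: kz.
Qed.

Lemma quasiB kap I u v x :
  quasi kap I (fun y => u y - v y) x = quasi kap I u x - quasi kap I v x.
Proof.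
elim: I u v => [//|i I ih] u v /=; rewrite -sumrB; apply: eq_bigr => k _.
by rewrite -mulrBr -ih.
Qed.

Lemma quasiZ kap I c v x : quasi kap I (fun y => c * v y) x = c * quasi kap I v x.
Proof.
elim: I v => [//|i I ih] v /=; rewrite mulr_sumr; apply: eq_bigr => k _.
by rewrite mulrCA -ih.
Qed.

Lemma quasi0 kap I v x : (forall y, v y = 0) -> quasi kap I v x = 0.
Proof.
by elim: I v => [|i I ih] v hv /=; [exact: hv|apply: big1 => k _; rewrite ih ?mulr0].
Qed.

Lemma eq_quasi kap kap' I u v x : (forall i, i \in I -> kap i = kap' i) ->
  (forall y, u y = v y) -> quasi kap I u x = quasi kap' I v x.
Proof.
elim: I u v => [|i I ih] u v hk hv /=; first exact: hv.
apply: eq_bigr => k _; rewrite hk ?mem_head//; congr (_ * _); apply: ih => // j jI.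
by apply: hk; rewrite inE jI orbT.
Qed.

(** A coordinate that is neither sampled nor seen by v does not influence the
    result. *)
Lemma quasi_indep kap I v i x y : i \notin I ->
  (forall z a, v (upd z i a) = v z) ->
  (forall j, j != i -> x ord0 j = y ord0 j) -> quasi kap I v x = quasi kap I v y.
Proof.
move=> + + hxy; elim: I v => [|j I ih] v /= iI hv.
  have -> : y = upd x i (y ord0 i); last by rewrite hv.
  apply/rowP => l; have [->|li] := eqVneq l i; first by rewrite upd_same.
  by rewrite upd_other// hxy.
move: iI; rewrite inE negb_or => /andP[ij iI].
apply: eq_bigr => k _; rewrite hxy; last by rewrite eq_sym.
congr (_ * _); apply: ih => // z a.
by rewrite upd_comm// hv.
Qed.

Definition dquot j u y : R := h^-1 * (u y - u (upd y j (y ord0 j - h))).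

(** Differentiating the kernel eta in direction j gives differences of theta;
    a summation by parts moves the difference to the samples of u. *)
Lemma quasi_partial (eta theta : R -> R) kap j I u M x :
  (forall t, is_derive t (1:R) eta (theta t - theta (t - 1))) ->
  kap j = eta -> uniq I -> j \in I -> (forall i, smooth (kap i)) ->
  (forall y, M <= `|y ord0 j| -> u y = 0) -> M <= h * (N%:R - 1) ->
  is_derive x (ebase j) (quasi kap I u)
    (quasi (fun i => if i == j then theta else kap i) I (dquot j u) x).
Proof.
move=> het kj + + sk + MN.
set kap' := fun i => _.
have kE i : i != j -> kap' i = kap i by rewrite /kap' => /negbTE ->.
have N0 : 0 <= h * (N%:R + 1) by rewrite mulr_ge0// ltW.
elim: I u => [//|i I ih] u /=; rewrite inE => /andP[iI uI] jI hu.
have dsum (f : 'I_(2 * N) -> 'rV[R]_n -> R) (df : 'I_(2 * N) -> R) :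
    (forall k, is_derive x (ebase j) (f k) (df k)) ->
    is_derive x (ebase j) (fun y => \sum_k f k y) (\sum_k df k).
  move=> hf; rewrite (_ : (fun y => _) = \sum_k f k); first exact: is_derive_sum.
  by apply/funext => y; rewrite fct_sumE.
case/predU1P: jI => [ji|jI].
- subst i.
  pose V (a : R) := quasi kap I (fun z => u (upd z j a)) x.
  have Vz a : M <= `|a| -> V a = 0.
    by move=> Ma; apply: quasi0 => y; apply: hu; rewrite upd_same.
  have hder (k : 'I_(2 * N)) : is_derive x (ebase j)
      (fun y => kap j (h^-1 * y ord0 j + (N%:R - k%:R)) *
         quasi kap I (fun z => u (upd z j (node k%:R))) y)
      ((theta (h^-1 * x ord0 j + (N%:R - k%:R)) -
        theta (h^-1 * x ord0 j + (N%:R - k%:R) - 1)) * h^-1 * V (node k%:R)).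
    have d1 := is_derive_coord j (het (h^-1 * x ord0 j + (N%:R - k%:R))).
    rewrite eqxx mulr1 -kj in d1.
    have d2 : is_derive x (ebase j) (quasi kap I (fun z => u (upd z j (node k%:R)))) 0.
      apply: is_derive_unslice.
      rewrite (_ : (fun s => _) = fun=> quasi kap I (fun z => u (upd z j (node k%:R))) x).
        exact: derC.
      apply/funext => s.
      apply: (@quasi_indep kap I _ j (x + s *: ebase j) x iI) => [z a|l lj].
        congr (u _); apply/rowP => l.
        by have [->|lj] := eqVneq l j; rewrite ?upd_same// !upd_other.
      by rewrite !mxE eqxx (negbTE lj) mulr0 addr0.
    have d3 := is_deriveM d1 d2; apply: (is_derive_eq d3).
    by rewrite scaler0 add0r /GRing.scale/= mulrC.
  apply: (is_derive_eq (dsum _ _ hder)).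
  (* Summation by parts: T k is the kernel at the k-th node, V the sum over
     the other coordinates with the j-th one frozen. Both boundary terms vanish because the
     extreme nodes lie outside the support of u. *)
  pose T (k : nat) := theta (h^-1 * x ord0 j + (N%:R - k%:R)).
  have hT (k : nat) : theta (h^-1 * x ord0 j + (N%:R - k%:R) - 1) = T k.+1.
    by rewrite /T -natr1; congr theta; ring.
  have hR (k : 'I_(2 * N)) : kap' j (h^-1 * x ord0 j + (N%:R - k%:R)) *
      quasi kap' I (fun z => dquot j u (upd z j (node k%:R))) x =
      h^-1 * (T k * V (node k%:R) - T k * V (node (k%:R - 1))).
    rewrite {1}/kap' eqxx -/(T k) -mulrBr mulrCA; congr (_ * _).
    rewrite -quasiB -quasiZ; apply: eq_quasi.
      by move=> l lI; rewrite kE//; apply: contraNneq iI => <-.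
    move=> y; rewrite /dquot upd_same; congr (_ * (_ - u _)); apply/rowP => l.
    have [->|lj] := eqVneq l j; last by rewrite !upd_other.
    by rewrite !upd_same /node; ring.
  rewrite (eq_bigr _ (fun k _ => hR k)) -mulr_sumr.
  rewrite (eq_bigr (fun k : 'I_(2 * N) => h^-1 * (T k * V (node k%:R) - T k.+1 * V (node k%:R)))).
    rewrite -mulr_sumr; congr (_ * _); apply/eqP; rewrite -subr_eq0 -sumrB; apply/eqP.
    pose W (k : nat) := T k * V (node (k%:R - 1)).
    rewrite (eq_bigr (fun k : 'I_(2 * N) => - (W k.+1 - W k))).
      rewrite sumrN -(big_mkord xpredT (fun k => W k.+1 - W k)) telescope_sumr//.
      rewrite /W !Vz ?mulr0 ?subrr ?oppr0//.
        rewrite /node normrM gtr0_norm//; apply: le_trans MN _; rewrite ler_pM2l//.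
        by rewrite -normrN; apply: le_trans (ler_norm _); lra.
      rewrite /node natrM normrM gtr0_norm//; apply: le_trans MN _; rewrite ler_pM2l//.
      by apply: le_trans (ler_norm _); lra.
    move=> k _; rewrite /W -natr1 addrK; ring.
  by move=> k _; rewrite hT -/(T k); ring.
- have ij : i != j by apply: contraNneq iI => ->.
  apply: dsum => k.
  have d1 : is_derive x (ebase j) (fun y => kap i (h^-1 * y ord0 i + (N%:R - k%:R))) 0.
    have := is_derive_coord j (smooth_der (h^-1 * x ord0 i + (N%:R - k%:R)) (sk i)).
    by rewrite (negbTE ij) !mulr0.
  have hu' y : M <= `|y ord0 j| -> u (upd y i (node k%:R)) = 0.
    by move=> hy; apply: hu; rewrite upd_other// eq_sym.
  have d2 := ih (fun z => u (upd z i (node k%:R))) uI jI hu'.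
  have d3 := is_deriveM d1 d2; apply: (is_derive_eq d3).
  rewrite scaler0 addr0 kE// /GRing.scale/=; congr (_ * _).
  apply: eq_quasi => // y; rewrite /dquot upd_other 1?eq_sym//.
  by rewrite (upd_comm y _ _ ij).
Qed.

End quasi_interpolation.

Section approximation.
Context {R : realType} {n : nat}.
Implicit Types (u v f : 'rV[R]_n -> R) (i j : 'I_n) (x y z : 'rV[R]_n).

(** Heine's theorem on a ball slightly larger than the support. *)
Lemma compact_support_unif f (M : R) : continuous f ->
  (forall x, M <= `|x| -> f x = 0) -> forall e, 0 < e ->
  exists2 d, 0 < d & forall x y, `|x - y| <= d -> `|f x - f y| <= e.
Proof.
move=> cf f0 e e0.
have cB : compact [set x : 'rV[R]_n | `|x| <= M + 1].
  apply: bounded_closed_compact.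
    by exists (M + 1); split; [exact: num_real|move=> N MN x /= xM; exact: le_trans xM (ltW MN)].
  rewrite (_ : [set _ | _] = Num.norm @^-1` [set t | t <= M + 1])//.
  by apply: closed_comp => [x _|]; [exact: norm_continuous|exact: closed_le].
have e2 : 0 < e / 2 by rewrite divr_gt0.
pose P (d : R) (x : 'rV[R]_n) := forall y, `|x - y| <= d -> `|f x - f y| <= e.
have := (compact_near_coveringP _).1 cB R (0^'+)%R P _.
have hP : forall x, [set x : 'rV[R]_n | `|x| <= M + 1] x ->
    \forall x' \near x & d \near (0:R)^'+, P d x'.
  move=> x _.
  have /rV_near_ball[r r0 hr] : \forall y \near x, `|f x - f y| <= e / 2.
    by have /cvgrPdist_le/(_ _ e2) := cf x.
  have r2 : 0 < r / 2 by rewrite divr_gt0.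
  exists (ball x (r / 2), [set d | d < r / 2]); first split => /=.
  - exact: nbhsx_ballx.
  - exact: nbhs_right_lt.
  move=> [x' d] /= [/ball_rVP hx' hd] y hy.
  have h1 := hr x' (lt_trans hx' _).
  have h2 := hr y.
  rewrite (_ : f x' - f y = (f x - f y) - (f x - f x')); last by ring.
  apply: le_trans (ler_normB _ _) _; rewrite (splitr e) lerD//.
    apply: h2; have -> : y - x = (x' - x) - (x' - y) by rewrite opprB [RHS]addrC addrA subrK.
    by apply: le_lt_trans (ler_normB _ _) _; rewrite (splitr r) ltrD// (le_lt_trans hy).
  by apply: h1; rewrite ltr_pdivrMr// ltr_pMr// ltr1n.
move=> /(_ _ hP) H.
have : \forall d \near (0:R)^'+, 0 < d /\ d <= 1 /\
    forall x, [set x : 'rV[R]_n | `|x| <= M + 1] x -> P d x.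
  near=> d; split; last split.
  - by near: d; exact: nbhs_right_gt.
  - by near: d; exact: nbhs_right_le.
  - by near: d.
move=> /(@filter_ex _ _ _)[d [d0 [d1 hd]]]; exists d => // x y xy.
have [hx|hx] := leP `|x| (M + 1); first exact: hd.
rewrite !f0 ?subr0 ?normr0 ?(ltW e0)//; first last.
  by rewrite ltW// (lt_trans _ hx)// ltrDl.
have := ler_normD y (x - y); rewrite addrC subrK => h3.
by move: h3 hx xy d1; lra.
Unshelve. all: by end_near. Qed.

Lemma closed_support_compact (Omega : set 'rV[R]_n) (phi : 'rV[R]_n -> R) (M d : R) : 0 < d ->
  (forall x, M <= `|x| -> phi x = 0) ->
  (forall x y, phi x != 0 -> `|y - x| <= d -> Omega y) ->
  compact (closure [set x | phi x != 0]) /\ closure [set x | phi x != 0] `<=` Omega.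
Proof.
move=> d0 h0 hO; split.
  apply: bounded_closed_compact; last exact: closed_closure.
  exists M; split; first exact: num_real.
  move=> N MN x /= hx; rewrite leNgt; apply/negP => Nx.
  have nx : nbhs x [set y : 'rV[R]_n | N < `|y|].
    have cn : {for x, continuous (Num.norm : 'rV[R]_n -> R)} by exact: norm_continuous.
    exact: (cvgr_gt _ cn).
  have [y [/= /eqP + hy]] := hx _ nx; apply; apply: h0.
  by rewrite ltW// (lt_trans MN).
move=> x hx; have [y [/= hy /ball_rVP yx]] := hx _ (nbhsx_ballx x d d0).
by apply: (hO y) => //; rewrite distrC ltW.
Qed.

Lemma upd_shift y j (c : R) : upd y j (y ord0 j + c) = y + c *: ebase j.
Proof.
apply/rowP => l; rewrite !mxE eqxx/=; have [->|_] := eqVneq l j; first by rewrite mulr1.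
by rewrite mulr0 addr0.
Qed.

(** The quasi-interpolant averages values of u, and its partial derivatives average
    difference quotients of u, that is, values of du by the mean value theorem.
    Uniform continuity of u and du concludes when the mesh is small. *)
Lemma C1_approx (Omega : set 'rV[R]_n) u du (r M : R) : C1_grad setT u du ->
  0 < r -> (forall x, M <= `|x| -> u x = 0) ->
  (forall x y, u x != 0 -> `|y - x| <= r -> Omega y) ->
  forall e, 0 < e -> exists phi : 'rV[R]_n -> R, [/\ test_function Omega phi,
    forall x, `|phi x - u x| <= e,
    forall i x, `|partial i phi x - du i x| <= e &
    forall x, M + r <= `|x| -> phi x = 0].
Proof.
move=> hC r0 uM uO e e0; have [_ hu] := hC.
have cu : continuous u by move=> x; have [] := hu x I.
have cdu i : continuous (du i) by move=> x; have [_ /(_ i)[]] := hu x I.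
have du0 i x : M < `|x| -> du i x = 0.
  apply: (@derive_support _ _ u (du i) (ebase i)) => // z.
  by have [_ /(_ i)[]] := hu z I.
have du0' i x : M + 1 <= `|x| -> du i x = 0.
  by move=> hx; apply: du0; rewrite (lt_le_trans _ hx)// ltrDl.
have [d0 d00 hd0] := compact_support_unif cu uM e0.
have [d d0' hd] : exists2 d, 0 < d &
    forall i x y, `|x - y| <= d -> `|du i x - du i y| <= e.
  have : \forall d \near (0:R)^'+, 0 < d /\
      forall i x y, `|x - y| <= d -> `|du i x - du i y| <= e.
    near=> d; split; first by near: d; exact: nbhs_right_gt.
    near: d; apply: filter_forall => i.
    have [di di0 hdi] := compact_support_unif (cdu i) (du0' i) e0.
    near=> d => x y xy; apply: hdi; apply: le_trans xy _.
    by near: d; exact: nbhs_right_le.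
  by move=> /(@filter_ex _ _ _)[d [dd0 hd]]; exists d.
pose h := Num.min (d0 / 4) (Num.min (d / 4) (r / 8)).
have h0 : 0 < h by rewrite !lt_min !divr_gt0.
have hd0h : 4 * h <= d0.
  have : h <= d0 / 4 by rewrite ge_min lexx.
  by rewrite ler_pdivlMr// mulrC.
have hdh : 4 * h <= d.
  have : h <= d / 4 by rewrite !ge_min lexx orbT.
  by rewrite ler_pdivlMr// mulrC.
have hrh : 8 * h <= r.
  have : h <= r / 8 by rewrite !ge_min lexx !orbT.
  by rewrite ler_pdivlMr// mulrC.
clearbody h.
have [N hN] : exists N : nat, `|M| / h + 6 <= N%:R.
  exists (Num.bound (`|M| / h + 6)); apply/ltW/archi_boundP.
  by rewrite addr_ge0// divr_ge0// ltW.
have hN2 : M + 4 * h <= h * (N%:R - 2).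
  have : h * (`|M| / h + 6) <= h * N%:R by rewrite ler_pM2l.
  rewrite mulrDr mulrCA divff ?gt_eqF// mulr1.
  have := ler_norm M; lra.
have [eta [theta [pe pt det]]] := @kernels R.
pose kap (i : 'I_n) := eta.
pose I := enum 'I_n.
have Iin i : i \in I by rewrite mem_enum.
pose phi := quasi h N kap I u.
have cn x y c : 0 <= c -> (forall j, `|y ord0 j - x ord0 j| <= c) -> `|y - x| <= c.
  by move=> c0 hxy; apply: norm_le_coord => // j; rewrite !mxE.
have h3 : 0 <= 3 * h by rewrite mulr_ge0// ltW.
have out x : (forall i, i \in I -> `|x ord0 i| <= h * (N%:R - 2)) \/
    exists i, h * (N%:R - 2) < `|x ord0 i|.
  have [H|H] := pselect (exists i, h * (N%:R - 2) < `|x ord0 i|); first by right.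
  by left=> i _; rewrite leNgt; apply/negP => H1; apply: H; exists i.
have far x y i c : h * (N%:R - 2) < `|x ord0 i| -> `|y ord0 i - x ord0 i| <= c -> c <= 4 * h ->
    M <= `|y|.
  move=> h1 h2 h4; apply: le_trans (coord_le_norm y i).
  have := ler_normB (y ord0 i) (y ord0 i - x ord0 i).
  by rewrite opprB addrC subrK; lra.
have hphi : forall x, `|phi x - u x| <= e.
  move=> x; case: (out x) => [hx|[i hx]].
    apply: quasi_approx => // y hy; apply: hd0; apply: le_trans (cn _ _ _ h3 hy) _; lra.
  have ux0 : u x = 0.
    apply: uM; apply: (far x x i 0) => //; first by rewrite subrr normr0.
    by rewrite mulr_ge0// ltW.
  rewrite /phi (@quasi_support _ _ _ _ h0)//.
    by rewrite ux0 subrr normr0 ltW.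
  by move=> y hy; apply: uM; apply: (far x y i (3 * h)) => //; lra.
have dphi j x : is_derive x (ebase j) phi
    (quasi h N (fun i => if i == j then theta else kap i) I (dquot h j u) x).
  apply: (@quasi_partial _ _ _ _ h0 eta theta kap j I u M x) => //.
  - exact: enum_uniq.
  - by case: pe.
  - by move=> y hy; apply: uM; apply: le_trans hy _; exact: coord_le_norm.
  - by move: hN2; lra.
have pk j i : pou (if i == j then theta else kap i) by case: ifP.
have hder j x : `|partial j phi x - du j x| <= e.
  have [_ e1] := dphi j x; rewrite /partial [X in X - _]e1.
  case: (out x) => [hx|[i hx]].
    apply: quasi_approx => // y hy.
    have [||c /andP[c1 c2] E] := @slice_MVT R n setT u du j y (- h) 0 hC.
    - by rewrite oppr_le0 ltW.
    - by [].
    rewrite /dquot upd_shift; move: E; rewrite scale0r addr0 => ->.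
    rewrite sub0r opprK mulrC mulfK ?gt_eqF//.
    apply: hd; rewrite addrAC; apply: le_trans (ler_normD _ _) _.
    rewrite normrZ norm_ebase mulr1.
    have := cn _ _ _ h3 hy; have : `|c| <= h by rewrite ler_norml c1 (le_trans c2)// ltW.
    lra.
  have ux0 : du j x = 0.
    apply: du0; apply: lt_le_trans (coord_le_norm x i); apply: le_lt_trans hx.
    by apply: le_trans hN2; rewrite lerDl mulr_ge0// ltW.
  rewrite (@quasi_support _ _ _ _ h0)//.
    by rewrite ux0 subrr normr0 ltW.
  move=> y hy; rewrite /dquot !uM ?subrr ?mulr0//.
    have [ij|ij] := eqVneq i j.
      apply: (far x _ i (4 * h)) => //; rewrite -ij upd_same.
      apply: le_trans (_ : `|y ord0 i - x ord0 i| + h <= _); last by have := hy i; lra.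
      by rewrite addrAC (le_trans (ler_normB _ _))// lerD2l ger0_norm// ltW.
    by apply: (far x _ i (3 * h)) => //; rewrite ?upd_other//; lra.
  by apply: (far x _ i (3 * h)) => //; lra.
have sphi x : phi x != 0 -> exists2 y, `|y - x| <= 3 * h & u y != 0.
  move=> px; apply: contrapT => H; move/eqP: px; apply.
  apply: (@quasi_support _ _ _ _ h0) => // y hy.
  apply/eqP/negP => /negP uy; apply: H; exists y => //; exact: cn.
have phiM x : M + r <= `|x| -> phi x = 0.
  move=> hx; apply/eqP/negP => /negP /sphi[y yx]; apply/negP; rewrite negbK; apply/eqP/uM.
  have := ler_normB y (y - x); rewrite opprB addrC subrK; lra.
exists phi; split=> //.
have [|c1 c2] := @closed_support_compact Omega phi (M + r) h h0 phiM.
  move=> x y /sphi[z zx uz] yx; apply: (uO z) => //.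
  have -> : y - z = (y - x) - (z - x) by rewrite opprB addrA subrK.
  by apply: le_trans (ler_normB _ _) _; lra.
split=> // k; apply: quasi_smooth.
  by move=> i; case: pe.
by move=> x y hxy; congr u; apply/rowP => j; apply: hxy.
Unshelve. all: by end_near. Qed.

End approximation.

Section sobolev.
Context {R : realType} {n : nat}.
Implicit Types (u v f : 'rV[R]_n -> R) (i j : 'I_n) (x y z : 'rV[R]_n).
Local Notation mu := (@lebesgue_rV R n).

Lemma integral_support (Omega : set 'rV[R]_n) f : (forall x, ~ Omega x -> f x = 0) ->
  (\int[mu]_(x in Omega) (f x)%:E = \int[mu]_x (f x)%:E)%E.
Proof.
move=> f0; rewrite integral_mkcond; apply: eq_integral => x _.
rewrite patchE; case: ifPn => // /negP h; rewrite f0// => Ox; apply: h.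
by rewrite inE.
Qed.

Lemma L2_continuous_support (Omega : set 'rV[R]_n) f (M : R) : open Omega -> continuous f ->
  (forall x, M <= `|x| -> f x = 0) -> L2 Omega f.
Proof.
move=> oO cf f0; split.
  by apply: measurable_funS (continuous_measurable_rV cf) => //; exact: measurableT.
have c2 : continuous (fun x => f x ^+ 2).
  by move=> x; exact: (@continuousM _ _ f f x (cf x) (cf x)).
have h2 x : M <= `|x| -> f x ^+ 2 = 0 by move=> /f0 ->; rewrite expr0n.
have := continuous_support_integrable (open_measurable_rV oO) c2 h2.
move=> /integrableP[_]; apply: le_lt_trans.
rewrite le_eqVlt; apply/orP; left; apply/eqP; apply: eq_integral => x _ /=.
by rewrite ger0_norm// sqr_ge0.
Qed.

(** Uniform smallness on a fixed cube implies smallness in L^2. *)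
Lemma sq_integral_le (Omega : set 'rV[R]_n) f (M e : R) : open Omega -> 0 < M ->
  continuous f -> (forall x, M <= `|x| -> f x = 0) -> (forall x, `|f x| <= e) ->
  (\int[mu]_(x in Omega) (f x ^+ 2)%:E <= (e ^+ 2 * (M *+ 2) ^+ n)%:E)%E.
Proof.
move=> oO M0 cf f0 fe.
have mO := open_measurable_rV oO.
have c2 : continuous (fun x => f x ^+ 2).
  by move=> x; exact: (@continuousM _ _ f f x (cf x) (cf x)).
have mf2 := continuous_measurable_rV c2.
have mB := measurable_ball_rV (0 : 'rV[R]_n) M.
rewrite EFinM -(lebesgue_rV_ball (0 : 'rV[R]_n) M0).
rewrite -(setIT (ball (0 : 'rV[R]_n) M)) -integral_indic//.
rewrite -ge0_integralZl//; first last.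
- by rewrite lee_fin sqr_ge0.
- exact/measurable_EFinP/measurable_indic.
apply: (@le_trans _ _ (\int[mu]_x (f x ^+ 2)%:E)%E).
  apply: ge0_subset_integral => //; first exact/measurable_EFinP.
  by move=> x _; rewrite lee_fin sqr_ge0.
apply: ge0_le_integral => //.
- by move=> x _; rewrite lee_fin sqr_ge0.
- exact/measurable_EFinP.
- apply: measurable_funeM; exact/measurable_EFinP/measurable_indic.
move=> x _; rewrite -EFinM lee_fin indicE.
have [hx|hx] := ltP `|x| M.
  rewrite mem_set ?mulr1; last by apply/ball_rVP; rewrite subr0.
  have e0 := le_trans (normr_ge0 _) (fe x).
  by rewrite -[f x ^+ 2]ger0_norm ?sqr_ge0// normrX ler_pXn2r ?nnegrE.
by rewrite f0// expr0n/= mulr_ge0// sqr_ge0.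
Qed.

(** The classical gradient is the weak one because integrals of partial derivatives
    vanish; the uniform approximations of [C1_approx] have supports in a fixed
    ball, so they converge in H^1. *)
Lemma C1_H10 (Omega : set 'rV[R]_n) u du (r M : R) : open Omega -> C1_grad setT u du ->
  0 < r -> (forall x, M <= `|x| -> u x = 0) ->
  (forall x y, u x != 0 -> `|y - x| <= r -> Omega y) ->
  H10 Omega u (fun x => \row_i du i x).
Proof.
move=> oO hC r0 uM uO; have [_ hu] := hC.
have cu : continuous u by move=> x; have [] := hu x I.
have cdu i : continuous (du i) by move=> x; have [_ /(_ i)[]] := hu x I.
have hdu i x : is_derive x (ebase i) u (du i x) by have [_ /(_ i)[]] := hu x I.
have duM i x : M + 1 <= `|x| -> du i x = 0.
  move=> hx; apply: (derive_support (hdu i) uM).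
  by rewrite (lt_le_trans _ hx)// ltrDl.
have uO' x : ~ Omega x -> u x = 0.
  by move=> nO; apply/eqP/negP => /negP ux; apply: nO; apply: (uO x x) => //; rewrite subrr normr0 ltW.
have duO i x : ~ Omega x -> du i x = 0.
  move=> nO.
  have h : \forall y \near x, (cst 0 : 'rV[R]_n -> R) y = u y.
    apply/nbhs_ballP; exists r => // y /ball_rVP yx; apply/esym/eqP/negP => /negP uy.
    by apply: nO; apply: (uO y) => //; rewrite distrC ltW.
  have := near_eq_is_derive h (is_derive_cst 0 x (ebase i)) => -[_ <-].
  by have [_ ->] := hdu i x.
have rowE i : (fun x => (\row_j du j x : 'rV[R]_n) ord0 i) = du i.
  by apply/funext => x; rewrite mxE.
split; first split.
- exact: L2_continuous_support uM.
- by move=> i; rewrite rowE; exact: L2_continuous_support (duM i).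
- move=> phi [hphi _ _] i.
  have cphi : continuous phi := Ck_continuous (hphi 0%N).
  have cdphi : continuous (partial i phi) := Ck_continuous (Ck_partial i (hphi 1%N)).
  have dphi x := Ck_der i x (hphi 0%N.+1).
  have i1 : mu.-integrable setT (EFin \o (fun x => u x * partial i phi x)).
    apply: (@continuous_support_integrable _ _ _ M) => //.
      by move=> x; apply: (@continuousM _ _ u (partial i phi)); [exact: cu|exact: cdphi].
    by move=> x /uM ->; rewrite mul0r.
  have i2 : mu.-integrable setT (EFin \o (fun x => du i x * phi x)).
    apply: (@continuous_support_integrable _ _ _ (M + 1)) => //.
      by move=> x; apply: (@continuousM _ _ (du i) phi); [exact: cdu|exact: cphi].
    by move=> x /(duM i) ->; rewrite mul0r.
  rewrite (@integral_support Omega (fun x => u x * partial i phi x)); last first.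
    by move=> x /uO' ->; rewrite mul0r.
  rewrite (@integral_support Omega (fun x => (\row_j du j x : 'rV[R]_n) ord0 i * phi x)); last first.
    by move=> x nO; rewrite mxE duO// mul0r.
  have : (\int[mu]_x ((u x * partial i phi x)%:E + (du i x * phi x)%:E) = 0)%E.
    rewrite -[RHS](@integral_partial0 _ _ i (fun x => u x * phi x)
      (fun x => u x * partial i phi x + du i x * phi x) M).
    - by apply: eq_integral => x _; rewrite EFinD.
    - by move=> x; apply: (@continuousM _ _ u phi); [exact: cu|exact: cphi].
    - move=> x; apply: (@continuousD _ _ _ (fun x => u x * partial i phi x) (fun x => du i x * phi x)).
        by apply: (@continuousM _ _ u (partial i phi)); [exact: cu|exact: cdphi].
      by apply: (@continuousM _ _ (du i) phi); [exact: cdu|exact: cphi].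
    - move=> x; have d := is_deriveM (hdu i x) (dphi x); apply: (is_derive_eq d).
      by rewrite /GRing.scale/= [phi x * _]mulrC.
    - by move=> x /uM ->; rewrite mul0r.
  rewrite (@integralD _ _ _ mu setT measurableT _ _ i1 i2) => E.
  have f1 := integral_fune_fin_num measurableT i1.
  have f2 := integral_fune_fin_num measurableT i2.
  have -> : (\int[mu]_x ((\row_j du j x : 'rV[R]_n) ord0 i * phi x)%:E =
      \int[mu]_x (du i x * phi x)%:E)%E by apply: eq_integral => x _; rewrite mxE.
  move: E f1 f2.
  case: (\int[mu]_x _)%E => // a; case: (\int[mu]_x _)%E => // b [E] _ _.
  by congr EFin; apply/eqP; rewrite -addr_eq0 E.
- have hk (k : nat) : 0 < k.+1%:R^-1 :> R by rewrite invr_gt0.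
  have /choice[phi hphi] := fun k => C1_approx hC r0 uM uO (hk k).
  exists phi; first by move=> k; have [] := hphi k.
  pose M' := `|M| + r + 1.
  have M'0 : 0 < M' by rewrite /M' ltr_wpDl// addr_ge0// ltW.
  have lim (f : nat -> 'rV[R]_n -> R) : (forall k, continuous (f k)) ->
      (forall k x, M' <= `|x| -> f k x = 0) -> (forall k x, `|f k x| <= k.+1%:R^-1) ->
      (\int[mu]_(x in Omega) ((f k x) ^+ 2)%:E @[k --> \oo] --> 0)%E.
    move=> cf f0 fe.
    apply: (@squeeze_cvge _ _ _ _ (fun=> 0%E) _
       (fun k => ((k.+1%:R^-1) ^+ 2 * (M' *+ 2) ^+ n)%:E)).
    + apply: nearW => k; apply/andP; split; last exact: (sq_integral_le oO M'0 (cf k) (f0 k) (fe k)).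
      by apply: integral_ge0 => x _; rewrite lee_fin sqr_ge0.
    + exact: cvg_cst.
    + apply: cvg_EFin; first exact: nearW.
      have h2 : (fun k : nat => (k.+1%:R^-1 : R) ^+ 2) @ \oo --> (0 : R).
        have -> : (fun k : nat => (k.+1%:R^-1 : R) ^+ 2) = @harmonic R * @harmonic R.
          by apply/funext => k; rewrite expr2.
        by rewrite -[X in _ --> X](mulr0 (0 : R)); apply: cvgM; exact: cvg_harmonic.
      rewrite -(mul0r ((M' *+ 2) ^+ n)).
      exact: (cvgM h2 (cvg_cst _)).
  split.
    apply: lim.
    + move=> k x; have [[h _ _] _ _ _] := hphi k.
      by apply: (@continuousB _ _ _ (phi k) u); [exact: (Ck_continuous (h 0%N))|exact: cu].
    + move=> k x hx; have [_ _ _ ->] := hphi k; rewrite ?uM ?subrr//.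
        by move: hx; rewrite /M'; have := ler_norm M; lra.
      by move: hx; rewrite /M'; have := ler_norm M; lra.
    + by move=> k x; have [_ + _ _] := hphi k; exact.
  move=> i.
  rewrite (_ : (fun k => _) = (fun k => \int[mu]_(x in Omega) ((partial i (phi k) x - du i x) ^+ 2)%:E)%E); last first.
    by apply/funext => k; apply: eq_integral => x _; rewrite mxE.
  apply: (lim (fun k x => partial i (phi k) x - du i x)).
  + move=> k x; have [[h _ _] _ _ _] := hphi k.
    apply: (@continuousB _ _ _ (partial i (phi k)) (du i)); last exact: cdu.
    exact: (Ck_continuous (Ck_partial i (h 1%N))).
  + move=> k x hx; rewrite duM; last by move: hx; rewrite /M'; have := ler_norm M; lra.
    have [[h _ _] _ _ hz] := hphi k.
    have hd z := Ck_der i z (h 1%N).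
    have -> : partial i (phi k) x = 0; last by rewrite subrr.
    apply: (derive_support hd hz).
    by move: hx; rewrite /M'; have := ler_norm M; lra.
  + by move=> k x; have [_ _ + _] := hphi k; exact.
Qed.

End sobolev.

(** * The distance near a smooth boundary point *)

Section local_bounds.
Context {R : realType}.

Lemma locally_bounded_fin (T : topologicalType) (I : finType) (f : I -> T -> R) (p : T) :
  (forall k, {for p, continuous (f k)}) ->
  exists2 C, 0 < C & \forall x \near p, forall k, `|f k x| <= C.
Proof.
move=> cf; exists (1 + \sum_k (`|f k p| + 1)).
  by rewrite ltr_pwDl// sumr_ge0// => k _; rewrite addr_ge0.
apply: filter_forall => k; near=> x.
apply: (@le_trans _ _ (`|f k p| + 1)); last first.
  rewrite (bigD1 k)//= addrCA lerDl addr_ge0// sumr_ge0// => l _; exact: addr_ge0.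
rewrite -lerBlDl; apply: (le_trans (lerB_dist _ _)).
rewrite distrC; near: x; have /cvgrPdist_le := cf k; apply.
exact: ltr01.
Unshelve. all: by end_near. Qed.

Lemma near_ge_half (T : topologicalType) (f : T -> R) (p : T) :
  {for p, continuous f} -> 0 < f p -> \forall x \near p, f p / 2 <= f x.
Proof.
move=> cf f0; have h : f p / 2 < f p by rewrite ltr_pdivrMr// ltr_pMr// ltr1n.
by near=> x; apply/ltW; near: x; exact: (cvgr_gt _ cf).
Unshelve. all: by end_near. Qed.

Lemma C2_grad n (U : set 'rV[R]_n) rho : C2_defining U rho ->
  C1_grad U rho (fun j => partial j rho) /\
  forall k, C1_grad U (partial k rho) (fun j => partial j (partial k rho)).
Proof.
move=> [oU [c h] _]; split.
  apply: Ck1_C1_grad => //; split=> // i; have [h1 [h2 _]] := h i; split=> //.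
by move=> k; apply: Ck1_C1_grad => //; have [_] := h k.
Qed.

(** The mean value theorem on a segment, with the crude bound of a scalar product
    by n times the maximum norms. *)
Lemma row_lipschitz n (V : set 'rV[R]_n) f df (x v : 'rV[R]_n) (b C : R) : C1_grad V f df ->
  0 <= b -> (forall t, 0 <= t <= b -> V (x + t *: v)) ->
  (forall j y, V y -> `|df j y| <= C) ->
  `|f (x + b *: v) - f x| <= n%:R * `|v| * C * b.
Proof.
move=> hC b0 hV dfC; have [c cb ->] := line_MVT hC b0 hV.
rewrite normrM (ger0_norm b0) ler_wpM2r//; apply: le_trans (ler_norm_sum _ _ _) _.
apply: (@le_trans _ _ (\sum_(i < n) `|v| * C)).
  by apply: ler_sum => i _; rewrite normrM ler_pM ?coord_le_norm// (dfC _ _ (hV _ cb)).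
by rewrite sumr_const card_ord -[leLHS]mulr_natl mulrA.
Qed.

End local_bounds.

Section hitting.
Context {R : realType} {n : nat} (F : 'rV[R]_n.+1 -> R) (Omega : set 'rV[R]_n.+1).
Hypotheses (hF : strongly_convex_norm F) (oO : open Omega) (hb : boundary Omega !=set0).
Let dF := anisotropic_dist F Omega.
Variables (V : set 'rV[R]_n.+1) (rho : 'rV[R]_n.+1 -> R).
Hypothesis hrho : C1_grad V rho (fun j => partial j rho).
Hypothesis hxi : forall k, C1_grad V (partial k rho) (fun j => partial j (partial k rho)).
Hypothesis hbd : forall x, V x -> rho x = 0 -> boundary Omega x.
Variable C1 : R.
Hypothesis hC1 : forall k j x, V x -> `|partial j (partial k rho) x| <= C1.

Let xi (x : 'rV[R]_n.+1) : 'rV[R]_n.+1 := \row_k partial k rho x.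

(** Start from x in the direction of the gradient of F at xi(x), with the sign that
    decreases |rho|. This is motion at unit speed for the polar norm, along which
    rho changes at the rate F(xi(x)), up to a quadratic error. The hypothesis on
    b forces rho to vanish before time b, at a boundary point. *)
Lemma dist_le_hit x (b : R) : xi x != 0 -> 0 <= b ->
  (forall y, `|y - x| <= finsler_ub F * b -> V y) ->
  `|rho x| <= b * F (xi x) - (n.+1%:R * finsler_ub F) ^+ 2 * C1 * b ^+ 2 ->
  dF x <= b.
Proof.
move=> xi0 b0 hV hb'.
set s := Num.sg (rho x).
pose w := finsler_grad F (xi x).
have K0 := ltW (finsler_ub_gt0 hF).
have wK : `|w| <= finsler_ub F by apply: norm_le_coord => // j; exact: (finsler_grad_coord hF _ xi0).
have s1 : `|s| <= 1 by rewrite normr_sg; case: eqP.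
pose v := (- s) *: w.
have vK : `|v| <= finsler_ub F.
  by rewrite normrZ normrN; apply: le_trans wK; rewrite ler_piMl.
have hVt t : 0 <= t <= b -> V (x + t *: v).
  move=> /andP[t0 tb]; apply: hV; rewrite addrC addKr normrZ ger0_norm// mulrC.
  by rewrite ler_pM.
have hVt' t c : 0 <= t <= b -> 0 <= c <= t -> V (x + c *: v).
  by move=> /andP[t0 tb] /andP[c0 ct]; apply: hVt; rewrite c0 (le_trans ct).
have C10 : 0 <= C1.
  by apply: le_trans (normr_ge0 _) (hC1 ord0 ord0 (hVt 0 _)); rewrite lexx b0.
have hwxi : dotp w (xi x) = F (xi x) by rewrite dotpC (finsler_grad_self hF xi0).
have polar_v t : 0 <= t -> polar F (x - (x + t *: v)) <= t.
  move=> t0; apply: (polar_le hF) => eta.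
  have -> : x - (x + t *: v) = (t * s) *: w.
    by rewrite opprD addrA subrr sub0r /v scalerA -scaleNr mulrN opprK.
  rewrite dotpZr -mulrA ler_wpM2l//.
  have -> : s * dotp eta w = dotp (s *: eta) w by rewrite dotpC -dotpZr dotpC.
  apply: le_trans (finsler_grad_le hF _ xi0) _; rewrite (finslerZ hF).
  by rewrite ler_piMl ?(finsler_ge0 hF).
suff [t /andP[t0 tb] rt] : exists2 t, 0 <= t <= b & rho (x + t *: v) = 0.
  have bd : boundary Omega (x + t *: v) by apply: hbd => //; apply: hVt; rewrite t0.
  by apply: le_trans (dist_le hF x bd) _; exact: le_trans (polar_v _ t0) tb.
have [r0|r0] := eqVneq (rho x) 0; first by exists 0; rewrite ?lexx// scale0r addr0.
have s2 : s * s = 1 by rewrite -expr2 sqr_sg r0.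
have ss : s * rho x = `|rho x| by rewrite normrEsg.
have main : s * rho (x + b *: v) <= 0.
  have [c cb e] := line_MVT hrho b0 hVt.
  have -> : rho (x + b *: v) = rho x + (dotp v (xi (x + c *: v))) * b.
    rewrite (_ : dotp v (xi (x + c *: v)) = \sum_i v ord0 i * partial i rho (x + c *: v)).
      by rewrite -e [RHS]addrC subrK.
    by apply: eq_bigr => j _; rewrite [xi _ _ _]mxE.
  have e2 : dotp v (xi (x + c *: v)) = - s * F (xi x) - s * dotp w (xi (x + c *: v) - xi x).
    rewrite dotpC /v dotpZr dotpC.
    have -> : dotp w (xi (x + c *: v)) = dotp w (xi (x + c *: v) - xi x) + F (xi x).
      by rewrite -hwxi -dotpDr subrK.
    by ring.
  have b1 : `|dotp w (xi (x + c *: v) - xi x)| <= (n.+1%:R * finsler_ub F) ^+ 2 * C1 * b.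
    rewrite /dotp; apply: le_trans (ler_norm_sum _ _ _) _.
    apply: (@le_trans _ _ (\sum_(i < n.+1) finsler_ub F * (n.+1%:R * finsler_ub F * C1 * b))).
      apply: ler_sum => j _; rewrite normrM ler_pM//; first exact: (finsler_grad_coord hF _ xi0).
      rewrite !mxE; have /andP[c0 cb'] := cb.
      apply: le_trans (row_lipschitz (hxi j) c0 (hVt' c ^~ cb) (hC1 j)) _.
      by rewrite ler_pM ?mulr_ge0// ler_wpM2r// ler_wpM2l.
    rewrite sumr_const card_ord -[leLHS]mulr_natl expr2 le_eqVlt; apply/orP; left; apply/eqP; ring.
  rewrite e2.
  have e3 : s * (rho x + (- s * F (xi x) - s * dotp w (xi (x + c *: v) - xi x)) * b) =
      `|rho x| - (F (xi x) + dotp w (xi (x + c *: v) - xi x)) * b.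
    rewrite mulrDr ss; congr (_ + _); rewrite -[RHS]mulN1r -s2; ring.
  rewrite e3; move: b1; rewrite ler_norml => /andP[b1 _].
  have b3 := ler_wpM2r b0 b1; move: hb' b3.
  set M := _ ^+ 2 * C1; clearbody M; move: (dotp w _) (F _) => X Y.
  rewrite expr2; lra.
have cr : {within `[0, b], continuous (fun t => s * rho (x + t *: v))}.
  apply: derivable_within_continuous => t; rewrite in_itv/= => tb.
  apply: derivableM; first exact: derivable_cst.
  by have := is_derive_slice (C1_is_derive v hrho (hVt t tb)); case.
have [|t tb E] := @IVT R (fun t => s * rho (x + t *: v)) 0 b 0 b0 cr.
  rewrite scale0r addr0 ss; apply/andP; split.
    by rewrite ge_min main orbT.
  by rewrite le_max normr_ge0.
exists t; first by move: tb; rewrite in_itv.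
by have := congr1 (fun a => s * a) E; rewrite mulrA s2 mul1r mulr0.
Qed.

End hitting.

Section chart.
Context {R : realType} {n : nat} (F : 'rV[R]_n.+1 -> R) (Omega : set 'rV[R]_n.+1).
Hypotheses (hF : strongly_convex_norm F) (oO : open Omega) (hb : boundary Omega !=set0).
Let dF := anisotropic_dist F Omega.

(** The function delta = rho/F(grad rho) is a first order approximation of the
    signed distance: where rho = 0 its gradient has F-norm 1, so all errors are
    of order delta. The factor iota = F(grad rho)/(d_i rho) makes the coordinate
    vector field iota e_i transversal to the level sets with unit rate, so a
    divergence in this direction involves a single partial derivative. *)
Lemma boundary_chart p U rho : C2_defining U rho -> U p -> boundary Omega p ->
  (forall x, U x -> boundary Omega x <-> rho x = 0) ->
  exists (r C : R) (i : 'I_n.+1) (delta iota : 'rV[R]_n.+1 -> R)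
    (ddelta diota : 'I_n.+1 -> 'rV[R]_n.+1 -> R),
  [/\ 0 < r, 1 <= C, C1_grad (ball p r) delta ddelta, C1_grad (ball p r) iota diota &
  forall x, ball p r x -> [/\ boundary Omega x <-> delta x = 0,
    F (\row_j ddelta j x) <= 1 + C * `|delta x|,
    `|iota x * ddelta i x - 1| <= C * `|delta x|,
    [/\ `|iota x| <= C, `|diota i x| <= C & forall j, `|ddelta j x| <= C] &
    Omega x -> dF x <= `|delta x| * (1 + C * `|delta x|)]].
Proof.
move=> hdef Up bp hbU; have [oU _ hgrad] := hdef.
have [hrho hxi] := C2_grad hdef.
have [i xip] := hgrad p Up.
have [_ hxi'] := hxi i; have [cxi_i _] := hxi' p Up.
have rp : rho p = 0 by apply/(hbU p Up).
have xi_i0 : \forall x \near p, U x /\ partial i rho x != 0.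
  near=> x; split; first by near: x; exact: open_nbhs_nbhs.
  near: x; have xn : 0 < `|partial i rho p| by rewrite normr_gt0.
  have cn : {for p, continuous (fun x => `|partial i rho x|)}.
    apply: (@continuous_comp _ _ _ (partial i rho) Num.norm) => //; exact: norm_continuous.
  by near=> x; rewrite -normr_gt0; near: x; exact: (cvgr_gt _ cn).
have [r0 r00 hr0] := rV_near_ball xi_i0.
pose V0 := ball p r0.
have oV0 : open V0 by exact: ball_open.
have V0p : V0 p by exact: ballxx.
have V0U x : V0 x -> U x /\ partial i rho x != 0 by move=> /ball_rVP /hr0.
have V0US : V0 `<=` U by move=> x /V0U[].
have hrho0 := C1_gradS oV0 V0US hrho.
have hxi0 k := C1_gradS oV0 V0US (hxi k).
pose xi x : 'rV[R]_n.+1 := \row_k partial k rho x.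
have xi0 x : V0 x -> xi x != 0.
  move=> /V0U[_]; apply: contraNneq => /rowP /(_ i); rewrite !mxE => ->.
  by rewrite eqxx.
pose N x := F (xi x).
pose dN j x := \sum_k partial j (partial k rho) x * partial k F (xi x).
have hN : C1_grad V0 N dN := C1_chain oV0 (finsler_C1 hF) hxi0 xi0.
have N0 x : V0 x -> 0 < N x by move=> /xi0 h; exact: (finsler_gt0 hF h).
have hiN := C1_gradV hN (fun x Vx => lt0r_neq0 (N0 x Vx)).
have hxiV := C1_gradV (hxi0 i) (fun x Vx => (V0U x Vx).2).
pose delta x := rho x * (N x)^-1.
pose ddelta j x := rho x * (- (N x) ^- 2 * dN j x) + (N x)^-1 * partial j rho x.
have hd : C1_grad V0 delta ddelta := C1_gradM hrho0 hiN.
pose iota x := N x * (partial i rho x)^-1.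
pose diota j x := N x * (- (partial i rho x) ^- 2 * partial j (partial i rho) x) +
  (partial i rho x)^-1 * dN j x.
have hio : C1_grad V0 iota diota := C1_gradM hN hxiV.
have cont f df : C1_grad V0 f df -> {for p, continuous f} by move=> [_ /(_ p V0p)[]].
have contd f df j : C1_grad V0 f df -> {for p, continuous (df j)}.
  by move=> [_ /(_ p V0p)[_ /(_ j)[]]].
have [CN CN0 bN] := locally_bounded_fin (fun j => contd _ _ j hN).
have [C2 C20 b2] := locally_bounded_fin (fun kj : 'I_n.+1 * 'I_n.+1 => contd _ _ kj.2 (hxi0 kj.1)).
have [Ci Ci0 bi] := locally_bounded (cont _ _ hiN).
have [Cx Cx0 bx] := locally_bounded (cont _ _ hxiV).
have [Co Co0 bo] := locally_bounded (cont _ _ hio).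
have [Cdo Cdo0 bdo] := locally_bounded (contd _ _ i hio).
have [Cd Cd0 bd] := locally_bounded_fin (fun j => contd _ _ j hd).
have Np := N0 p V0p.
pose m := N p / 2.
have m0 : 0 < m by rewrite divr_gt0.
have bm : \forall x \near p, m <= N x by apply: near_ge_half => //; exact: cont hN.
have K0 := finsler_ub_gt0 hF; set K := finsler_ub F in K0.
have b2' : \forall x \near p, V0 x /\ forall kj : 'I_n.+1 * 'I_n.+1,
    `|partial kj.2 (partial kj.1 rho) x| <= C2.
  near=> x; split; first by near: x; exact: open_nbhs_nbhs.
  by near: x.
have [r1 r10 hr1] := rV_near_ball b2'.
pose V1 := ball p r1.
have oV1 : open V1 by exact: ball_open.
have V1V0 : V1 `<=` V0 by move=> x /ball_rVP /hr1[].
pose M := (n.+1%:R * K) ^+ 2 * C2.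
have M0 : 0 <= M by rewrite mulr_ge0 ?sqr_ge0// ltW.
pose C := 1 + Ci * (K * CN) + CN * Cx + Co + Cdo + Cd + 4 * M / m.
have p1 : 0 <= Ci * (K * CN) by rewrite !mulr_ge0// ltW.
have p2 : 0 <= CN * Cx by rewrite mulr_ge0// ltW.
have p3 : 0 <= 4 * M / m by rewrite divr_ge0 ?mulr_ge0// ltW.
have [C0 CCi CCx CCo [CCdo CCd CM4]] : [/\ 1 <= C, Ci * (K * CN) <= C, CN * Cx <= C, Co <= C &
    [/\ Cdo <= C, Cd <= C & 4 * M / m <= C]].
  have gen (a b c d e f : R) : 0 <= a -> 0 <= b -> 0 <= c -> 0 <= d -> 0 <= e -> 0 <= f ->
      let t := 1 + a + b + c + d + e + f in
      [/\ 1 <= t, a <= t, b <= t, c <= t & [/\ d <= t, e <= t & f <= t]].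
    by rewrite /=; clear=> *; split; [..|split]; lra.
  by apply: gen => //; exact: ltW.
have Cgt0 : 0 < C by exact: lt_le_trans C0.
(* Below this size of delta, a path of polar length 2 |delta| stays in the chart and
   1 + C |delta| <= 2. *)
pose c0 := Num.min (C^-1) (r1 / (8 * K)).
have c00 : 0 < c0 by rewrite lt_min invr_gt0 Cgt0/= divr_gt0// mulr_gt0.
have dp : delta p = 0 by rewrite /delta rp mul0r.
have bdel : \forall x \near p, `|delta x| <= c0.
  have := cont _ _ hd => /cvgrPdist_le /(_ _ c00); rewrite dp.
  by apply: filterS => x; rewrite sub0r normrN.
have all : \forall x \near p, [/\ V0 x, `|x - p| < r1 / 2, `|delta x| <= c0, m <= N x &
    [/\ forall j, `|dN j x| <= CN, `|(N x)^-1| <= Ci, `|(partial i rho x)^-1| <= Cx,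
     `|iota x| <= Co & `|diota i x| <= Cdo /\ forall j, `|ddelta j x| <= Cd]].
  near=> x; split; [| | | |split; [| | | |split]]; near: x => //.
  - exact: open_nbhs_nbhs.
  - apply/nbhs_ballP; exists (r1 / 2); first by rewrite /= divr_gt0.
    by move=> x /ball_rVP.
have [r rpos hr] := rV_near_ball all.
have VrV0 : ball p r `<=` V0 by move=> x /ball_rVP /hr[].
exists r, C, i, delta, iota, ddelta, diota; split=> //.
- exact: (C1_gradS (@ball_open _ _ p r) VrV0 hd).
- exact: (C1_gradS (@ball_open _ _ p r) VrV0 hio).
move=> x /ball_rVP /hr[Vx xr1 dx mN [hdN hiNx hxix hio' [hdio hdd]]].
have [Ux xix] := V0U x Vx.
have Nx := N0 x Vx.
have Nx0 := lt0r_neq0 Nx.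
have ddE j : ddelta j x = (N x)^-1 * (partial j rho x - delta x * dN j x).
  by rewrite /ddelta /delta; field.
split.
- rewrite hbU//; rewrite /delta; split=> [->|/eqP]; first by rewrite mul0r.
  by rewrite mulf_eq0 invr_eq0 (negbTE Nx0) orbF => /eqP.
- have -> : (\row_j ddelta j x : 'rV[R]_n.+1) = (N x)^-1 *: (xi x + (- delta x) *: \row_j dN j x).
    by apply/rowP => j; rewrite !mxE ddE mulNr.
  rewrite (finslerZ hF) gtr0_norm ?invr_gt0//.
  apply: (@le_trans _ _ ((N x)^-1 * (N x + `|delta x| * (K * CN)))).
    rewrite ler_pM2l ?invr_gt0//; apply: le_trans (finsler_triangle hF _ _) _.
    rewrite lerD2l (finslerZ hF) normrN ler_wpM2l//.
    apply: le_trans (finsler_le_ub hF _) _; rewrite ler_pM2l//.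
    by apply: norm_le_coord => [|j]; [exact: ltW|rewrite mxE].
  rewrite mulrDr mulVf// lerD2l mulrCA mulrC ler_wpM2r//.
  apply: (@le_trans _ _ (Ci * (K * CN))); last exact: CCi.
  apply: ler_wpM2r; last exact: le_trans (ler_norm _) hiNx.
  by rewrite mulr_ge0 // ltW.
- have -> : iota x * ddelta i x - 1 = - (delta x * (dN i x * (partial i rho x)^-1)).
    rewrite ddE /iota; move: (delta x) (dN i x) => c d.
    move: (N x) Nx0 (partial i rho x) xix => a a0 b b0.
    by field; rewrite a0 b0.
  rewrite normrN normrM mulrC ler_wpM2r// normrM.
  apply: (@le_trans _ _ (CN * Cx)); last exact: CCx.
  by rewrite ler_pM.
- split.
  + exact: le_trans hio' CCo.
  + exact: le_trans hdio CCdo.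
  + by move=> j; exact: le_trans (hdd j) CCd.
- move=> Ox; set s := `|delta x|.
  have s0 : 0 <= s by exact: normr_ge0.
  have sC : C * s <= 1.
    apply: (@le_trans _ _ (C * c0)); first by rewrite ler_pM2l.
    by rewrite -ler_pdivlMl// mulr1 ge_min lexx.
  have sK : 8 * K * s <= r1.
    apply: (@le_trans _ _ (8 * K * c0)); first by rewrite ler_pM2l// mulr_gt0.
    by rewrite -ler_pdivlMl ?mulr_gt0// mulrC ge_min lexx orbT.
  have hb2 : s * (1 + C * s) <= 2 * s.
    by rewrite mulrC ler_wpM2r// -[2]/(1 + 1) lerD2l.
  have h1 := C1_gradS oV1 V1V0 hrho0.
  have h2 k := C1_gradS oV1 V1V0 (hxi0 k).
  have h3 y : V1 y -> rho y = 0 -> boundary Omega y.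
    by move=> /V1V0/V0U[Uy _] ry; apply/(hbU y Uy).
  have h4 k j y : V1 y -> `|partial j (partial k rho) y| <= C2.
    by move=> /ball_rVP /hr1[_ /(_ (k, j))].
  apply: (dist_le_hit hF h1 h2 h3 h4).
  + exact: xi0.
  + by rewrite mulr_ge0// addr_ge0// mulr_ge0// ltW.
  + move=> y hy; apply/ball_rVP; have -> : y - p = (y - x) + (x - p) by rewrite addrA subrK.
    apply: le_lt_trans (ler_normD _ _) _; rewrite (splitr r1) ler_ltD//.
    apply: le_trans hy _; apply: (@le_trans _ _ (K * (2 * s))); first by rewrite ler_pM2l.
    lra.
  + rewrite -/K -/M -/(xi x) -/(N x).
    have -> : `|rho x| = s * N x.
      by rewrite /s /delta normrM normfV (gtr0_norm Nx) mulfVK.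
    have CM : 4 * M <= C * N x.
      apply: (@le_trans _ _ (4 * M / m * m)); first by rewrite mulfVK// lt0r_neq0.
      by apply: ler_pM => //; exact: ltW.
    have hs : (s * (1 + C * s)) ^+ 2 <= 4 * s ^+ 2.
      rewrite exprMn mulrC ler_wpM2r ?sqr_ge0//.
      have h5 : 0 <= 1 + C * s <= 2 by apply/andP; split; [rewrite addr_ge0// mulr_ge0// ltW|rewrite -[2]/(1 + 1) lerD2l].
      have -> : 4 = 2 ^+ 2 :> R by rewrite -natrX.
      by move: h5 => /andP[h5 h6]; rewrite ler_pXn2r ?nnegrE.
    have h6 : M * (s * (1 + C * s)) ^+ 2 <= C * N x * s ^+ 2.
      apply: le_trans (ler_wpM2l M0 hs) _; apply: le_trans _ (ler_wpM2r (sqr_ge0 s) CM).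
      by rewrite le_eqVlt; apply/orP; left; apply/eqP; ring.
    rewrite (_ : s * (1 + C * s) * N x = s * N x + C * N x * s ^+ 2); last by ring.
    by rewrite -addrA lerDl subr_ge0.
Unshelve. all: by end_near. Qed.

End chart.

(** * The one-dimensional profile *)

Section profile.
Context {R : realType}.
Implicit Types (t tau : R).

Definition ppart t : R := Num.max t 0.

Lemma ppart_ge0 t : 0 <= ppart t. Proof. by rewrite le_max lexx orbT. Qed.

Lemma ppart_le t (c : R) : 0 <= c -> t <= c -> ppart t <= c.
Proof. by move=> c0 tc; rewrite ge_max tc. Qed.

Lemma ppart_cases t : ppart t = 0 \/ (0 < ppart t /\ ppart t = t).
Proof.
have [h|h] := leP t 0; first by left; rewrite /ppart max_r.
by right; rewrite /ppart max_l// ltW.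
Qed.

(** Powers at least 2 of the positive part are C^1; at 0 the difference quotient is
    bounded by |h|. *)
Lemma ppart_der m t : is_derive t (1:R) (fun t => ppart t ^+ m.+2) (m.+2%:R * ppart t ^+ m.+1).
Proof.
have [t0|t0|<-] := ltgtP 0 t.
- have h := derX m.+2 (derI t).
  have -> : m.+2%:R * ppart t ^+ m.+1 = m.+2%:R * t ^+ m.+1 * 1.
    by rewrite /ppart max_l ?mulr1// ltW.
  apply: der_near h; near=> s; rewrite /ppart max_l// ltW//; near: s; exact: lt_nbhsr.
- have -> : m.+2%:R * ppart t ^+ m.+1 = 0.
    by rewrite /ppart max_r ?expr0n ?mulr0// ltW.
  apply: der_near (derC 0 t); near=> s; rewrite /ppart max_r ?expr0n//.
  by apply/ltW; near: s; exact: lt_nbhsl.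
- have -> : m.+2%:R * ppart 0 ^+ m.+1 = 0 :> R by rewrite /ppart maxxx expr0n mulr0.
  have hc : h^-1 *: (((fun t => ppart t ^+ m.+2) \o shift 0) (h *: (1 : R)) - ppart 0 ^+ m.+2)
      @[h --> 0^'] --> (0 : R).
    apply/cvgrPdist_le => e e0; near=> h.
    have h0 : h != 0 by near: h; exact: nbhs_dnbhs_neq.
    rewrite sub0r normrN [ppart 0]/ppart maxxx expr0n subr0 /= addr0 [h *: 1]mulr1.
    have h1 : `|h| <= 1 by near: h; apply: dnbhs0_le.
    rewrite [_ *: _]mulrC normrM normfV ler_pdivrMr ?normr_gt0//.
    apply: (@le_trans _ _ (`|h| ^+ m.+2)).
      rewrite normrX lerXn2r ?nnegrE// ger0_norm ?ppart_ge0//.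
      by rewrite ppart_le// ler_norm.
    rewrite exprS mulrC ler_wpM2r//.
    apply: (@le_trans _ _ (`|h|)); last by near: h; apply: dnbhs0_le.
    by rewrite exprS ger_pMr ?normr_gt0// exprn_ile1.
  by split; [apply/cvg_ex; exists 0|exact/cvg_lim].
Unshelve. all: by end_near. Qed.

Lemma ppart_continuous : continuous ppart.
Proof.
move=> t; apply/cvgrPdist_le => e e0; near=> s.
apply: (@le_trans _ _ `|t - s|); last first.
  by near: s; apply: cvgr_dist_le; first exact: cvg_id.
have a := ler_norm (t - s); have b := ler_norm (s - t); rewrite distrC in b.
have c := normr_ge0 (t - s).
rewrite ler_norml /ppart; case: (leP t 0) => h1; case: (leP s 0) => h2;
  apply/andP; split; lra.
Unshelve. all: by end_near. Qed.

Variables (L sig0 : R).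
Hypothesis L1 : 1 <= L.

Let L0 : 0 < L. Proof. exact: lt_le_trans L1. Qed.

Definition wpos tau : R := (ln tau - sig0) / L.

(** Its square is of class C^1, which is what the profile needs; the polynomial form
    makes [corrector] explicit. *)
Definition window tau : R := ppart (1 - wpos tau ^+ 2).

Lemma is_derive_wpos tau : 0 < tau -> is_derive tau (1:R) wpos (tau^-1 / L).
Proof.
move=> t0; apply: (derE (derM (derB (is_derive1_ln t0) (derC sig0 tau)) (derC L^-1 tau))).
by rewrite mulr0 add0r subr0 mulrC.
Qed.

Lemma is_derive_window m tau : 0 < tau -> is_derive tau (1:R) (fun t => window t ^+ m.+2)
  (m.+2%:R * window tau ^+ m.+1 * (- (2 * wpos tau * (tau^-1 / L)))).
Proof.
move=> t0.
have h := derB (derC 1 tau) (derX 2 (is_derive_wpos t0)).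
apply: (derE (derComp h (ppart_der m _))).
by rewrite /window; congr (_ * _); rewrite sub0r /= expr1.
Qed.

Lemma window_ge0 tau : 0 <= window tau. Proof. exact: ppart_ge0. Qed.

Lemma window_cases tau : window tau = 0 \/ (0 < window tau /\ window tau = 1 - wpos tau ^+ 2).
Proof. exact: ppart_cases. Qed.

Lemma window_le1 tau : window tau <= 1.
Proof. by rewrite ppart_le// gerBl sqr_ge0. Qed.

(** This is sqrt (tau exp(-tau)) P^2 with P the window. With tau = ln (D/s) the
    first factor is sqrt (s tau/D), the critical profile of the half line. *)
Definition profile tau : R := expR ((ln tau - tau) / 2) * window tau ^+ 2.

(** The derivative of the profile divided by sqrt (tau exp(-tau)). *)
Definition slope tau : R := (tau^-1 - 1) / 2 * window tau ^+ 2 - 4 * wpos tau * window tau / (L * tau).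

Lemma is_derive_profile tau : 0 < tau -> is_derive tau (1:R) profile (expR ((ln tau - tau) / 2) * slope tau).
Proof.
move=> t0.
have h1 := derM (derB (is_derive1_ln t0) (derI tau)) (derC 2^-1 tau).
have h2 := derComp h1 (is_derive_expR _).
apply: (derE (derM h2 (is_derive_window 0 t0))).
rewrite /slope /= expr1 invfM; ring.
Qed.

(** In terms of z = [wpos], a primitive of 16 z^2 P^2 - 3 P^4: the squared slope
    contributes z^2 P^2 with the wrong sign, and subtracting a total derivative
    reverses it at the cost of a multiple of P^4. *)
Definition corrector tau : R := wpos tau * (wpos tau ^+ 2 - 9) / 3 * window tau ^+ 3.
Definition corrector_der tau : R := (16 * wpos tau ^+ 2 * window tau ^+ 2 - 3 * window tau ^+ 4) * (tau^-1 / L).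

(** The function whose total derivative is discarded by integration. The first term
    removes the cross term of the squared slope, the second one the wrong sign
    described at [corrector]. *)
Definition flux_coef tau : R := (1 - tau) / 2 * window tau ^+ 4 + 2 / L * corrector tau.
Definition flux_coef_der tau : R := - (window tau ^+ 4) / 2 - (1 - tau) * 4 * wpos tau * window tau ^+ 3 * (tau^-1 / L)
  + 2 / L * corrector_der tau.

Lemma is_derive_corrector tau : 0 < tau -> is_derive tau (1:R) corrector (corrector_der tau).
Proof.
move=> t0; have hz := is_derive_wpos t0.
have h1 := derM (derM hz (derB (derX 2 hz) (derC 9 tau))) (derC 3^-1 tau).
apply: (derE (derM h1 (is_derive_window 1 t0))).
rewrite /corrector_der /=; move: (tau^-1 / L) => y; case: (window_cases tau) => [->|[_ ->]].
  by rewrite !expr0n/=; ring.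
by field.
Qed.

Lemma is_derive_flux_coef tau : 0 < tau -> is_derive tau (1:R) flux_coef (flux_coef_der tau).
Proof.
move=> t0.
have h1 := derM (derB (derC 1 tau) (derI tau)) (derC 2^-1 tau).
have h2 := derM h1 (is_derive_window 2 t0).
apply: (derE (derD h2 (derMl (2 / L) (is_derive_corrector t0)))).
by rewrite /flux_coef_der /=; move: (tau^-1 / L) (corrector_der tau) => y w; field; rewrite lt0r_neq0.
Qed.

(** The one-dimensional inequality. Expanding the square, tau slope^2 is
    tau P^4/4 plus the derivative of [flux_coef] plus
    ((1/4 + 6/L^2) P^4 - 16 z^2 P^2/L^2)/tau. When B' exceeds 1/4 by 22/L^2, what
    is left is at least 16 (P^4 + z^2 P^2)/L^2, and P^4 + z^2 P^2 >= 3 P^2/4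
    because P = 1 - z^2 on the support. *)
Lemma hardy_profile B' tau : 0 < tau -> 1 / 4 + 22 / L ^+ 2 <= B' ->
  tau * slope tau ^+ 2 <= tau * window tau ^+ 4 / 4 + B' * window tau ^+ 4 / tau + flux_coef_der tau
    - 12 / L ^+ 2 * window tau ^+ 2 / tau.
Proof.
move=> t0 hB.
have E : tau * slope tau ^+ 2 = tau * window tau ^+ 4 / 4 + flux_coef_der tau +
    ((1 / 4 + 6 / L ^+ 2) * window tau ^+ 4 - 16 / L ^+ 2 * (wpos tau ^+ 2 * window tau ^+ 2)) / tau.
  rewrite /slope /flux_coef_der /corrector_der; move: (window tau) (wpos tau) => p z.
  by field; rewrite !lt0r_neq0.
rewrite E; set p := window tau; set z := wpos tau.
have K : (1 / 4 + 6 / L ^+ 2) * p ^+ 4 - 16 / L ^+ 2 * (z ^+ 2 * p ^+ 2) <=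
   B' * p ^+ 4 - 12 / L ^+ 2 * p ^+ 2.
  have y0 : 0 < (L ^+ 2)^-1 by rewrite invr_gt0 exprn_gt0.
  have h1 : (1 / 4 + 22 / L ^+ 2) * p ^+ 4 <= B' * p ^+ 4.
    by rewrite ler_wpM2r// exprn_ge0// window_ge0.
  have h2 : 12 * p ^+ 2 <= 16 * (p ^+ 4 + z ^+ 2 * p ^+ 2).
    rewrite /p; case: (window_cases tau) => [->|[_ e]]; first by rewrite !expr0n/=; lra.
    rewrite e -/z.
    have : 0 <= (1 - z ^+ 2) ^+ 2 * (2 * z ^+ 2 - 1) ^+ 2 by rewrite mulr_ge0 ?sqr_ge0.
    by move=> h; nra.
  have := ler_wpM2r (ltW y0) h2.
  move: h1; move: (L ^+ 2)^-1 => y; lra.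
have := ler_wpM2r (ltW (_ : 0 < tau^-1)) K; rewrite invr_gt0 => /(_ t0).
lra.
Qed.

Lemma slope_bound tau : 1 <= tau -> `|slope tau| <= 5 * window tau.
Proof.
move=> t1; have t0 : 0 < tau by exact: lt_le_trans t1.
case: (window_cases tau) => [e|[p0 e]].
  by rewrite /slope e expr0n/= !mulr0 !mul0r subrr normr0.
have z1 : `|wpos tau| <= 1.
  by rewrite -(@ler_pXn2r _ 2) ?nnegrE// expr1n -normrX ger0_norm ?sqr_ge0//; lra.
have p1 := window_le1 tau.
have ti : 0 <= tau^-1 <= 1 by rewrite invr_ge0 ltW//= invf_le1.
have Li : 0 <= L^-1 <= 1 by rewrite invr_ge0 ltW//= invf_le1.
apply: le_trans (ler_normB _ _) _.
have h1 : `|(tau^-1 - 1) / 2 * window tau ^+ 2| <= window tau.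
  rewrite normrM [`|window tau ^+ 2|]ger0_norm ?sqr_ge0// expr2 mulrA ger_pMl//.
  rewrite mulr_ile1 ?window_ge0// ler_norml; move/andP: ti => [a b].
  by apply/andP; split; lra.
have h2 : `|4 * wpos tau * window tau / (L * tau)| <= 4 * window tau.
  move/andP: Li => [La Lb]; move/andP: ti => [ta tb].
  have e1 : `|wpos tau| * (L^-1 * tau^-1) <= 1 by rewrite mulr_ile1 ?mulr_ge0 ?mulr_ile1.
  move: (wpos tau) e1 => z e1.
  have n4 : `|4| = 4 :> R by rewrite ger0_norm.
  have nL : `|(L * tau)^-1| = L^-1 * tau^-1 by rewrite ger0_norm invfM// mulr_ge0.
  rewrite 3!normrM nL n4 (ger0_norm (window_ge0 _)).
  rewrite (_ : 4 * `|z| * window tau * (L^-1 * tau^-1) = 4 * window tau * (`|z| * (L^-1 * tau^-1))); last by ring.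
  by rewrite ger_pMr// mulr_gt0.
lra.
Qed.

Lemma flux_coef_bound tau : 1 <= tau -> `|flux_coef tau| <= 10 * tau * window tau ^+ 2.
Proof.
move=> t1; have t0 : 0 < tau by exact: lt_le_trans t1.
case: (window_cases tau) => [e|[p0 e]].
  by rewrite /flux_coef /corrector e !expr0n/= !mulr0 addr0 normr0.
have z1 : `|wpos tau| <= 1.
  by rewrite -(@ler_pXn2r _ 2) ?nnegrE// expr1n -normrX ger0_norm ?sqr_ge0//; lra.
have p1 := window_le1 tau.
have Li : 0 <= L^-1 <= 1 by rewrite invr_ge0 ltW//= invf_le1.
apply: le_trans (ler_normD _ _) _.
have h1 : `|(1 - tau) / 2 * window tau ^+ 4| <= tau * window tau ^+ 2.
  rewrite normrM [`|window tau ^+ 4|]ger0_norm ?exprn_ge0 ?window_ge0//.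
  apply: ler_pM => //; first by rewrite exprn_ge0 ?window_ge0.
    by rewrite ler_norml; apply/andP; split; lra.
  by rewrite (_ : 4 = 2 + 2)%N// exprD ger_pMr ?exprn_gt0// exprn_ile1 ?window_ge0.
have h2 : `|2 / L * corrector tau| <= 9 * window tau ^+ 2.
  move/andP: Li => [La Lb].
  have p2 : 0 <= window tau ^+ 2 by rewrite exprn_ge0 ?window_ge0.
  have e9 : `|wpos tau ^+ 2 - 9| <= 9.
    have := sqr_ge0 (wpos tau).
    have : wpos tau ^+ 2 <= 1 by rewrite -[wpos tau ^+ 2]ger0_norm ?sqr_ge0// normrX exprn_ile1.
    by move=> a b; rewrite ler_norml; apply/andP; split; lra.
  rewrite /corrector; move: (wpos tau) e9 z1 => z e9 z1.
  have e4 : `|z| * `|z ^+ 2 - 9| <= 1 * 9 by rewrite ler_pM.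
  have e5 : window tau ^+ 3 <= window tau ^+ 2 by rewrite exprS ger_pMl// exprn_gt0.
  have e6 : `|z * (z ^+ 2 - 9)| * window tau ^+ 3 <= 9 * window tau ^+ 2.
    apply: ler_pM => //; first exact: exprn_ge0 (window_ge0 tau).
    by rewrite normrM; move: e4; rewrite mul1r.
  have e7 : 0 <= `|z * (z ^+ 2 - 9)| * window tau ^+ 3 :=
    mulr_ge0 (normr_ge0 _) (exprn_ge0 3 (window_ge0 tau)).
  have -> : 2 / L * (z * (z ^+ 2 - 9) / 3 * window tau ^+ 3) =
      (2 / 3 * L^-1) * ((z * (z ^+ 2 - 9)) * window tau ^+ 3) by ring.
  rewrite normrM [`|z * _ * _|]normrM (ger0_norm (exprn_ge0 3 (window_ge0 tau))).
  have nL : `|2 / 3 * L^-1| <= 1.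
    by rewrite ger0_norm ?mulr_ge0//; lra.
  by apply: le_trans e6; rewrite ler_piMl.
have h3 : window tau ^+ 2 <= tau * window tau ^+ 2 by rewrite ler_peMl// exprn_ge0 ?window_ge0.
lra.
Qed.

End profile.

Section profile_continuity.
Context {R : realType}.
Implicit Types (t tau : R) (f g : R -> R).

Lemma contM f g t : {for t, continuous f} -> {for t, continuous g} ->
  {for t, continuous (fun s => f s * g s)}.
Proof. exact: continuousM. Qed.

Lemma contD f g t : {for t, continuous f} -> {for t, continuous g} ->
  {for t, continuous (fun s => f s + g s)}.
Proof. exact: continuousD. Qed.

Lemma contN f t : {for t, continuous f} -> {for t, continuous (fun s => - f s)}.
Proof. exact: continuousN. Qed.

Lemma contC (c t : R) : {for t, continuous (fun=> c)}.
Proof. exact: cst_continuous. Qed.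

Lemma contX f m t : {for t, continuous f} -> {for t, continuous (fun s => f s ^+ m)}.
Proof.
move=> cf; elim: m => [|m ih]; first exact: contC.
rewrite (_ : (fun s => _) = (fun s => f s * f s ^+ m)); first exact: contM.
by apply/funext => s; rewrite exprS.
Qed.

Lemma contV f t : f t != 0 -> {for t, continuous f} -> {for t, continuous (fun s => (f s)^-1)}.
Proof. by move=> f0 cf; exact: continuousV. Qed.

Lemma contcomp (h : R -> R) f t : {for t, continuous f} -> {for f t, continuous h} ->
  {for t, continuous (fun s => h (f s))}.
Proof. by move=> cf ch; exact: (@continuous_comp _ _ _ f h). Qed.

Variables (L sig0 : R).
Hypothesis L1 : 1 <= L.
Local Notation wpos := (wpos L sig0).
Local Notation window := (window L sig0).

Let L0 : 0 < L. Proof. exact: lt_le_trans L1. Qed.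

Lemma flux_coef_der_bound tau : 1 <= tau -> `|flux_coef_der L sig0 tau| <= 50 * tau * window tau ^+ 2.
Proof.
move=> t1; have t0 : 0 < tau by exact: lt_le_trans t1.
have p0 := window_ge0 L sig0 tau; have p1 := window_le1 L sig0 tau.
have p2 : 0 <= window tau ^+ 2 by exact: exprn_ge0.
have p42 : window tau ^+ 4 <= window tau ^+ 2 by apply: ler_wiXn2l.
have p32 : window tau ^+ 3 <= window tau ^+ 2 by apply: ler_wiXn2l.
have p3 : 0 <= window tau ^+ 3 by exact: exprn_ge0.
have p4 : 0 <= window tau ^+ 4 by exact: exprn_ge0.
case: (window_cases L sig0 tau) => [e|[p0' e]].
  by rewrite /flux_coef_der /corrector_der e !expr0n/= !(mulr0, mul0r, subr0, addr0, oppr0) normr0.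
have z2 : wpos tau ^+ 2 <= 1 by lra.
have z1 : `|wpos tau| <= 1.
  by rewrite -(@ler_pXn2r _ 2) ?nnegrE// expr1n -normrX ger0_norm ?sqr_ge0.
have La : 0 <= L^-1 by rewrite invr_ge0 ltW.
have Lb : L^-1 <= 1 by rewrite invf_le1.
have ta : 0 <= tau^-1 by rewrite invr_ge0 ltW.
have tb : tau^-1 <= 1 by rewrite invf_le1.
have h1 : `|- (window tau ^+ 4) / 2| <= window tau ^+ 2.
  by rewrite mulNr normrN ger0_norm; lra.
have h2 : `|(1 - tau) * 4 * wpos tau * window tau ^+ 3 * (tau^-1 / L)| <= 4 * window tau ^+ 2.
  rewrite (_ : (1 - tau) * 4 * wpos tau * window tau ^+ 3 * (tau^-1 / L) =
    ((tau^-1 - tau * tau^-1) * L^-1) * wpos tau * (4 * window tau ^+ 3)); last by ring.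
  rewrite divff ?lt0r_neq0// normrM [X in _ * X]ger0_norm; last by rewrite mulr_ge0.
  apply: (@le_trans _ _ (1 * (4 * window tau ^+ 3))); last by rewrite mul1r ler_pM2l.
  apply: ler_wpM2r; first by rewrite mulr_ge0.
  rewrite 2!normrM (ger0_norm La) mulr_ile1// ?mulr_ge0// mulr_ile1//.
  by rewrite ler_norml; apply/andP; split; lra.
have h3 : `|2 / L * corrector_der L sig0 tau| <= 38 * window tau ^+ 2.
  rewrite /corrector_der (_ : 2 / L * ((16 * wpos tau ^+ 2 * window tau ^+ 2 - 3 * window tau ^+ 4) * (tau^-1 / L)) =
    (L^-1 * tau^-1 * L^-1) * (2 * (16 * (wpos tau ^+ 2 * window tau ^+ 2) - 3 * window tau ^+ 4))); last by ring.
  rewrite normrM; apply: (@le_trans _ _ (1 * (38 * window tau ^+ 2))); last by rewrite mul1r.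
  apply: ler_pM => //.
    by rewrite ger0_norm ?mulr_ge0// mulr_ile1 ?mulr_ge0// mulr_ile1.
  have zp : 0 <= wpos tau ^+ 2 * window tau ^+ 2 by rewrite mulr_ge0 ?sqr_ge0.
  have zp2 : wpos tau ^+ 2 * window tau ^+ 2 <= window tau ^+ 2 by rewrite ler_piMl.
  by rewrite ler_norml; apply/andP; split; lra.
have h4 : window tau ^+ 2 <= tau * window tau ^+ 2 by rewrite ler_peMl.
rewrite /flux_coef_der; apply: le_trans (ler_normD _ _) _.
have := ler_normB (- (window tau ^+ 4) / 2) ((1 - tau) * 4 * wpos tau * window tau ^+ 3 * (tau^-1 / L)).
lra.
Qed.

Lemma wpos_cont tau : 0 < tau -> {for tau, continuous wpos}.
Proof. by move=> t0; exact: der_continuous (is_derive_wpos L sig0 t0). Qed.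

Lemma window_cont tau : 0 < tau -> {for tau, continuous window}.
Proof.
move=> t0; apply: (@contcomp (@ppart R) (fun s => 1 - wpos s ^+ 2)); last exact: ppart_continuous.
by apply: contD; [exact: contC|apply: contN; apply: contX; exact: wpos_cont].
Qed.

Lemma profile_der_cont tau : 0 < tau -> {for tau, continuous (fun s => expR ((ln s - s) / 2) * slope L sig0 s)}.
Proof.
move=> t0; have ci : {for tau, continuous (fun s : R => s)} by exact: cvg_id.
have ct : {for tau, continuous (fun s : R => s^-1)} by apply: contV => //; rewrite lt0r_neq0.
apply: contM.
  apply: (@contcomp expR (fun s => (ln s - s) / 2)); last exact: continuous_expR.
  apply: contM; last exact: contC.
  by apply: contD; [exact: continuous_ln|exact: contN].
apply: contD.
  apply: contM; last by apply: contX; exact: window_cont.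
  by apply: contM; [apply: contD => //; exact: contC|exact: contC].
apply: contN; apply: contM.
  apply: contM; last exact: window_cont.
  by apply: contM; [exact: contC|exact: wpos_cont].
apply: contV; first by rewrite mulf_neq0 ?lt0r_neq0.
by apply: contM; [exact: contC|].
Qed.

Lemma flux_coef_der_cont tau : 0 < tau -> {for tau, continuous (flux_coef_der L sig0)}.
Proof.
move=> t0; have ci : {for tau, continuous (fun s : R => s)} by exact: cvg_id.
have ct : {for tau, continuous (fun s : R => s^-1)} by apply: contV => //; rewrite lt0r_neq0.
have cz := wpos_cont t0; have cp := window_cont t0.
have cl : {for tau, continuous (fun s : R => s^-1 / L)} by apply: contM => //; exact: contC.
apply: contD.
  apply: contD; first by apply: contM; [apply: contN; exact: contX|exact: contC].
  apply: contN; apply: contM => //; apply: contM; last exact: contX.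
  apply: contM => //; apply: contM; last exact: contC.
  by apply: contD; [exact: contC|exact: contN].
apply: contM; first exact: contC.
apply: contM => //; apply: contD.
  apply: contM; last exact: contX.
  by apply: contM; [exact: contC|exact: contX].
by apply: contN; apply: contM; [exact: contC|exact: contX].
Qed.

End profile_continuity.

(** * Extension by zero *)

Section glue.
Context {R : realType} {n : nat}.
Implicit Types (x y z : 'rV[R]_n) (i j : 'I_n) (v : 'rV[R]_n -> R).

Definition zero_ext (O : set 'rV[R]_n) (v : 'rV[R]_n -> R) : 'rV[R]_n -> R := v \_ O.

Lemma zero_extE O v x : O x -> zero_ext O v x = v x.
Proof. by move=> Ox; rewrite /zero_ext patchE mem_set. Qed.

Lemma zero_ext0 O v x : ~ O x -> zero_ext O v x = 0.
Proof. by move=> Ox; rewrite /zero_ext patchE memNset. Qed.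

(** Since the support of v keeps a positive distance from the complement of O, every
    point outside O has a neighbourhood where the extension is zero. *)
Lemma C1_zero_ext (O : set 'rV[R]_n) v dv (r : R) : C1_grad O v dv -> 0 < r ->
  (forall x y, O y -> v y != 0 -> `|x - y| <= r -> O x) ->
  C1_grad setT (zero_ext O v) (fun j => zero_ext O (dv j)).
Proof.
move=> [oO hv] r0 hO; split; first exact: openT.
move=> x _; have [Ox|nOx] := pselect (O x).
  have nO : \forall y \near x, O y by exact: open_nbhs_nbhs.
  have [cv hvi] := hv x Ox.
  split.
    by apply: continuous_near_eq cv; near=> y; rewrite zero_extE//; near: y.
  move=> i; have [d c] := hvi i; split.
    by rewrite zero_extE//; apply: near_eq_is_derive d; near=> y; rewrite zero_extE//; near: y.
  by apply: continuous_near_eq c; near=> y; rewrite zero_extE//; near: y.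
have v0 y : O y -> `|x - y| <= r -> v y = 0.
  by move=> Oy xy; apply/eqP/negP => /negP vy; apply: nOx; exact: hO xy.
have r2 : 0 < r / 2 by rewrite divr_gt0.
have dv0 y i : O y -> `|x - y| < r / 2 -> dv i y = 0.
  move=> Oy xy; have [_ /(_ i)[[_ <-] _]] := hv y Oy.
  have h : \forall z \near y, (cst 0 : 'rV[R]_n -> R) z = v z.
    have h1 : \forall z \near y, O z by exact: open_nbhs_nbhs.
    have h2 : \forall z \near y, ball y (r / 2) z by exact: nbhsx_ballx.
    apply: filterS2 h1 h2 => z Oz /ball_rVP zy; rewrite v0//.
    have -> : x - z = (x - y) - (z - y) by rewrite opprB addrA subrK.
    by apply: le_trans (ler_normB _ _) _; rewrite (splitr r) lerD// ltW.
  by have [_] := near_eq_is_derive h (is_derive_cst 0 y (ebase i)).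
have z0 : \forall y \near x, zero_ext O v y = 0 /\ forall i, zero_ext O (dv i) y = 0.
  apply/nbhs_ballP; exists (r / 2) => // y /ball_rVP; rewrite distrC => xy.
  have [Oy|nOy] := pselect (O y); last by rewrite zero_ext0//; split=> // i; rewrite zero_ext0.
  rewrite zero_extE// v0//; last by rewrite ltW// (lt_le_trans xy)// ger_pMr// invf_le1// ler1n.
  by split=> // i; rewrite zero_extE// dv0.
have c0 (f : 'rV[R]_n -> R) : (\forall y \near x, f y = 0) -> {for x, continuous f}.
  move=> hf; apply: (@continuous_near_eq _ _ (cst 0)); last exact: cst_continuous.
  by apply: filterS hf => y ->.
split; first by apply: c0; apply: filterS z0 => y [].
move=> i; split; last by apply: c0; apply: filterS z0 => y [_ /(_ i)].
rewrite [X in is_derive _ _ _ X]zero_ext0//.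
apply: near_eq_is_derive (is_derive_cst 0 x (ebase i)).
by apply: filterS z0 => y [->].
Unshelve. all: by end_near. Qed.

(** Otherwise the segment from x to a point of the ball outside Omega would have a
    first exit point, which is a boundary point. *)
Lemma no_boundary_ball (Omega : set 'rV[R]_n) x r : open Omega -> Omega x -> 0 < r ->
  (forall y, `|y - x| < r -> ~ boundary Omega y) -> forall y, `|y - x| < r -> Omega y.
Proof.
move=> oO Ox r0 hb y yx; apply: contrapT => nOy.
pose g (t : R) := x + t *: (y - x).
pose A := [set t : R | 0 <= t <= 1 /\ forall s, 0 <= s <= t -> Omega (g s)].
have g0 : g 0 = x by rewrite /g scale0r addr0.
have g1 : g 1 = y by rewrite /g scale1r addrC subrK.
have cg : continuous g.
  move=> t; apply: (@continuousD _ _ _ (cst x) (fun t : R => t *: (y - x))).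
    exact: cst_continuous.
  apply: (@continuousZl _ _ _ (fun t : R => t)); exact: cvg_id.
have gr t : 0 <= t <= 1 -> `|g t - x| < r.
  move=> /andP[t0 t1]; rewrite /g addrC addKr normrZ ger0_norm//.
  by apply: le_lt_trans yx; rewrite ler_piMl.
have A0 : A 0 by split; [rewrite lexx ler01|move=> s /andP[s0 s1]; have -> : s = 0 by [apply/eqP; rewrite eq_le s0 s1]; rewrite g0].
have hA : has_sup A by split; [exists 0|exists 1 => t [/andP[]]].
set T := sup A.
have T0 : 0 <= T by apply: ub_le_sup A0; case: hA.
have T1 : T <= 1 by apply: ge_sup; [exists 0|move=> t [/andP[]]].
have T01 : 0 <= T <= 1 by rewrite T0.
have below s : 0 <= s -> s < T -> Omega (g s).
  move=> s0 sT; have [t [_ ht] st] := sup_gt (ex_intro _ 0 A0) sT.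
  by apply: ht; rewrite s0 ltW.
have OT : Omega (g T).
  apply: contrapT => nOT; apply: (hb _ (gr T T01)); split; last first.
    by rewrite (interior_id _).1.
  have Tp : 0 < T by rewrite lt_neqAle T0 andbT; apply/eqP => e; apply: nOT; rewrite -e g0.
  move=> B nB.
  have : \forall t \near T^'-, B (g t) by apply: (cvg_at_left_filter (cg T)).
  have : \forall t \near T^'-, 0 < t by exact: nbhs_left_gt.
  have : \forall t \near T^'-, t < T by exact: nbhs_left_lt.
  move=> h1 h2 h3.
  have h4 : \forall t \near T^'-, [/\ t < T, 0 < t & B (g t)] by apply: filterS3 h1 h2 h3.
  have [t [a b c]] := @filter_ex _ _ _ _ h4.
  by exists (g t); split=> //; apply: below => //; exact: ltW.
have nT : nbhs T [set t | Omega (g t)] by apply: cg; exact: open_nbhs_nbhs.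
have T1' : T < 1.
  by rewrite lt_neqAle T1 andbT; apply/eqP => e; apply: nOy; rewrite -g1 -e.
have /nbhs_ballP[e e0 he] := nT.
pose t := Num.min 1 (T + e / 2).
have tT : T < t by rewrite lt_min T1' ltrDl divr_gt0.
have : A t.
  split; first by rewrite (le_trans T0 (ltW tT)) ge_min lexx.
  move=> s /andP[s0 st]; have [sT|Ts] := ltP s T; first exact: below.
  apply: he; rewrite /ball/= distrC ger0_norm ?subr_ge0// ltrBlDl.
  apply: le_lt_trans st _; rewrite gt_min ltrD2l ltr_pdivrMr// ltr_pMr//.
  by rewrite ltr1n orbT.
by move=> At; have := ub_le_sup hA.2 At; rewrite leNgt tT.
Unshelve. all: by end_near. Qed.

End glue.

(** * Pointwise inequalities *)

Section numeric.
Context {R : realType}.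
Implicit Types (s d y D tau l K c zeta a p C Cz kap : R).

(** Young's inequality with the threshold b = K s tau^2/c: for q >= b the power
    q^(m+1) absorbs the left side, for q <= b the left side is at most its value
    at b. It lets the gain absorb the terms where a derivative fell on the cutoff,
    leaving a high power of s. *)
Lemma young_power K c s tau q (m : nat) : 0 <= K -> 0 < c -> 0 < s -> 0 < tau -> 0 <= q ->
  K * tau * q ^+ m <= c / (s * tau) * q ^+ m.+1 + K * tau * (K * s * tau ^+ 2 / c) ^+ m.
Proof.
move=> K0 c0 s0 t0 q0; set b := K * s * tau ^+ 2 / c.
have t0' := ltW t0; have s0' := ltW s0; have c0' := ltW c0.
have b0 : 0 <= b by apply: divr_ge0 => //; apply: mulr_ge0; [exact: mulr_ge0|exact: exprn_ge0].
have [bq|qb] := leP b q.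
  apply: ler_wpDr; first by apply: mulr_ge0; [exact: mulr_ge0|exact: exprn_ge0].
  rewrite exprS mulrA ler_wpM2r ?exprn_ge0//.
  have -> : K * tau = c / (s * tau) * b.
    by rewrite /b; field; rewrite !lt0r_neq0.
  by apply: ler_wpM2l => //; apply: divr_ge0 => //; exact: mulr_ge0.
apply: ler_wpDl.
  by apply: mulr_ge0; [apply: divr_ge0 => //; exact: mulr_ge0|exact: exprn_ge0].
apply: ler_wpM2l; first exact: mulr_ge0.
by apply: lerXn2r; rewrite ?nnegrE//; exact: ltW.
Qed.

(** From (1 + y)^2 (1 - 2y) <= 1. *)
Lemma inv_sq_lb d s y : 0 < d -> 0 < s -> 0 <= y -> d <= s * (1 + y) ->
  (1 - 2 * y) / s ^+ 2 <= (d ^+ 2)^-1.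
Proof.
move=> d0 s0 y0 ds.
rewrite ler_pdivrMr ?exprn_gt0// ler_pdivlMl ?exprn_gt0//.
have [h|h] := leP (1 - 2 * y) 0.
  by apply: (@le_trans _ _ 0); [rewrite mulr_ge0_le0// exprn_ge0// ltW|rewrite exprn_ge0// ltW].
apply: (@le_trans _ _ ((s * (1 + y)) ^+ 2 * (1 - 2 * y))).
  rewrite ler_wpM2r//; first exact: ltW.
  by rewrite lerXn2r ?nnegrE// ltW// (lt_le_trans d0).
rewrite exprMn -mulrA ger_pMr ?exprn_gt0//.
have -> : (1 + y) ^+ 2 * (1 - 2 * y) = 1 - y ^+ 2 * (3 + 2 * y) by ring.
by rewrite gerBl mulr_ge0 ?sqr_ge0//; lra.
Qed.

(** The function t ln (D/t) increases up to t = D/e: this is the reason for the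
    constant e in D. *)
Lemma mul_ln_mono D d y : 0 < d -> d <= y -> y * expR 1 <= D ->
  d * ln (D / d) <= y * ln (D / y).
Proof.
move=> d0 dy yD; have y0 := lt_le_trans d0 dy.
have D0 : 0 < D by apply: lt_le_trans yD; rewrite mulr_gt0 ?expR_gt0.
have l1 : 1 <= ln (D / y).
  by rewrite -[1]expRK ler_ln ?posrE ?expR_gt0 ?divr_gt0// ler_pdivlMr// mulrC.
have e : ln (D / d) = ln (D / y) + ln (y / d).
  by rewrite -lnM ?posrE ?divr_gt0// mulrA mulfVK// lt0r_neq0.
have h : ln (y / d) <= y / d - 1.
  have := expR_ge1Dx (ln (y / d)); rewrite lnK ?posrE ?divr_gt0//; lra.
rewrite e mulrDr.
have h2 : d * ln (y / d) <= y - d.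
  apply: le_trans (ler_wpM2l (ltW d0) h) _.
  by rewrite mulrBr mulrCA divff ?lt0r_neq0// !mulr1.
have h3 : 0 <= (y - d) * (ln (D / y) - 1) by rewrite mulr_ge0// subr_ge0.
move: h2 h3; move: (ln (D / y)) (ln (y / d)) => X Y; lra.
Qed.

(** The leading term comes from the profile, whose slope is divided by s; the cutoff
    and the curvature enter without the factor 1/s. *)
Lemma gradient_bound s tau a p zeta y C Cz kap : 0 < s -> s <= 1 -> 0 <= tau ->
  0 <= p -> p <= 1 -> 0 <= a -> a <= 5 * p -> 0 <= zeta -> zeta <= 1 -> 0 <= C -> 0 <= Cz -> 0 <= kap ->
  tau * s * (a * (zeta * y) * ((1 + C * s) / s) + p ^+ 2 * (kap * y) * Cz) ^+ 2 <=
  tau * a ^+ 2 / s * (zeta * y) ^+ 2 +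
  (25 * (2 * C + C ^+ 2) + 10 * (1 + C) * kap * Cz + kap ^+ 2 * Cz ^+ 2) * tau * p ^+ 2 * y ^+ 2.
Proof.
move=> s0 s1 t0 p0 p1 a0 a5 z0 z1 C0 Cz0 k0.
have -> : tau * s * (a * (zeta * y) * ((1 + C * s) / s) + p ^+ 2 * (kap * y) * Cz) ^+ 2 =
  tau * a ^+ 2 / s * (zeta * y) ^+ 2 + tau * y ^+ 2 *
   (a ^+ 2 * zeta ^+ 2 * (2 * C + C ^+ 2 * s) + 2 * (a * zeta * (1 + C * s) * p ^+ 2) * (kap * Cz)
    + s * p ^+ 4 * (kap ^+ 2 * Cz ^+ 2)).
  by field; rewrite lt0r_neq0.
rewrite lerD2l.
have -> : (25 * (2 * C + C ^+ 2) + 10 * (1 + C) * kap * Cz + kap ^+ 2 * Cz ^+ 2) * tau * p ^+ 2 * y ^+ 2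
  = tau * y ^+ 2 * (25 * p ^+ 2 * (2 * C + C ^+ 2) + 2 * (5 * (1 + C) * p ^+ 2) * (kap * Cz)
     + p ^+ 2 * (kap ^+ 2 * Cz ^+ 2)) by ring.
have p2 : 0 <= p ^+ 2 by exact: sqr_ge0.
have z2 : zeta ^+ 2 <= 1 by rewrite exprn_ile1.
have a2 : a ^+ 2 <= 25 * p ^+ 2.
  by have -> : 25 * p ^+ 2 = (5 * p) ^+ 2 by [ring]; rewrite lerXn2r ?nnegrE// mulr_ge0.
have Cs : C * s <= C by rewrite ler_piMr.
have Cs0 : 0 <= C * s by rewrite mulr_ge0// ltW.
apply: ler_wpM2l; first by apply: mulr_ge0 => //; exact: sqr_ge0.
apply: lerD; first apply: lerD.
- apply: ler_pM.
  + by rewrite mulr_ge0 ?sqr_ge0.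
  + by rewrite addr_ge0 ?mulr_ge0 ?sqr_ge0// ltW.
  + by rewrite -[leRHS]mulr1 ler_pM ?sqr_ge0.
  + by rewrite lerD2l ler_piMr ?sqr_ge0.
- apply: ler_wpM2r; first by rewrite mulr_ge0.
  rewrite ler_pM2l//.
  have h1 : a * zeta <= 5.
    apply: (@le_trans _ _ (5 * 1)); last lra.
    apply: ler_pM => //; apply: le_trans a5 _; lra.
  have h2 : a * zeta * (1 + C * s) <= 5 * (1 + C).
    by apply: ler_pM => //; [rewrite mulr_ge0|lra|lra].
  by rewrite ler_wpM2r.
- apply: ler_wpM2r; first by rewrite mulr_ge0 ?sqr_ge0.
  rewrite (_ : s * p ^+ 4 = (s * p ^+ 2) * p ^+ 2); last by ring.
  rewrite ler_piMl// mulr_ile1// ?(ltW s0)// exprn_ile1//.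
Qed.

(** Replaces d by s: d <= s (1 + C s) gives 1/d^2 and 1/(d ln (D/d))^2 lower bounds
    of relative error O(s). *)
Lemma potential_bound D s tau d p y C B' W : 0 < d -> 0 < s -> 1 <= tau -> 0 <= C -> 0 <= B' ->
  s = D * expR (- tau) -> d <= s * (1 + C * s) -> s * (1 + C * s) * expR 1 <= D ->
  1 / 4 + B' / ln (D / d) ^+ 2 <= W ->
  (tau * p ^+ 4 / 4 + B' * p ^+ 4 / tau) / s * y ^+ 2 - 2 * C * (1 / 4 + B') * tau * p ^+ 4 * y ^+ 2
  <= tau * s * p ^+ 4 * y ^+ 2 / d ^+ 2 * W.
Proof.
move=> d0 s0 t1 C0 B0 es ds sD hW.
have t0 : 0 < tau by exact: lt_le_trans t1.
have D0 : 0 < D by move: s0; rewrite es pmulr_lgt0 ?expR_gt0.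
have yC : 0 <= C * s by rewrite mulr_ge0// ltW.
have sg0 : 0 < s * (1 + C * s) by rewrite mulr_gt0//; lra.
have dD : d * expR 1 <= D by apply: le_trans sD; rewrite ler_wpM2r// expR_ge0.
have l0 : 0 < ln (D / d).
  rewrite ln_gt0// ltr_pdivlMr// mul1r; apply: lt_le_trans dD.
  by rewrite ltr_pMr// expR_gt1.
have h1 := inv_sq_lb d0 s0 yC ds.
have lt : ln (D / s) = tau.
  rewrite es invfM mulrA divff ?lt0r_neq0// mul1r -expRN opprK; exact: expRK.
have hdl : d * ln (D / d) <= s * tau * (1 + C * s).
  apply: le_trans (mul_ln_mono d0 ds sD) _.
  rewrite -lt [leRHS]mulrAC; apply: ler_wpM2l; first exact: ltW.
    rewrite ler_ln ?posrE ?divr_gt0// ler_pM2l// lef_pV2 ?posrE// ler_peMr ?(ltW s0)//; lra.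
have h2 := inv_sq_lb (mulr_gt0 d0 l0) (mulr_gt0 s0 t0) yC hdl.
have p4 : 0 <= p ^+ 4 by have -> : p ^+ 4 = (p ^+ 2) ^+ 2 by [ring]; exact: sqr_ge0.
have k0 : 0 <= tau * s * p ^+ 4 * y ^+ 2.
  apply: mulr_ge0; last exact: sqr_ge0.
  by apply: mulr_ge0 => //; apply: mulr_ge0; exact: ltW.
have h3 : (1 - 2 * (C * s)) / s ^+ 2 / 4 + B' * ((1 - 2 * (C * s)) / (s * tau) ^+ 2) <= (d ^+ 2)^-1 * W.
  apply: (@le_trans _ _ ((d ^+ 2)^-1 * (1 / 4 + B' / ln (D / d) ^+ 2))); last first.
    by rewrite ler_pM2l// invr_gt0 exprn_gt0.
  rewrite mulrDr; apply: lerD; first by rewrite mul1r ler_wpM2r// invr_ge0.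
  rewrite [leRHS]mulrCA; apply: ler_wpM2l => //; rewrite -invfM -exprMn; exact: h2.
rewrite -[leRHS]mulrA; apply: le_trans (ler_wpM2l k0 h3).
have -> : tau * s * p ^+ 4 * y ^+ 2 * ((1 - 2 * (C * s)) / s ^+ 2 / 4 + B' * ((1 - 2 * (C * s)) / (s * tau) ^+ 2))
  = (tau * p ^+ 4 / 4 + B' * p ^+ 4 / tau) / s * y ^+ 2 - 2 * C * (tau / 4 + B' / tau) * (p ^+ 4 * y ^+ 2).
  by field; rewrite !lt0r_neq0.
rewrite lerD2l lerN2 (_ : 2 * C * (1 / 4 + B') * tau * p ^+ 4 * y ^+ 2 =
  2 * C * ((1 / 4 + B') * tau) * (p ^+ 4 * y ^+ 2)); last by ring.
apply: ler_wpM2r.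
  by apply: mulr_ge0 => //; exact: sqr_ge0.
rewrite ler_wpM2l ?mulr_ge0// mulrDl lerD//; first by rewrite mul1r mulrC.
by rewrite ler_wpM2l// (le_trans _ t1)// invf_le1.
Qed.

(** Up to sign, the main part of the derivative of the flux is dG/s, because
    iota * ddi is 1 + O(s); the other terms carry no factor 1/s. Here chi is the sign of delta. *)
Lemma divergence_bound G dG s C Cz kap zeta y iota diota dzi ddi tau p chi : 0 < s ->
  0 <= C -> 0 <= Cz -> 0 <= kap -> 0 <= zeta -> zeta <= 1 -> 0 <= y -> 0 <= tau ->
  `|dG| <= 50 * tau * p ^+ 2 -> `|G| <= 10 * tau * p ^+ 2 -> chi ^+ 2 = 1 ->
  `|iota| <= C -> `|diota| <= C -> `|dzi| <= Cz -> `|iota * ddi - 1| <= C * s ->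
  dG / s * (zeta * y) ^+ 2 <=
  - (chi * iota * ((zeta * y) ^+ 2 * (dG * - (chi * ddi / s))
     + G * (2 * kap * (zeta * y ^+ 2) * dzi)) + (zeta * y) ^+ 2 * G * (chi * diota))
  + (60 * C + 20 * kap * C * Cz) * tau * p ^+ 2 * y ^+ 2.
Proof.
move=> s0 C0 Cz0 k0 z0 z1 y0 t0 dG_le G_le chi2 hio hdio hdz hdd.
have hchi : `|chi| <= 1 by rewrite -(@ler_pXn2r _ 2) ?nnegrE// expr1n -normrX chi2 normr1.
have tp : 0 <= tau * p ^+ 2 by rewrite mulr_ge0 ?sqr_ge0.
have zy : (zeta * y) ^+ 2 <= y ^+ 2 by rewrite exprMn ler_piMl ?sqr_ge0// exprn_ile1.
have zy2 : zeta * y ^+ 2 <= y ^+ 2 by rewrite ler_piMl ?sqr_ge0.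
have y2 : 0 <= y ^+ 2 by exact: sqr_ge0.
have e1 : `|- ((iota * ddi - 1) * dG / s * (zeta * y) ^+ 2)| <= 50 * C * tau * p ^+ 2 * y ^+ 2.
  rewrite normrN [`|_ * (zeta * y) ^+ 2|]normrM (ger0_norm (sqr_ge0 (zeta * y))) [`|_ / s|]normrM [`|_ * dG|]normrM normfV (gtr0_norm s0).
  apply: (@le_trans _ _ (C * (50 * tau * p ^+ 2) * y ^+ 2)); last first.
    by rewrite le_eqVlt; apply/orP; left; apply/eqP; ring.
  apply: ler_pM => //.
    by rewrite mulr_ge0 ?mulr_ge0 ?normr_ge0// invr_ge0 ltW.
    exact: sqr_ge0.
  rewrite mulrAC; apply: ler_pM => //; first by rewrite divr_ge0// ltW.
  by rewrite ler_pdivrMr.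
have e2 : `|chi * iota * (G * (2 * kap * (zeta * y ^+ 2) * dzi))| <= 20 * kap * C * Cz * tau * p ^+ 2 * y ^+ 2.
  have -> : 20 * kap * C * Cz * tau * p ^+ 2 * y ^+ 2 = (1 * C) * ((10 * tau * p ^+ 2) * (2 * kap * y ^+ 2 * Cz)) by ring.
  rewrite normrM; apply: ler_pM => //; first by rewrite normrM ler_pM.
  rewrite normrM; apply: ler_pM => //.
  rewrite normrM; apply: ler_pM => //.
  by rewrite ger0_norm ?mulr_ge0// ler_wpM2l// mulr_ge0.
have e3 : `|(zeta * y) ^+ 2 * G * (chi * diota)| <= 10 * C * tau * p ^+ 2 * y ^+ 2.
  have -> : 10 * C * tau * p ^+ 2 * y ^+ 2 = (y ^+ 2 * (10 * tau * p ^+ 2)) * (1 * C) by ring.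
  rewrite normrM; apply: ler_pM => //; last by rewrite normrM ler_pM.
  by rewrite normrM (ger0_norm (sqr_ge0 (zeta * y))) ler_pM ?sqr_ge0.
have h1 := ler_norm (- ((iota * ddi - 1) * dG / s * (zeta * y) ^+ 2)).
have h2 := ler_norm (chi * iota * (G * (2 * kap * (zeta * y ^+ 2) * dzi))).
have h3 := ler_norm ((zeta * y) ^+ 2 * G * (chi * diota)).
set X2 := chi * iota * (G * _) in h2 e2; set X3 := (zeta * y) ^+ 2 * G * _ in h3 e3.
set X1 := - (_ * _) in h1 e1.
rewrite [leRHS](_ : _ = dG / s * (zeta * y) ^+ 2 - X1 - X2 - X3 +
  (50 * C * tau * p ^+ 2 * y ^+ 2 + 20 * kap * C * Cz * tau * p ^+ 2 * y ^+ 2 + 10 * C * tau * p ^+ 2 * y ^+ 2)).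
  move: h1 e1 h2 e2 h3 e3; move: `|X1| `|X2| `|X3| (dG / s * _) => a1 a2 a3 a4; lra.
have key : chi * iota * ((zeta * y) ^+ 2 * (dG * - (chi * ddi / s))) =
    - (iota * ddi * dG / s * (zeta * y) ^+ 2).
  by rewrite -[RHS]mulr1 -chi2; ring.
by rewrite [chi * iota * (_ + _)]mulrDr key /X1 /X2 /X3; ring.
Qed.

(** Collects the constants of [gradient_bound], [potential_bound] and
    [divergence_bound], with kap the power of the cutoff. *)
Definition loss_const C Cz kap B' : R :=
  25 * (2 * C + C ^+ 2) + 10 * (1 + C) * kap * Cz + kap ^+ 2 * Cz ^+ 2
  + 2 * C * (1 / 4 + B') + (60 * C + 20 * kap * C * Cz).

Lemma loss_const_ge0 C Cz kap B' : 0 <= C -> 0 <= Cz -> 0 <= kap -> 0 <= B' ->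
  0 <= loss_const C Cz kap B'.
Proof.
move=> C0 Cz0 k0 B0; rewrite /loss_const.
have h1 := mulr_ge0 C0 C0; have h2 := mulr_ge0 k0 Cz0; have h3 := mulr_ge0 C0 h2.
have h4 := mulr_ge0 h2 h2; have h5 := mulr_ge0 C0 B0.
have -> : kap ^+ 2 * Cz ^+ 2 = (kap * Cz) * (kap * Cz) by ring.
lra.
Qed.

(** The profile inequality, multiplied by zeta^(2(m+1))/s, is inserted between the
    three bounds of the gradient, the potential and the flux. Half of the gain
    12/L^2 is spent on absorbing the error terms by [young_power]. *)
Lemma pointwise_bound L sig0 B' D s tau zeta (m : nat) d W C Cz iota diota dzi ddi chi f :
  1 <= L -> 1 / 4 + 22 / L ^+ 2 <= B' -> 0 < s -> s <= 1 -> 1 <= tau -> s = D * expR (- tau) ->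
  0 <= zeta -> zeta <= 1 -> 0 <= C -> 0 <= Cz -> chi ^+ 2 = 1 ->
  `|iota| <= C -> `|diota| <= C -> `|dzi| <= Cz -> `|iota * ddi - 1| <= C * s ->
  0 < d -> d <= s * (1 + C * s) -> s * (1 + C * s) * expR 1 <= D ->
  1 / 4 + B' / ln (D / d) ^+ 2 <= W ->
  let p := window L sig0 tau in let E := expR ((ln tau - tau) / 2) in let y := zeta ^+ m in
  let K := loss_const C Cz m.+1%:R B' in let c := 6 / L ^+ 2 in
  0 <= f -> f <= E * `|slope L sig0 tau| * (zeta * y) * ((1 + C * s) / s) + E * p ^+ 2 * (m.+1%:R * y) * Cz ->
  D * f ^+ 2 + c / (s * tau) * zeta ^+ 2 ^+ m.+1 * p ^+ 2 <=
  D * ((profile L sig0 tau * (zeta * y)) ^+ 2 / d ^+ 2 * W)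
  - (chi * iota * ((zeta * y) ^+ 2 * (flux_coef_der L sig0 tau * - (chi * ddi / s))
     + flux_coef L sig0 tau * (2 * m.+1%:R * (zeta * y ^+ 2) * dzi)) + (zeta * y) ^+ 2 * flux_coef L sig0 tau * (chi * diota))
  + K * tau * (K * s * tau ^+ 2 / c) ^+ m * p ^+ 2.
Proof.
move=> L1 hB s0 s1 t1 es z0 z1 C0 Cz0 chi2 hio hdio hdz hdd d0 ds sD hW p E y K c f0 hf.
have t0 : 0 < tau by exact: lt_le_trans t1.
have L0 : 0 < L by exact: lt_le_trans L1.
have L20 : 0 < L ^+ 2 by exact: exprn_gt0.
have D0 : 0 < D by move: s0; rewrite es pmulr_lgt0 ?expR_gt0.
have B0 : 0 <= B'.
  have := divr_ge0 (ler0n R 22) (ltW L20); lra.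
have k0 : 0 <= m.+1%:R :> R by exact: ler0n.
have y0 : 0 <= y by exact: exprn_ge0.
have y2 : 0 <= y ^+ 2 by exact: sqr_ge0.
have p0 : 0 <= p by exact: window_ge0.
have p1 : p <= 1 by exact: window_le1.
have E0 : 0 < E by exact: expR_gt0.
have E2 : D * E ^+ 2 = tau * s.
  rewrite es /E -expRM_natl (_ : 2%:R * ((ln tau - tau) / 2) = ln tau - tau); last by field.
  by rewrite expRD lnK ?posrE//; ring.
have K0 : 0 <= K by exact: loss_const_ge0.
have c0 : 0 < c by exact: divr_gt0.
have g1 := gradient_bound y s0 s1 (ltW t0) p0 p1 (normr_ge0 _) (slope_bound sig0 L1 t1) z0 z1 C0 Cz0 k0.
rewrite -normrX (ger0_norm (sqr_ge0 (slope _ _ _))) in g1.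
have g0 : D * f ^+ 2 <= tau * s * (`|slope L sig0 tau| * (zeta * y) * ((1 + C * s) / s) + p ^+ 2 * (m.+1%:R * y) * Cz) ^+ 2.
  rewrite -E2 -mulrA -exprMn; apply: ler_wpM2l; first exact: ltW.
  have hf' : f <= E * (`|slope L sig0 tau| * (zeta * y) * ((1 + C * s) / s) + p ^+ 2 * (m.+1%:R * y) * Cz).
    by apply: le_trans hf _; rewrite le_eqVlt; apply/orP; left; apply/eqP; ring.
  by apply: lerXn2r => //; rewrite nnegrE; exact: le_trans hf'.
have sz0 : 0 <= (zeta * y) ^+ 2 / s by apply: divr_ge0; [exact: sqr_ge0|exact: ltW].
have g2 := ler_wpM2r sz0 (hardy_profile sig0 L1 t0 hB).
have g3 := potential_bound p (zeta * y) d0 s0 t1 C0 B0 es ds sD hW.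
have g4 := divergence_bound s0 C0 Cz0 k0 z0 z1 y0 (ltW t0) (flux_coef_der_bound sig0 L1 t1)
  (flux_coef_bound sig0 L1 t1) chi2 hio hdio hdz hdd.
have g5 := young_power m K0 c0 s0 t0 (sqr_ge0 zeta).
have g6 := ler_wpM2r (sqr_ge0 p) g5.
have eR : D * ((profile L sig0 tau * (zeta * y)) ^+ 2 / d ^+ 2 * W) = tau * s * p ^+ 4 * (zeta * y) ^+ 2 / d ^+ 2 * W.
  by rewrite -E2 /profile -/p -/E; ring.
rewrite eR.
have g7 : 2 * C * (1 / 4 + B') * tau * p ^+ 4 * (zeta * y) ^+ 2 <= 2 * C * (1 / 4 + B') * tau * p ^+ 2 * y ^+ 2.
  have p42 : p ^+ 4 <= p ^+ 2 by apply: ler_wiXn2l.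
  have zy : (zeta * y) ^+ 2 <= y ^+ 2 by rewrite exprMn ler_piMl ?sqr_ge0// exprn_ile1.
  have c1 : 0 <= 2 * C * (1 / 4 + B') * tau.
    apply: mulr_ge0; last exact: ltW.
    apply: mulr_ge0; first exact: mulr_ge0.
    by apply: addr_ge0 => //; apply: divr_ge0.
  rewrite -[leLHS]mulrA -[leRHS]mulrA; apply: ler_wpM2l => //.
  by apply: ler_pM => //; [exact: exprn_ge0|exact: sqr_ge0].
have ezy : (zeta * y) ^+ 2 = zeta ^+ 2 ^+ m.+1.
  by rewrite /y -exprS -!exprM mulnC.
have ey : y ^+ 2 = zeta ^+ 2 ^+ m by rewrite /y -!exprM mulnC.
have e1 : c / (s * tau) * (zeta * y) ^+ 2 * p ^+ 2 = 6 / L ^+ 2 * p ^+ 2 / tau * ((zeta * y) ^+ 2 / s).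
  by rewrite /c; field; rewrite !lt0r_neq0.
have e2 : tau * slope L sig0 tau ^+ 2 * ((zeta * y) ^+ 2 / s) = tau * slope L sig0 tau ^+ 2 / s * (zeta * y) ^+ 2 by ring.
have e3 : (tau * window L sig0 tau ^+ 4 / 4 + B' * window L sig0 tau ^+ 4 / tau + flux_coef_der L sig0 tau -
  12 / L ^+ 2 * window L sig0 tau ^+ 2 / tau) * ((zeta * y) ^+ 2 / s) =
  (tau * p ^+ 4 / 4 + B' * p ^+ 4 / tau) / s * (zeta * y) ^+ 2 + flux_coef_der L sig0 tau / s * (zeta * y) ^+ 2
   - 2 * (c / (s * tau) * (zeta * y) ^+ 2 * p ^+ 2) by rewrite e1 -/p; ring.
have g6' : K * tau * p ^+ 2 * y ^+ 2 <= c / (s * tau) * (zeta * y) ^+ 2 * p ^+ 2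
   + K * tau * (K * s * tau ^+ 2 / c) ^+ m * p ^+ 2.
  rewrite ezy ey -mulrDl; apply: le_trans g6.
  by rewrite [leLHS]mulrAC.
have eK : K * tau * p ^+ 2 * y ^+ 2 =
  (25 * (2 * C + C ^+ 2) + 10 * (1 + C) * m.+1%:R * Cz + m.+1%:R ^+ 2 * Cz ^+ 2) * tau * p ^+ 2 * y ^+ 2
  + 2 * C * (1 / 4 + B') * tau * p ^+ 2 * y ^+ 2 + (60 * C + 20 * m.+1%:R * C * Cz) * tau * p ^+ 2 * y ^+ 2.
  by rewrite /K /loss_const; ring.
rewrite e2 e3 in g2; rewrite eK in g6'; rewrite -ezy.
move: (le_trans g0 g1) g2 g3 g4 g6' g7.
set DW := (chi * iota * _ + (zeta * y) ^+ 2 * _ * _).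
move: DW => DW.
move: (K * tau * _ * p ^+ 2) (c / (s * tau) * _ * p ^+ 2) (tau * s * p ^+ 4 * _ / _ * W) (D * f ^+ 2) => X1 X2 X3 X4.
move: (tau * slope _ _ _ ^+ 2 / s * _) ((tau * p ^+ 4 / 4 + _) / s * _) (flux_coef_der _ _ _ / s * _) => X5 X6 X7.
move: (_ * tau * p ^+ 4 * _) ((25 * _ + _ + _) * tau * p ^+ 2 * _) ((60 * C + _) * tau * p ^+ 2 * _) => X8 X9 X10.
move: (_ * tau * p ^+ 2 * _) => X11.
clear; lra.
Qed.

End numeric.

(** * The test function in a boundary collar *)

Section gradient_sum.
Context {R : realType} {n : nat}.
Implicit Types (x p : 'rV[R]_n).

Lemma C1_grad_sum (m : nat) (U : set 'rV[R]_n) (f : 'I_m -> 'rV[R]_n -> R) df : open U ->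
  (forall k, C1_grad U (f k) (df k)) ->
  C1_grad U (fun x => \sum_k f k x) (fun i x => \sum_k df k i x).
Proof.
move=> oU h; elim: (index_enum _) => [|k s ih].
  by apply: (C1_grad_eq (C1_grad_cst 0 oU)) => [x|i x] _; rewrite big_nil.
by apply: (C1_grad_eq (C1_gradD (h k) ih)) => [x|i x] _; rewrite big_cons.
Qed.

End gradient_sum.

Section cutoff.
Context {R : realType} {n : nat}.
Implicit Types (x p : 'rV[R]_n.+1).

(** The square of the positive part of 1 - |x - p|^2/e^2; the Euclidean norm is used
    because it is smooth. *)
Lemma cutoff p (e : R) : 0 < e -> exists zeta dzeta (Cz e' : R),
  [/\ C1_grad setT zeta dzeta, 0 <= Cz /\ 0 < e',
      forall x, 0 <= zeta x <= 1 /\ forall j, `|dzeta j x| <= Cz,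
      forall x, zeta x != 0 -> `|x - p| <= e
    & forall x, `|x - p| <= e' -> 1 / 2 <= zeta x].
Proof.
move=> e0.
pose q x : R := 1 - dotp (x - p) (x - p) / e ^+ 2.
pose dq (j : 'I_n.+1) x : R := - (2 * (x ord0 j - p ord0 j) / e ^+ 2).
have hq : C1_grad setT q dq.
  have hk k : C1_grad setT (fun x => (x ord0 k - p ord0 k) * (x ord0 k - p ord0 k)) (fun j x =>
     (x ord0 k - p ord0 k) * ((k == j)%:R + 0) + (x ord0 k - p ord0 k) * ((k == j)%:R + 0)).
    have h := C1_gradD (@C1_grad_coord R n.+1 setT k openT) (C1_grad_cst (- p ord0 k) openT).
    exact: (C1_gradM h h).
  have hs := C1_grad_sum openT hk.
  have h1 := C1_gradD (C1_grad_cst 1 openT) (C1_gradM hs (C1_grad_cst (- (e ^+ 2)^-1) openT)).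
  apply: (C1_grad_eq h1) => [x|j x] _.
    by rewrite /q /dotp -mulrN; congr (_ + _ * _); apply: eq_bigr => k _; rewrite !mxE.
  rewrite /dq mulr0 !add0r (bigD1 j)//= big1 ?addr0 ?eqxx; last first.
    by move=> k kj /=; rewrite (negbTE kj) !(addr0, mulr0).
  by rewrite !mulr1; ring.
have dot0 x : 0 <= dotp x x by apply: le_trans (dotp_self_ge x); exact: sqr_ge0.
have e20 : 0 < e ^+ 2 by exact: exprn_gt0.
have q1 x : q x <= 1 by rewrite gerBl divr_ge0// ltW.
have qe x : ppart (q x) != 0 -> `|x - p| <= e.
  case: (ppart_cases (q x)) => [->|[h1 h2] _]; first by rewrite eqxx.
  have : 0 < q x by rewrite -h2.
  rewrite subr_gt0 ltr_pdivrMr// mul1r => h0.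
  rewrite -(@ler_pXn2r _ 2) ?nnegrE ?(ltW e0)//.
  exact/ltW/(le_lt_trans (dotp_self_ge _) h0).
exists (fun x => ppart (q x) ^+ 2), (fun j x => 2 * ppart (q x) * dq j x), (4 / e), (e / (2 * n.+1%:R)).
split.
- apply: (@C1_grad_comp _ _ _ q dq (fun t => ppart t ^+ 2) (fun t => 2 * ppart t)) => // x _.
  split; first by have := ppart_der 0 (q x).
  by apply: contM; [exact: contC|exact: ppart_continuous].
- by rewrite divr_ge0 ?(ltW e0)//; split=> //; rewrite divr_gt0// mulr_gt0// ltr0n.
- move=> x; have p0 := ppart_ge0 (q x).
  have p1 : ppart (q x) <= 1 by exact: ppart_le.
  split; first by rewrite exprn_ge0// exprn_ile1.
  move=> j; have [->|h] := eqVneq (ppart (q x)) 0.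
    by rewrite mulr0 mul0r normr0 divr_ge0// ltW.
  have hx := le_trans (coord_le_norm (x - p) j) (qe x h); rewrite !mxE in hx.
  have -> : 4 / e = (2 * 1) * (2 * e / e ^+ 2) by field; rewrite lt0r_neq0.
  rewrite normrM; apply: ler_pM => //.
    by rewrite normrM !ger0_norm// ler_pM2l.
  rewrite /dq normrN !normrM normfV [`|2|]ger0_norm// [`|e ^+ 2|]gtr0_norm//.
  by rewrite ler_pM2r ?invr_gt0// ler_pM2l.
- by move=> x h; apply: qe; apply: contraNneq h => ->; rewrite expr0n.
- move=> x hx.
  have N0 : 0 < n.+1%:R :> R by rewrite ltr0n.
  have N1 : 1 <= n.+1%:R :> R by rewrite ler1n.
  have hd : dotp (x - p) (x - p) <= e ^+ 2 / 4.
    apply: le_trans (dotp_le _ _) _; rewrite -mulrA.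
    apply: (@le_trans _ _ (n.+1%:R * (e / (2 * n.+1%:R) * (e / (2 * n.+1%:R))))).
      by rewrite ler_pM2l// ler_pM.
    have -> : n.+1%:R * (e / (2 * n.+1%:R) * (e / (2 * n.+1%:R))) = e ^+ 2 / 4 * n.+1%:R^-1.
      by field; rewrite lt0r_neq0.
    by rewrite ger_pMr ?divr_gt0// invf_le1.
  have hq2 : 3 / 4 <= q x.
    have : dotp (x - p) (x - p) / e ^+ 2 <= 1 / 4.
      by rewrite ler_pdivrMr//; lra.
    by rewrite /q; lra.
  have -> : ppart (q x) = q x by rewrite /ppart max_l//; lra.
  nra.
Qed.

End cutoff.

Section powers.
Context {R : realType} {n : nat}.

Lemma C1_gradX (U : set 'rV[R]_n) f df m : C1_grad U f df ->
  C1_grad U (fun x => f x ^+ m.+1) (fun j x => m.+1%:R * f x ^+ m * df j x).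
Proof.
move=> hf; apply: (@C1_grad_comp _ _ U f df (fun t => t ^+ m.+1) (fun t => m.+1%:R * t ^+ m)) => // x Ux.
split; first by apply: (derE (derX m.+1 (derI (f x)))); rewrite mulr1.
by apply: contM; [exact: contC|apply: contX; exact: cvg_id].
Qed.

End powers.

Section decay.
Context {R : realType}.

(** Polynomials in t are absorbed by exponentials, t <= 4 exp(t/4) and
    t^2 <= 16 exp(t/2); almost half of the exponent in exp(-m t) survives. *)
Lemma loss_decay (K D c t t0 : R) (m N : nat) : 0 <= K -> 0 <= D -> 0 < c -> 0 <= t ->
  N%:R * t0 <= (2 * m%:R - 1) / 4 * t ->
  K * t * (K * (D * expR (- t)) * t ^+ 2 / c) ^+ m <=
  4 * K * (16 * K * D / c) ^+ m * expR (- (N%:R * t0)).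
Proof.
move=> K0 D0 c0 t_ge0 hN; have c0' := ltW c0.
have e0 : 0 <= expR (t / 4) by exact: expR_ge0.
have te : t <= 4 * expR (t / 4) by have := expR_ge1Dx (t / 4); lra.
have te2 : expR (- t) * t ^+ 2 <= 16 * expR (- (t / 2)).
  have h : t ^+ 2 <= 16 * expR (t / 2).
    have -> : 16 * expR (t / 2) = (4 * expR (t / 4)) ^+ 2.
      have -> : t / 2 = t / 4 + t / 4 by field.
      by rewrite expRD; ring.
    by apply: lerXn2r => //; rewrite nnegrE// mulr_ge0.
  apply: le_trans (ler_wpM2l (expR_ge0 _) h) _.
  rewrite mulrCA -expRD; have -> : - t + t / 2 = - (t / 2) by field.
  exact: lexx.
have KDc : 0 <= K * D / c by apply: divr_ge0 => //; exact: mulr_ge0.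
apply: (@le_trans _ _ (K * (4 * expR (t / 4)) * ((16 * K * D / c) * expR (- (t / 2))) ^+ m)).
  apply: ler_pM.
  - exact: mulr_ge0.
  - apply: exprn_ge0; apply: divr_ge0 => //; apply: mulr_ge0; last exact: sqr_ge0.
    by apply: mulr_ge0 => //; apply: mulr_ge0 => //; exact: expR_ge0.
  - exact: ler_wpM2l.
  - have hh := ler_wpM2l KDc te2.
    have h1 : 0 <= expR (- t) * t ^+ 2 by apply: mulr_ge0; [exact: expR_ge0|exact: sqr_ge0].
    have e1 : K * (D * expR (- t)) * t ^+ 2 / c = K * D / c * (expR (- t) * t ^+ 2) by ring.
    have e2 : 16 * K * D / c * expR (- (t / 2)) = K * D / c * (16 * expR (- (t / 2))) by ring.
    rewrite e1 e2; apply: lerXn2r => //; rewrite nnegrE; first exact: mulr_ge0.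
    by apply: le_trans hh; exact: mulr_ge0.
rewrite exprMn (_ : K * (4 * expR (t / 4)) * ((16 * K * D / c) ^+ m * expR (- (t / 2)) ^+ m) =
  4 * K * (16 * K * D / c) ^+ m * (expR (t / 4) * expR (- (t / 2)) ^+ m)); last by ring.
apply: ler_wpM2l.
  apply: mulr_ge0; first exact: mulr_ge0.
  by apply: exprn_ge0; have := KDc; rewrite -!mulrA => h; exact: mulr_ge0.
rewrite -expRM_natl -expRD ler_expR; lra.
Qed.

(** Near x0 the depth changes by at most 1, so its logarithm stays in the middle of
    the window. *)
Lemma log_close (a b : R) : 2 <= a -> `|b - a| <= 1 -> `|ln b - ln a| <= 1.
Proof.
move=> a2; rewrite ler_distl => /andP[h1 h2].
have a0 : 0 < a by lra.
have b0 : 0 < b by lra.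
have lnle (u v : R) : 0 < u -> 0 < v -> v <= u + 1 -> 1 <= u -> ln v <= ln u + 1.
  move=> u0 v0 uv u1; have := expR_ge1Dx (v / u - 1).
  rewrite addrC subrK => h; have : ln (v / u) <= v / u - 1.
    by rewrite -[leRHS]expRK ler_ln ?posrE ?expR_gt0 ?divr_gt0.
  rewrite ln_div ?posrE// => h3.
  have : v / u <= 2 by rewrite ler_pdivrMr//; lra.
  lra.
rewrite ler_distl; apply/andP; split; last by apply: lnle => //; lra.
by have := @lnle b a b0 a0; lra.
Qed.

End decay.

Section test_pair.
Context {R : realType} {n : nat}.
Variables (F : 'rV[R]_n.+1 -> R) (Omega : set 'rV[R]_n.+1).
Hypotheses (hF : strongly_convex_norm F) (oO : open Omega) (hb : boundary Omega !=set0).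
Local Notation dF := (anisotropic_dist F Omega).
Variables (p : 'rV[R]_n.+1) (r C : R) (i : 'I_n.+1) (delta iota : 'rV[R]_n.+1 -> R)
  (ddelta diota : 'I_n.+1 -> 'rV[R]_n.+1 -> R).
Hypotheses (r0 : 0 < r) (C1 : 1 <= C) (hdelta : C1_grad (ball p r) delta ddelta)
  (hiota : C1_grad (ball p r) iota diota).
Hypothesis chart : forall x, ball p r x -> [/\ boundary Omega x <-> delta x = 0,
    F (\row_j ddelta j x) <= 1 + C * `|delta x|,
    `|iota x * ddelta i x - 1| <= C * `|delta x|,
    [/\ `|iota x| <= C, `|diota i x| <= C & forall j, `|ddelta j x| <= C] &
    Omega x -> dF x <= `|delta x| * (1 + C * `|delta x|)].
Variables (D d1 : R).
Hypotheses (D0 : 0 < D) (d1D : d1 * expR 1 <= D).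
Hypothesis small : forall x, ball p r x ->
  `|delta x| <= 1 /\ `|delta x| * (1 + C * `|delta x|) <= d1.

Definition collar := ball p r `&` Omega.
Local Notation O := collar.

Lemma open_collar : open O.
Proof. by apply: openI => //; exact: ball_open. Qed.
Hint Resolve open_collar : core.

Lemma delta_neq0 x : O x -> delta x != 0.
Proof.
move=> [bx Ox]; have [[_ h] _ _ _ _] := chart bx.
by apply/eqP => /h bO; exact: boundary_not_in bO Ox.
Qed.

Lemma delta_lipschitz y z : `|y - p| <= r / 2 -> `|z - y| < r / 2 ->
  `|delta z - delta y| <= n.+1%:R * C * `|z - y|.
Proof.
move=> yp zy.
have hV t : 0 <= t <= 1 -> ball p r (y + t *: (z - y)).
  move=> /andP[t0 t1]; apply/ball_rVP; rewrite addrAC.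
  apply: le_lt_trans (ler_normD _ _) _; rewrite (splitr r); apply: ler_ltD => //.
  by apply: le_lt_trans zy; rewrite normrZ ger0_norm// ler_piMl.
have hd j x : ball p r x -> `|ddelta j x| <= C by move=> /chart[_ _ _ [_ _ ->]].
have := row_lipschitz hdelta ler01 hV hd; rewrite scale1r [y + _]addrC subrK mulr1.
by rewrite mulrAC.
Qed.

(** Since delta is Lipschitz, it cannot vanish on a ball of radius proportional to
    |delta y|; no boundary point is met and the ball stays in Omega. *)
Lemma collar_ball y (e : R) : O y -> `|y - p| <= r / 2 -> 0 < e -> e <= r / 2 ->
  n.+1%:R * C * e <= `|delta y| -> forall x, `|x - y| < e ->
  O x /\ `|delta x - delta y| <= n.+1%:R * C * `|x - y|.
Proof.
move=> Oy yp e0 er hd.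
have lip x : `|x - y| < e -> `|delta x - delta y| <= n.+1%:R * C * `|x - y|.
  by move=> xy; apply: delta_lipschitz => //; exact: lt_le_trans er.
have hB x : `|x - y| < e -> ball p r x.
  move=> xy; apply/ball_rVP; have -> : x - p = (y - p) + (x - y) by rewrite [RHS]addrC addrA subrK.
  apply: le_lt_trans (ler_normD _ _) _; rewrite (splitr r); apply: ler_ltD => //.
  exact: lt_le_trans er.
have nC : 0 < n.+1%:R * C by rewrite mulr_gt0 ?ltr0n// (lt_le_trans ltr01).
have hO : forall x, `|x - y| < e -> Omega x.
  apply: no_boundary_ball => //; first by case: Oy.
  move=> x xy bx; have [[h _] _ _ _ _] := chart (hB x xy).
  have := lip x xy; rewrite (h bx) sub0r normrN leNgt => /negP; apply.
  by apply: lt_le_trans hd; rewrite ltr_pM2l.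
by move=> x xy; split; [split; [exact: hB|exact: hO]|exact: lip].
Qed.

(** Written with a square, so that it is C^1 on both sides of the boundary at once. *)
Definition log_depth x : R := - ln ((delta x / D) ^+ 2) / 2.
Local Notation tau := log_depth.

Lemma delta_tau x : O x -> `|delta x| = D * expR (- tau x).
Proof.
move=> Ox; have d0 := delta_neq0 Ox.
have q0 : 0 < `|delta x| / D by rewrite divr_gt0// normr_gt0.
have -> : tau x = - ln (`|delta x| / D).
  rewrite /log_depth; have -> : (delta x / D) ^+ 2 = (`|delta x| / D) ^+ 2.
    by rewrite !exprMn -normrX ger0_norm ?sqr_ge0.
  by rewrite lnXn// -mulr_natl; field.
by rewrite opprK lnK ?posrE// mulrC mulfVK// lt0r_neq0.
Qed.

Lemma log_depth_ge1 x : O x -> 1 <= tau x.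
Proof.
move=> Ox; have [_ h] := small Ox.1.
have C0 := le_trans ler01 C1.
have h1 : `|delta x| <= d1.
  by apply: le_trans h; rewrite ler_peMr// lerDl mulr_ge0.
have : D * expR (- tau x) * expR 1 <= D.
  by rewrite -delta_tau//; apply: le_trans d1D; rewrite ler_wpM2r ?expR_ge0.
rewrite -mulrA -expRD ger_pMr// -[leRHS]expR0 ler_expR; lra.
Qed.

Lemma log_depth_C1 : C1_grad O tau (fun j x => - (ddelta j x / delta x)).
Proof.
have hd : C1_grad O delta ddelta by apply: C1_gradS hdelta => // x [].
pose h (t : R) := - ln ((t / D) ^+ 2) / 2; pose h' (t : R) := - t^-1.
have := @C1_grad_comp _ _ O delta ddelta h h' hd.
move=> H; apply: (C1_grad_eq (H _)) => [x Ux|//|j x Ux].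
  have d0 := delta_neq0 Ux; split; last by apply: contN; apply: contV => //; exact: cvg_id.
  have D0' : D != 0 by rewrite lt0r_neq0.
  have q0 : 0 < (delta x / D) ^+ 2.
    by rewrite lt_neqAle sqr_ge0 andbT eq_sym sqrf_eq0 mulf_neq0// invr_eq0.
  have e1 := derX 2 (derM (derI (delta x)) (derC D^-1 (delta x))).
  apply: (derE (derM (derN (derComp e1 (is_derive1_ln q0))) (derC 2^-1 (delta x)))).
  by rewrite /h' /=; field; rewrite d0 D0'.
by rewrite /h' mulrC mulrN.
Qed.

Variables (zeta : 'rV[R]_n.+1 -> R) (dzeta : 'I_n.+1 -> 'rV[R]_n.+1 -> R) (Cz : R).
Hypotheses (hzeta : C1_grad setT zeta dzeta) (Cz0 : 0 <= Cz)
  (zeta01 : forall x, 0 <= zeta x <= 1 /\ forall j, `|dzeta j x| <= Cz)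
  (zeta_supp : forall x, zeta x != 0 -> `|x - p| <= r / 2).
Variables (L sig0 : R) (m : nat).
Hypothesis L1 : 1 <= L.

(** The sign of delta, equal to 1 or -1 in the collar. This expression is C^1 with
    zero gradient by direct computation, whatever side of the boundary Omega is. *)
Definition side x : R := delta x * (expR (tau x) / D).
Local Notation chi := side.

Definition test_fun x : R := profile L sig0 (tau x) * zeta x ^+ m.+1.
Definition test_grad j x : R :=
  profile L sig0 (tau x) * (m.+1%:R * zeta x ^+ m * dzeta j x) + zeta x ^+ m.+1 *
    (expR ((ln (tau x) - tau x) / 2) * slope L sig0 (tau x) * - (ddelta j x / delta x)).
Definition flux x : R := chi x * iota x * ((zeta x ^+ m.+1) ^+ 2 * flux_coef L sig0 (tau x)).
Definition flux_grad j x : R := chi x * iota x *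
    ((zeta x ^+ m.+1) ^+ 2 * (flux_coef_der L sig0 (tau x) * - (ddelta j x / delta x))
     + flux_coef L sig0 (tau x) * (2 * zeta x ^+ m.+1 * (m.+1%:R * zeta x ^+ m * dzeta j x)))
  + (zeta x ^+ m.+1) ^+ 2 * flux_coef L sig0 (tau x) * (chi x * diota j x).

Lemma side_C1 : C1_grad O chi (fun _ _ => 0).
Proof.
have hd : C1_grad O delta ddelta by apply: C1_gradS hdelta => // x [].
have he := @C1_grad_comp _ _ O _ _ expR expR log_depth_C1
  (fun x _ => conj (is_derive_expR (tau x)) (@continuous_expR R (tau x))).
apply: (C1_grad_eq (C1_gradM hd (C1_gradM he (C1_grad_cst D^-1 open_collar)))) => // j x Ux.
by rewrite /=; field; rewrite delta_neq0//= lt0r_neq0.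
Qed.

Lemma side_sq x : O x -> chi x ^+ 2 = 1.
Proof.
move=> Ox; rewrite /side exprMn -[delta x ^+ 2]ger0_norm ?sqr_ge0// normrX delta_tau//.
rewrite -exprMn (_ : D * expR (- tau x) * (expR (tau x) / D) = expR (- tau x + tau x)); first by rewrite addNr expR0 expr1n.
by rewrite expRD; field; rewrite lt0r_neq0.
Qed.

Lemma test_fun_C1 : C1_grad O test_fun test_grad.
Proof.
have hz : C1_grad O zeta dzeta by apply: C1_gradS hzeta.
pose h' t := expR ((ln t - t) / 2) * slope L sig0 t.
have hh x : O x -> is_derive (tau x) (1 : R) (profile L sig0) (h' (tau x)) /\ {for tau x, continuous h'}.
  move=> Ox; have t0 := lt_le_trans ltr01 (log_depth_ge1 Ox).
  by split; [exact: is_derive_profile|exact: profile_der_cont].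
by apply: (C1_grad_eq (C1_gradM (C1_grad_comp log_depth_C1 hh) (C1_gradX m hz))).
Qed.

Lemma flux_C1 : C1_grad O flux flux_grad.
Proof.
have hz : C1_grad O zeta dzeta by apply: C1_gradS hzeta.
have hi : C1_grad O iota diota by apply: C1_gradS hiota => // x [].
have hh x : O x -> is_derive (tau x) (1 : R) (flux_coef L sig0) (flux_coef_der L sig0 (tau x)) /\
    {for tau x, continuous (flux_coef_der L sig0)}.
  move=> Ox; have t0 := lt_le_trans ltr01 (log_depth_ge1 Ox).
  by split; [exact: is_derive_flux_coef|exact: flux_coef_der_cont].
apply: (C1_grad_eq (C1_gradM (C1_gradM side_C1 hi)
  (C1_gradM (C1_gradX 1 (C1_gradX m hz)) (C1_grad_comp log_depth_C1 hh)))) => // j x Ux.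
by rewrite /flux_grad expr1 mulr0 addr0.
Qed.

(** On the window the depth is comparable to its central value exp(sig0). *)
Lemma window_range t : 0 < t -> window L sig0 t != 0 -> expR (sig0 - L) <= t <= expR (sig0 + L).
Proof.
move=> t0; have L0 : 0 < L := lt_le_trans ltr01 L1.
case: (window_cases L sig0 t) => [->|[h e] _]; first by rewrite eqxx.
have : `|wpos L sig0 t| <= 1.
  by rewrite -(@ler_pXn2r _ 2) ?nnegrE// expr1n -normrX ger0_norm ?sqr_ge0//; lra.
rewrite /wpos normrM normfV (gtr0_norm L0) ler_pdivrMr// mul1r ler_distl => /andP[h1 h2].
by rewrite -[t]lnK ?posrE// !ler_expR h1.
Qed.

(** In the window |delta| is bounded below, so [collar_ball] applies with a uniform
    radius. *)
Lemma support_margin : exists2 e, 0 < e & forall x y, O y ->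
  window L sig0 (tau y) != 0 -> zeta y != 0 -> `|x - y| <= e -> O x.
Proof.
have nC : 0 < n.+1%:R * C by rewrite mulr_gt0 ?ltr0n// (lt_le_trans ltr01).
(* The value of |delta| at the deepest end of the window. *)
pose smin := D * expR (- expR (sig0 + L)).
have s0 : 0 < smin by rewrite mulr_gt0// expR_gt0.
pose e := Num.min (r / 2) (smin / (n.+1%:R * C)).
have e0 : 0 < e by rewrite lt_min !divr_gt0.
exists (e / 2) => [|x y Oy py zy xy]; first by rewrite divr_gt0.
have t0 := lt_le_trans ltr01 (log_depth_ge1 Oy).
have /andP[_ h] := window_range t0 py.
have := @collar_ball y e Oy (zeta_supp zy) e0; rewrite ge_min lexx => /(_ isT) H.
apply: (H _ x _).1; last by apply: le_lt_trans xy _; rewrite ltr_pdivrMr// ltr_pMr// ltr1n.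
rewrite delta_tau//; apply: (@le_trans _ _ smin).
  by rewrite mulrC -ler_pdivlMr// ge_min lexx orbT.
by rewrite ler_pM2l// ler_expR lerN2.
Qed.

Lemma test_fun_neq0 x : test_fun x != 0 -> window L sig0 (tau x) != 0 /\ zeta x != 0.
Proof.
move=> h; split; apply: contraNneq h => h; rewrite /test_fun /profile h.
  by rewrite expr0n/= mulr0 mul0r.
by rewrite expr0n/= mulr0.
Qed.

Lemma flux_neq0 x : flux x != 0 -> window L sig0 (tau x) != 0 /\ zeta x != 0.
Proof.
move=> h; split; apply: contraNneq h => h; rewrite /flux /flux_coef /corrector h.
  by rewrite !expr0n/= !(mulr0, mul0r, addr0).
by rewrite !expr0n/= mul0r mulr0.
Qed.

Lemma collar_norm x : O x -> `|x| < `|p| + r.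
Proof.
move=> [/ball_rVP h _]; rewrite -[x](subrK p) addrC.
by apply: le_lt_trans (ler_normD _ _) _; rewrite ltrD2l.
Qed.

Lemma test_fun_H10 : C1_grad setT (zero_ext O test_fun) (fun j => zero_ext O (test_grad j)) /\
  H10 Omega (zero_ext O test_fun) (fun x => \row_j zero_ext O (test_grad j) x).
Proof.
have [e e0 he] := support_margin.
have hv x y : O y -> test_fun y != 0 -> `|x - y| <= e -> O x.
  by move=> Oy /test_fun_neq0[h1 h2] xy; exact: (he x y).
have hC := C1_zero_ext test_fun_C1 e0 hv.
split=> //; apply: (@C1_H10 _ _ Omega _ _ e (`|p| + r)) => //.
  move=> x hx; rewrite zero_ext0// => /collar_norm; rewrite ltNge hx//.
move=> x y; have [Ox|nOx] := pselect (O x); last by rewrite zero_ext0// eqxx.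
by rewrite zero_extE// => v0 yx; have [] := hv y x Ox v0 yx.
Qed.

(** The flux is C^1 with compact support, so the integral of its i-th partial
    derivative vanishes. *)
Lemma flux_integral : exists2 dw, continuous dw & [/\ forall x, O x -> dw x = flux_grad i x,
  forall x, ~ O x -> dw x = 0, (forall x, `|p| + r <= `|x| -> dw x = 0) &
  (\int[lebesgue_rV n.+1]_x (dw x)%:E = 0)%E].
Proof.
have [e e0 he] := support_margin.
have hw x y : O y -> flux y != 0 -> `|x - y| <= e -> O x.
  by move=> Oy /flux_neq0[h1 h2] xy; exact: (he x y).
have [_ hC] := C1_zero_ext flux_C1 e0 hw.
have n0 x : `|p| + r <= `|x| -> ~ O x by move=> hx /collar_norm; rewrite ltNge hx.
exists (zero_ext O (flux_grad i)); first by move=> x; have [_ /(_ i)[]] := hC x I.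
split=> [x|x|x|].
- exact: zero_extE.
- exact: zero_ext0.
- by move=> hx; rewrite zero_ext0//; exact: n0.
apply: (@integral_partial0 _ _ i (zero_ext O flux) _ (`|p| + r)).
- by move=> x; have [] := hC x I.
- by move=> x; have [_ /(_ i)[]] := hC x I.
- by move=> x; have [_ /(_ i)[]] := hC x I.
- by move=> x hx; rewrite zero_ext0//; exact: n0.
Qed.

Variables (B' : R) (W : R -> R).
Hypotheses (hB : 1 / 4 + 22 / L ^+ 2 <= B')
  (hW : forall d : R, 0 < d -> d <= d1 -> 1 / 4 + B' / ln (D / d) ^+ 2 <= W d).

Local Notation K := (loss_const C ((finsler_ub F + 1) * Cz) m.+1%:R B').
Local Notation c := (6 / L ^+ 2).
Local Notation window := (window L sig0).

(** The gradient splits along grad delta, of F-norm at most 1 + C |delta|, and along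
    grad zeta, where the crude bound of F by the maximum norm is enough. *)
Lemma norm_test_grad x : O x ->
  let E := expR ((ln (tau x) - tau x) / 2) in
  F (\row_j test_grad j x) <= E * `|slope L sig0 (tau x)| * (zeta x * zeta x ^+ m) *
      ((1 + C * `|delta x|) / `|delta x|)
    + E * window (tau x) ^+ 2 * (m.+1%:R * zeta x ^+ m) * ((finsler_ub F + 1) * Cz).
Proof.
move=> Ox /=; set E := expR (_ / 2); have [_ hN _ _ _] := chart Ox.1.
have d0 := delta_neq0 Ox; have d0' : 0 < `|delta x| by rewrite normr_gt0.
have [/andP[z0 z1] hz] := zeta01 x.
have zm : 0 <= zeta x ^+ m by exact: exprn_ge0.
have E0 : 0 <= E by exact: expR_ge0.
have nu := finsler_ub_ge0 hF.
have -> : (\row_j test_grad j x : 'rV[R]_n.+1) =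
    (- (E * slope L sig0 (tau x) * (zeta x * zeta x ^+ m) / delta x)) *: (\row_j ddelta j x) +
    (E * window (tau x) ^+ 2 * (m.+1%:R * zeta x ^+ m)) *: (\row_j dzeta j x).
  apply/rowP => j; rewrite !mxE /test_grad /profile -/E [zeta x ^+ m.+1]exprS; field; exact: d0.
apply: le_trans (finsler_triangle hF _ _) _; rewrite !(finslerZ hF); apply: lerD.
  have -> : `|- (E * slope L sig0 (tau x) * (zeta x * zeta x ^+ m) / delta x)| =
      E * `|slope L sig0 (tau x)| * (zeta x * zeta x ^+ m) / `|delta x|.
    rewrite normrN normrM normfV [`|_ * (_ * _)|]normrM [`|E * _|]normrM (ger0_norm E0).
    by rewrite [`|zeta x * _|]ger0_norm// mulr_ge0.
  rewrite [leLHS]mulrAC [leRHS]mulrA; apply: ler_wpM2r; first by rewrite invr_ge0.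
  by apply: ler_wpM2l => //; apply: mulr_ge0; exact: mulr_ge0.
rewrite ger0_norm; last first.
  by apply: mulr_ge0; [apply: mulr_ge0 => //; exact: sqr_ge0|exact: mulr_ge0].
apply: ler_wpM2l.
  by apply: mulr_ge0; [apply: mulr_ge0 => //; exact: sqr_ge0|exact: mulr_ge0].
apply: le_trans (finsler_le_ub hF _) _; apply: ler_pM => //; first by rewrite lerDl.
by apply: norm_le_coord => // j; rewrite mxE.
Qed.

(** [pointwise_bound] at a point of the collar. *)
Lemma collar_pointwise x : O x ->
  D * F (\row_j test_grad j x) ^+ 2 +
    c / (`|delta x| * tau x) * zeta x ^+ 2 ^+ m.+1 * window (tau x) ^+ 2 <=
  D * (test_fun x ^+ 2 / dF x ^+ 2 * W (dF x)) - flux_grad i x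
    + K * tau x * (K * `|delta x| * tau x ^+ 2 / c) ^+ m * window (tau x) ^+ 2.
Proof.
move=> Ox; have [_ _ hio [hi hdi _] hdist] := chart Ox.1.
have [sm1 sm2] := small Ox.1.
have d0 := delta_neq0 Ox; have d0' : 0 < `|delta x| by rewrite normr_gt0.
have [/andP[z0 z1] hz] := zeta01 x.
have C0 := le_trans ler01 C1; have nu := finsler_ub_ge0 hF.
have Cz'0 : 0 <= (finsler_ub F + 1) * Cz by rewrite mulr_ge0// addr_ge0.
have hz' j : `|dzeta j x| <= (finsler_ub F + 1) * Cz.
  by apply: le_trans (hz j) _; rewrite ler_peMl// lerDr.
have hd := dist_gt0 hF oO hb Ox.2.
have hd1 := hdist Ox.2.
have sD : `|delta x| * (1 + C * `|delta x|) * expR 1 <= D.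
  by apply: le_trans d1D; rewrite ler_wpM2r ?expR_ge0.
have := @pointwise_bound R L sig0 B' D `|delta x| (tau x) (zeta x) m (dF x) (W (dF x)) C
  ((finsler_ub F + 1) * Cz) (iota x) (diota i x) (dzeta i x) (ddelta i x) (chi x) (F (\row_j test_grad j x))
  L1 hB d0' sm1 (log_depth_ge1 Ox) (delta_tau Ox) z0 z1 C0 Cz'0 (side_sq Ox) hi hdi (hz' i) hio hd hd1 sD
  (hW hd (le_trans hd1 sm2)) (finsler_ge0 hF _) (norm_test_grad Ox).
rewrite /test_fun.
have -> : flux_grad i x = chi x * iota x * ((zeta x * zeta x ^+ m) ^+ 2 *
   (flux_coef_der L sig0 (tau x) * - (chi x * ddelta i x / `|delta x|)) +
   flux_coef L sig0 (tau x) * (2 * m.+1%:R * (zeta x * zeta x ^+ m ^+ 2) * dzeta i x)) +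
   (zeta x * zeta x ^+ m) ^+ 2 * flux_coef L sig0 (tau x) * (chi x * diota i x).
  have e : chi x * ddelta i x / `|delta x| = ddelta i x / delta x.
    have e2 : `|delta x| ^+ 2 = delta x ^+ 2 by rewrite -normrX ger0_norm ?sqr_ge0.
    have -> : chi x = delta x / `|delta x|.
      rewrite /side delta_tau// invfM -expRN opprK [D^-1 * _]mulrC; congr (_ * _).
    rewrite (_ : delta x / `|delta x| * ddelta i x / `|delta x| = delta x * ddelta i x / `|delta x| ^+ 2).
      by rewrite e2; field; exact: d0.
    by field; rewrite lt0r_neq0.
  by rewrite e /flux_grad [zeta x ^+ m.+1]exprS; ring.
by rewrite -exprS.
Qed.

Variables (e' : R) (x0 : 'rV[R]_n.+1).
Hypotheses (e'0 : 0 < e') (zeta_big : forall x, `|x - p| <= e' -> 1 / 2 <= zeta x)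
  (Ox0 : O x0) (x0p : `|x0 - p| <= e' / 2) (sig0E : sig0 = ln (tau x0)) (tau0 : (2 : R) <= tau x0)
  (L2 : (2 : R) <= L).

(** The ratio between the radius of the ball where the gain is seen and exp(-tau0):
    on this ball delta changes by at most half of its value and zeta >= 1/2. *)
Definition gain_ratio : R := Num.min (Num.min (r / 2) (e' / 2)) (D / (2 * (n.+1%:R * C))).
Definition gain_radius : R := gain_ratio * expR (- tau x0).
Definition gain : R := c / (4 * D) * (1 / 4) ^+ m.+1 * (1 / 4).

Lemma gain_ratio_gt0 : 0 < gain_ratio.
Proof.
have C0 := lt_le_trans ltr01 C1.
by rewrite !lt_min !divr_gt0// mulr_gt0// mulr_gt0// ltr0n.
Qed.

(** On this ball s and tau are within fixed factors of their values at x0, so that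
    s tau <= 4 D, while the window and the cutoff are at least 1/2. *)
Lemma gain_ball x : `|x - x0| < gain_radius -> O x /\
  gain <= c / (`|delta x| * tau x) * zeta x ^+ 2 ^+ m.+1 * window (tau x) ^+ 2.
Proof.
move=> xx0; have t20 : 2 <= tau x0 := tau0; have L20 : 2 <= L := L2; have e'00 : 0 < e' := e'0.
have C0 := lt_le_trans ltr01 C1; have nC : 0 < n.+1%:R * C by rewrite mulr_gt0// ltr0n.
have e1 : expR (- tau x0) <= 1 by rewrite -[leRHS]expR0 ler_expR; lra.
have rad_le b : gain_ratio <= b -> gain_radius <= b.
  by apply: le_trans; rewrite /gain_radius ger_pMr ?gain_ratio_gt0.
have rad_r : gain_radius <= r / 2 by apply: rad_le; rewrite !ge_min lexx.
have rad_e : gain_radius <= e' / 2 by apply: rad_le; rewrite !ge_min lexx orbT.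
have rad_s : n.+1%:R * C * gain_radius <= `|delta x0| / 2.
  rewrite delta_tau// /gain_radius mulrA [leRHS]mulrAC; apply: ler_wpM2r; first exact: expR_ge0.
  rewrite mulrC -ler_pdivlMr// /gain_ratio ge_min; apply/orP; right.
  by rewrite le_eqVlt; apply/orP; left; apply/eqP; field; rewrite -!natr1 in nC *; rewrite !lt0r_neq0.
have rad0 : 0 < gain_radius by rewrite mulr_gt0 ?gain_ratio_gt0// expR_gt0.
have d0 : 0 < `|delta x0| by rewrite normr_gt0 delta_neq0.
have zx0 : zeta x0 != 0.
  have := @zeta_big x0; move=> h; apply: lt0r_neq0; apply: (@lt_le_trans _ _ (1 / 2)) => //.
  by apply: h; apply: le_trans x0p _; lra.
have [Ox dx] : O x /\ `|delta x - delta x0| <= n.+1%:R * C * `|x - x0|.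
  apply: (collar_ball Ox0 (zeta_supp zx0) rad0) => //; apply: le_trans rad_s _; lra.
split=> //.
have dx2 : `|delta x - delta x0| <= `|delta x0| / 2.
  by apply: le_trans dx _; apply: le_trans rad_s; rewrite ler_pM2l// ltW.
have [s1 s2] : `|delta x0| / 2 <= `|delta x| /\ `|delta x| <= 2 * `|delta x0|.
  have h1 := lerB_dist (delta x0) (delta x); have h2 := lerB_dist (delta x) (delta x0).
  rewrite distrC in h1; split; lra.
have ex1 : 2 <= expR 1 :> R by have := expR_ge1Dx (1 : R); lra.
have ta : `|tau x - tau x0| <= 1.
  rewrite !delta_tau// in s1 s2; rewrite ler_distl; apply/andP; split.
    have : expR (- tau x) <= expR (1 - tau x0).
      have : expR (- tau x) <= 2 * expR (- tau x0) by rewrite -(ler_pM2l D0); lra.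
      move=> h; apply: le_trans h _; rewrite expRD; apply: ler_wpM2r => //; exact: expR_ge0.
    by rewrite ler_expR; lra.
  have : expR (- tau x0) <= expR (1 - tau x).
    have : expR (- tau x0) <= 2 * expR (- tau x) by rewrite -(ler_pM2l D0); lra.
    move=> h; apply: le_trans h _; rewrite expRD; apply: ler_wpM2r => //; exact: expR_ge0.
  by rewrite ler_expR; lra.
have tx1 := log_depth_ge1 Ox.
have hz : `|wpos L sig0 (tau x)| <= 1 / 2.
  rewrite /wpos normrM normfV (gtr0_norm (lt_le_trans ltr01 L1)) ler_pdivrMr ?(lt_le_trans ltr01 L1)//.
  by apply: le_trans (_ : 1 <= _); [rewrite sig0E; exact: log_close|lra].
have hz2 : wpos L sig0 (tau x) ^+ 2 <= 1 / 4.
  have -> : 1 / 4 = (1 / 2) ^+ 2 :> R by field.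
  rewrite -[leLHS]ger0_norm ?sqr_ge0// normrX; apply: lerXn2r; rewrite ?nnegrE//.
have hp : 1 / 4 <= window (tau x) ^+ 2.
  have -> : 1 / 4 = (1 / 2) ^+ 2 :> R by field.
  apply: lerXn2r; rewrite ?nnegrE ?window_ge0//.
  by rewrite /window /ppart le_max; apply/orP; left; lra.
have hzeta2 : 1 / 4 <= zeta x ^+ 2.
  have -> : 1 / 4 = (1 / 2) ^+ 2 :> R by field.
  have [/andP[z0 _] _] := zeta01 x.
  apply: lerXn2r; rewrite ?nnegrE//; apply: zeta_big.
  have -> : x - p = (x0 - p) + (x - x0) by rewrite [RHS]addrC addrA subrK.
  apply: le_trans (ler_normD _ _) _; rewrite (splitr e') lerD// ltW//.
  exact: lt_le_trans rad_e.
have c0 : 0 < c by rewrite divr_gt0// exprn_gt0// (lt_le_trans ltr01).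
have dp : 0 < `|delta x| by rewrite normr_gt0 delta_neq0.
have st : `|delta x| * tau x <= 4 * D.
  have tx : tau x <= 2 * tau x0 by move: ta; rewrite ler_distl => /andP[_ h]; lra.
  have h : tau x0 * expR (- tau x0) <= 1.
    rewrite expRN ler_pdivrMr ?expR_gt0// mul1r.
    by have := expR_ge1Dx (tau x0); lra.
  apply: (@le_trans _ _ ((2 * `|delta x0|) * (2 * tau x0))).
    by apply: ler_pM => //; lra.
  rewrite delta_tau// (_ : 2 * (D * expR (- tau x0)) * (2 * tau x0) = 4 * D * (tau x0 * expR (- tau x0))).
    by rewrite ger_pMr// mulr_gt0.
  ring.
have q0 : 0 <= c / (4 * D) by apply: divr_ge0; [exact: ltW|rewrite mulr_ge0// ltW].
have z20 : 0 <= (1 / 4 : R) ^+ m.+1 by apply: exprn_ge0; lra.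
rewrite /gain; apply: ler_pM => //; first exact: mulr_ge0.
apply: ler_pM => //.
  apply: ler_wpM2l; first exact: ltW.
  by rewrite lef_pV2// posrE; apply: mulr_gt0 => //; exact: lt_le_trans tx1.
by apply: lerXn2r => //; rewrite nnegrE ?sqr_ge0//; lra.
Qed.

Variable N : nat.
Hypothesis hm : (N%:R : R) <= (2 * m%:R - 1) / 4 * expR (- L).

Definition loss : R := 4 * K * (16 * K * D / c) ^+ m * expR (- (N%:R * tau x0)).

(** Where the window vanishes so does the loss; elsewhere the depth is at least
    exp(-L) times its value at x0, and [loss_decay] applies. *)
Lemma window_estimate x : O x ->
  D * F (\row_j test_grad j x) ^+ 2 + gain * \1_(ball x0 gain_radius) x <=
  D * (test_fun x ^+ 2 / dF x ^+ 2 * W (dF x)) - flux_grad i x + loss.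
Proof.
move=> Ox; have C0 := le_trans ler01 C1; have nu := finsler_ub_ge0 hF.
have L20 : 0 < L ^+ 2 by rewrite exprn_gt0// (lt_le_trans ltr01).
have c0 : 0 < c by rewrite divr_gt0.
have B0 : 0 <= B' by have := divr_ge0 (ler0n R 22) (ltW L20); move: hB; lra.
have K0 : 0 <= K by apply: loss_const_ge0 => //; rewrite mulr_ge0// addr_ge0.
have t1 := log_depth_ge1 Ox; have t0 := lt_le_trans ltr01 t1.
have hg : gain * \1_(ball x0 gain_radius) x <=
    c / (`|delta x| * tau x) * zeta x ^+ 2 ^+ m.+1 * window (tau x) ^+ 2.
  rewrite indicE; case: (boolP (x \in _)) => [|_].
    by rewrite inE => /ball_rVP/gain_ball[_]; rewrite mulr1.
  rewrite mulr0; apply: mulr_ge0; last exact: sqr_ge0.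
  apply: mulr_ge0; last by apply: exprn_ge0; exact: sqr_ge0.
  by apply: divr_ge0; [exact: ltW|rewrite mulr_ge0// ltW].
have hl : K * tau x * (K * `|delta x| * tau x ^+ 2 / c) ^+ m * window (tau x) ^+ 2 <= loss.
  have l0 : 0 <= loss.
    rewrite /loss; apply: mulr_ge0; last exact: expR_ge0.
    apply: mulr_ge0; first exact: mulr_ge0.
    by apply: exprn_ge0; apply: divr_ge0; [rewrite mulr_ge0 ?mulr_ge0// ltW|exact: ltW].
  have [->|pn] := eqVneq (window (tau x)) 0; first by rewrite expr0n/= mulr0.
  have /andP[h _] := window_range t0 pn.
  have X0 : 0 <= K * tau x * (K * `|delta x| * tau x ^+ 2 / c) ^+ m.
    apply: mulr_ge0; first by apply: mulr_ge0 => //; exact: ltW.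
    apply: exprn_ge0; apply: divr_ge0; last exact: ltW.
    by apply: mulr_ge0; [exact: mulr_ge0|exact: sqr_ge0].
  apply: (@le_trans _ _ (K * tau x * (K * `|delta x| * tau x ^+ 2 / c) ^+ m)).
    by apply: ler_piMr => //; apply: exprn_ile1; [exact: window_ge0|exact: window_le1].
  rewrite delta_tau//; apply: loss_decay => //; [exact: ltW|exact: ltW|].
  have m0 : 0 <= (2 * m%:R - 1) / 4 :> R.
    have h2 : 0 <= (2 * m%:R - 1) / 4 * expR (- L) by apply: le_trans hm; exact: ler0n.
    by move: h2; rewrite pmulr_lge0// expR_gt0.
  apply: le_trans (ler_wpM2l m0 h); rewrite expRD sig0E lnK ?posrE; last exact: lt_le_trans tau0.
  rewrite [leRHS]mulrCA [leRHS]mulrC; apply: ler_wpM2r; last exact: hm.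
  by apply: le_trans tau0.
have := collar_pointwise Ox; lra.
Qed.

End test_pair.

(** * Integration and contradiction *)

Section integration.
Context {R : realType} {n : nat}.
Local Notation mu := (@lebesgue_rV R n).

(** Inversion is discontinuous at 0; it is written x (x^2)^(-1) with a measurable real
    power. *)
Lemma measurable_inverse : measurable_fun setT (fun x : R => x^-1).
Proof.
rewrite (_ : (fun x => _) = (fun x : R => x * ((x ^+ 2) `^ (-1)))); last first.
  apply/funext => x; rewrite powR_inv1 ?sqr_ge0//.
  by have [->|d0] := eqVneq x 0; [rewrite invr0 mul0r|field].
apply: measurable_funM => //.
by apply: (measurableT_comp (measurable_powR (-1))); exact: measurable_funX.
Qed.

Lemma indic_ball_integrable (Omega : set 'rV[R]_n) (x : 'rV[R]_n) (r : R) : measurable Omega -> 0 < r ->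
  mu.-integrable Omega (EFin \o \1_(ball x r)).
Proof.
move=> mO r0; apply: (@bounded_support_integrable R _ _ mu (\1_(ball x r)) (ball x r) Omega 1) => //.
- exact: measurable_ball_rV.
- by move: (lebesgue_rV_ball x r0) => /= ->; exact: ltry.
- exact: measurable_indic (measurable_ball_rV x r).
- by move=> y; rewrite indicE; case: (_ \in _); rewrite ?normr1 ?normr0.
- by move=> y hy; rewrite indicE memNset.
Qed.

(** Integrate the pointwise inequality over Omega. The divergence disappears, the
    hypothesis comparing the integrals of Rf and f removes both main terms, and
    the two indicators remain. *)
Lemma concentration_inequality (Omega : set 'rV[R]_n) (f dw Rf : 'rV[R]_n -> R) (D a b M rho r : R)
    (x0 p : 'rV[R]_n) :
  open Omega -> continuous f -> (forall x, M <= `|x| -> f x = 0) ->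
  continuous dw -> (forall x, M <= `|x| -> dw x = 0) -> (forall x, ~ Omega x -> dw x = 0) ->
  (\int[mu]_x (dw x)%:E = 0)%E ->
  measurable_fun Omega Rf -> (forall x, Omega x -> 0 <= Rf x) ->
  (\int[mu]_(x in Omega) (Rf x)%:E <= \int[mu]_(x in Omega) (f x)%:E)%E ->
  0 <= D -> 0 <= b -> 0 < rho -> 0 < r -> ball x0 rho `<=` Omega ->
  (forall x, Omega x -> D * f x + (a * \1_(ball x0 rho) x + dw x) <= D * Rf x + b * \1_(ball p r) x) ->
  a * (rho *+ 2) ^+ n <= b * (r *+ 2) ^+ n.
Proof.
move=> oO cf fM cdw dwM dwO dw0 mR R0 hI D0 b0 rho0 r0 hrho hpt.
have mO : measurable Omega by exact: open_measurable_rV.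
have iF : mu.-integrable Omega (EFin \o f) by exact: (continuous_support_integrable mO cf fM).
have iw : mu.-integrable Omega (EFin \o dw) by exact: (continuous_support_integrable mO cdw dwM).
have i1 := indic_ball_integrable x0 mO rho0; have i2 := indic_ball_integrable p mO r0.
have iR : mu.-integrable Omega (EFin \o Rf).
  apply/integrableP; split; first exact/measurable_EFinP.
  rewrite (eq_integral (fun x => (Rf x)%:E)); last first.
    by move=> x /set_mem Ox; rewrite /= ger0_norm// R0.
  by apply: le_lt_trans hI _; have := integrable_lty mO iF.
have iZ (k : R) (h : 'rV[R]_n -> R) : mu.-integrable Omega (EFin \o h) ->
    mu.-integrable Omega (EFin \o (fun x => k * h x)).
  by move=> ih; exact: (integrableZl mO k ih).
have iD (h1 h2 : 'rV[R]_n -> R) : mu.-integrable Omega (EFin \o h1) -> mu.-integrable Omega (EFin \o h2) ->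
    mu.-integrable Omega (EFin \o (fun x => h1 x + h2 x)).
  by move=> ih1 ih2; exact: (integrableD mO ih1 ih2).
have iA := iZ a _ i1.
have H := le_Rintegral mO (iD _ _ (iZ D _ iF) (iD _ _ iA iw)) (iD _ _ (iZ D _ iR) (iZ b _ i2)) hpt.
rewrite !RintegralD ?RintegralZl// in H; try by [exact: iZ|exact: iD].
have Rw : Rintegral mu Omega dw = 0.
  rewrite /Rintegral integral_mkcond (eq_integral (fun x => (dw x)%:E)) ?dw0// => x _.
  by rewrite /= patchE; case: ifPn => // /negP; rewrite inE => /dwO ->.
have R1 : Rintegral mu Omega (\1_(ball x0 rho)) = (rho *+ 2) ^+ n.
  rewrite /Rintegral integral_indic//; last exact: measurable_ball_rV.
  by rewrite (setIidl hrho); move: (lebesgue_rV_ball x0 rho0) => /= ->.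
have R2 : Rintegral mu Omega (\1_(ball p r)) <= (r *+ 2) ^+ n.
  rewrite /Rintegral integral_indic//; last exact: measurable_ball_rV.
  have h : (mu (ball p r `&` Omega) <= ((r *+ 2) ^+ n)%:E)%E.
    rewrite -(lebesgue_rV_ball p r0); apply: le_measure; rewrite ?inE//.
    - by apply: measurableI => //; exact: measurable_ball_rV.
    - exact: measurable_ball_rV.
  have fi : mu (ball p r `&` Omega) \is a fin_num.
    by rewrite ge0_fin_numE//; apply: le_lt_trans h _; exact: ltry.
  by rewrite -lee_fin fineK.
have RR : Rintegral mu Omega Rf <= Rintegral mu Omega f.
  by rewrite /Rintegral; apply: fine_le => //; [exact: (integrable_fin_num mO iR)|exact: (integrable_fin_num mO iF)].
have := ler_wpM2l D0 RR; have := ler_wpM2l b0 R2.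
rewrite Rw R1 addr0 in H; move: H.
move: (Rintegral _ _ _) (Rintegral _ _ _) (Rintegral _ _ _) (_ ^+ n) (_ ^+ n) => I1 I2 I3 v1 v2.
clear=> H1 H2 H3; lra.
Qed.

End integration.

Section contradiction.
Context {R : realType} {n : nat}.
Variables (F : 'rV[R]_n.+1 -> R) (Omega : set 'rV[R]_n.+1).
Hypotheses (hF : strongly_convex_norm F) (oO : open Omega) (hb : boundary Omega !=set0).
Local Notation dF := (anisotropic_dist F Omega).
Local Notation mu := (@lebesgue_rV R n.+1).

(** The parameters are chosen in this order: L from B' - 1/4, then the power m of the
    cutoff from L and the dimension, then the depth of the window. The gain, of
    order exp(-(n+1) tau0), would have to be at most the loss, of order
    exp(-(n+2) tau0). *)
Lemma no_hardy_beyond_quarter p U rho (D d1 B' : R) (W : R -> R) :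
  C2_defining U rho -> U p -> boundary Omega p ->
  (forall x, U x -> boundary Omega x <-> rho x = 0) ->
  0 < D -> 0 < d1 -> d1 * expR 1 <= D -> 1 / 4 < B' ->
  measurable_fun setT W -> (forall d, 0 <= W d) ->
  (forall d : R, 0 < d -> d <= d1 -> 1 / 4 + B' / ln (D / d) ^+ 2 <= W d) ->
  ~ (forall u g, H10 Omega u g ->
      (\int[mu]_(x in Omega) (u x ^+ 2 / dF x ^+ 2 * W (dF x))%:E <=
       \int[mu]_(x in Omega) (F (g x) ^+ 2)%:E)%E).
Proof.
move=> hdef Up bp hbU D0 d10 d1D hB' mW W0 hW hardy.
have [r1 [C [i [delta [iota [ddelta [diota [r10 C1 hdelta1 hiota1 chart1]]]]]]]] :=
  boundary_chart hF hdef Up bp hbU.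
have C0 := lt_le_trans ltr01 C1.
have bpp : ball p r1 p by exact: ballxx.
have delta_p : delta p = 0 by have [[h _] _ _ _ _] := chart1 p bpp; exact: h.
have cdelta : {for p, continuous delta} by have [_ h] := hdelta1; have [] := h p bpp.
pose eps := Num.min 1 (d1 / (1 + C)).
have C10 : 0 < 1 + C by lra.
have eps0 : 0 < eps by rewrite lt_min ltr01 divr_gt0.
have [r2 r20 hr2] : exists2 r, 0 < r & forall y, `|y - p| < r -> `|delta y| <= eps.
  apply: rV_near_ball; near=> y; rewrite -[delta y]subr0 -delta_p distrC.
  near: y; exact: (@cvgr_dist_le _ _ _ _ _ _ _ cdelta eps eps0).
pose r := Num.min r1 r2.
have r0 : 0 < r by rewrite lt_min r10.
have rsub : ball p r `<=` ball p r1.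
  by move=> x /ball_rVP h; apply/ball_rVP; apply: lt_le_trans h _; rewrite ge_min lexx.
have hdelta := C1_gradS (@ball_open _ _ p r) rsub hdelta1.
have hiota := C1_gradS (@ball_open _ _ p r) rsub hiota1.
have chart x (h : ball p r x) := chart1 x (rsub x h).
have small x : ball p r x -> `|delta x| <= 1 /\ `|delta x| * (1 + C * `|delta x|) <= d1.
  move=> /ball_rVP h; have de : `|delta x| <= eps.
    by apply: hr2; apply: lt_le_trans h _; rewrite ge_min lexx orbT.
  have de1 : `|delta x| <= 1 by apply: le_trans de _; rewrite ge_min lexx.
  split=> //; apply: (@le_trans _ _ (d1 / (1 + C) * (1 + C))); last by rewrite mulfVK// lt0r_neq0.
  apply: ler_pM => //.
  - by rewrite addr_ge0// mulr_ge0// ltW.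
  - by apply: le_trans de _; rewrite ge_min lexx orbT.
  - by rewrite lerD2l ger_pMr.
have [zeta [dzeta [Cz [e' [hzeta [Cz0 e'0] zeta01 zeta_supp zeta_big]]]]] :=
  @cutoff R n p (r / 2) (divr_gt0 r0 (ltr0n _ 2)).
(* This makes 22 / L^2 at most B' - 1/4, as [hardy_profile] requires. *)
pose L := 2 + 22 / (B' - 1 / 4).
have B'0 : 0 < B' - 1 / 4 by rewrite subr_gt0.
have q0 : 0 < 22 / (B' - 1 / 4) by rewrite divr_gt0.
have L2 : 2 <= L by rewrite /L; lra.
have L1 : 1 <= L by lra.
have L0 : 0 < L by lra.
have hB : 1 / 4 + 22 / L ^+ 2 <= B'.
  rewrite -lerBrDl ler_pdivrMr ?exprn_gt0//.
  apply: (@le_trans _ _ ((B' - 1 / 4) * L)).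
    by rewrite /L mulrDr [_ * (22 / _)]mulrC mulfVK ?lt0r_neq0// lerDr; lra.
  by rewrite ler_pM2l// expr2 ler_peMr// ltW.
(* The loss decays like exp(-(2m - 1) tau / 4) with tau >= tau0 exp(-L); this m
   makes it of order exp(-(n + 2) tau0), one power below the gain. *)
pose m := Num.bound (4 * n.+2%:R * expR L).
have hm : n.+2%:R <= (2 * m%:R - 1) / 4 * expR (- L).
  rewrite expRN ler_pdivlMr ?expR_gt0//.
  have h : 4 * n.+2%:R * expR L < m%:R.
    by apply: archi_boundP; rewrite mulr_ge0 ?expR_ge0// mulr_ge0.
  have : 1 <= m%:R :> R.
    rewrite ler1n lt0n; apply/eqP => m0; move: h; rewrite m0 ltNge.
    by rewrite mulr_ge0 ?expR_ge0// mulr_ge0.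
  move: h; move: (expR L) (m%:R) => E mm; lra.
pose kap := @gain_ratio R n r C D e'.
have kap0 : 0 < kap by exact: gain_ratio_gt0.
pose G := gain D L m.
have G0 : 0 < G.
  rewrite /G /gain; apply: mulr_gt0; last lra.
  apply: mulr_gt0; [|rewrite exprn_gt0// divr_gt0].
  by apply: divr_gt0; [apply: divr_gt0 => //; exact: exprn_gt0|exact: mulr_gt0].
pose K := loss_const C ((finsler_ub F + 1) * Cz) m.+1%:R B'.
pose lc := 4 * K * (16 * K * D / (6 / L ^+ 2)) ^+ m.
have K0 : 0 <= K.
  apply: loss_const_ge0 => //; [lra|..|lra].
  by rewrite mulr_ge0// addr_ge0// finsler_ub_ge0.
have lc0 : 0 <= lc.
  rewrite /lc; apply: mulr_ge0; first exact: mulr_ge0.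
  apply: exprn_ge0; apply: divr_ge0; last by rewrite divr_ge0// exprn_ge0// ltW.
  by rewrite mulr_ge0 ?mulr_ge0// ltW.
pose Y := G * (kap *+ 2) ^+ n.+1; pose X := lc * (r *+ 2) ^+ n.+1.
have Y0 : 0 < Y by rewrite mulr_gt0// exprn_gt0// pmulrn_lgt0.
have X0 : 0 <= X by rewrite mulr_ge0// exprn_ge0// mulrn_wge0// ltW.
(* At depth T the factor exp(-tau0) is smaller than Y / X. *)
pose T := 2 + X / Y.
have [x0 [Ox0 x0p hx0]] : exists x0, [/\ collar Omega p r x0, `|x0 - p| <= e' / 2 &
    `|delta x0| <= D * expR (- T)].
  have [clp _] := bp.
  have : \forall y \near p, [/\ ball p r y, ball p (e' / 2) y & `|delta y| <= D * expR (- T)].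
    near=> y; split.
    - by near: y; exact: nbhsx_ballx.
    - by near: y; apply: nbhsx_ballx; rewrite divr_gt0.
    - rewrite -[delta y]subr0 -delta_p distrC; near: y; apply: (@cvgr_dist_le _ _ _ _ _ _ _ cdelta).
      by rewrite mulr_gt0// expR_gt0.
  by move=> /clp[y [Oy [b1 /ball_rVP/ltW b2 h]]]; exists y; split.
pose tau := log_depth delta D.
have hT : T <= tau x0.
  have := delta_tau oO chart D0 Ox0 => e; move: hx0; rewrite e ler_pM2l// ler_expR lerN2.
  exact.
have tau2 : 2 <= tau x0 by apply: le_trans hT; rewrite /T lerDl divr_ge0// ltW.
pose sig0 := ln (tau x0).
have [hC1u hH10] := test_fun_H10 oO r0 C1 hdelta chart D0 d1D small hzeta zeta_supp sig0 m L1.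
have [dw cdw [dwE dwO dwM dw0]] := flux_integral oO r0 C1 hdelta hiota chart D0 d1D small
  hzeta zeta_supp sig0 m L1.
have win := window_estimate hF oO hb r0 C1 hdelta chart D0 d1D small Cz0 zeta01 zeta_supp L1 hB hW e'0
   zeta_big Ox0 x0p erefl tau2 L2 hm.
have gb := gain_ball oO r0 C1 hdelta chart D0 d1D small zeta01 zeta_supp m L1 e'0
   zeta_big Ox0 x0p erefl tau2 L2.
pose O := collar Omega p r.
set u := zero_ext O _ in hC1u hH10; set g := (fun x => \row_j _) in hH10.
have OO x : O x -> Omega x by case.
have nO x : `|p| + r <= `|x| -> ~ O x.
  by move=> h /collar_norm; rewrite ltNge h.
have g0 x : ~ O x -> g x = 0 by move=> h; apply/rowP => j; rewrite !mxE zero_ext0.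
have ge x : O x -> g x = \row_j test_grad delta ddelta D zeta dzeta L sig0 m j x.
  by move=> h; apply/rowP => j; rewrite !mxE zero_extE.
have cg : continuous g.
  by move=> x; apply: continuous_row => j; have [_ h] := hC1u; have [_ /(_ j)[]] := h x I.
have cu : continuous u by move=> x; have [_ h] := hC1u; have [] := h x I.
have cF : continuous (fun x => F (g x) ^+ 2).
  move=> x; have c1 : {for x, continuous (fun x => F (g x))}.
    by apply: (@continuous_comp _ _ _ g F); [exact: cg|exact: finsler_continuous].
  exact: (@continuousM _ _ _ _ x c1 c1).
have mO : measurable Omega by exact: open_measurable_rV.
have mdF : measurable_fun setT dF by apply: continuous_measurable_rV; exact: dist_continuous.
have mR : measurable_fun Omega (fun x => u x ^+ 2 / dF x ^+ 2 * W (dF x)).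
  apply: (@measurable_funS _ _ _ _ setT) => //.
  apply: measurable_funM; last exact: measurableT_comp.
  apply: measurable_funM; first by apply: measurable_funX; exact: continuous_measurable_rV.
  by apply: (measurableT_comp measurable_inverse); exact: measurable_funX.
have R0 x : Omega x -> 0 <= u x ^+ 2 / dF x ^+ 2 * W (dF x).
  by move=> _; rewrite mulr_ge0// divr_ge0 ?sqr_ge0.
pose radius := gain_radius r C delta D e' x0.
have rad0 : 0 < radius by rewrite mulr_gt0// expR_gt0.
have rO x : ball x0 radius x -> O x by move=> /ball_rVP/gb[].
have ls0 : 0 <= loss F C delta D Cz L m B' x0 n.+2 by apply: mulr_ge0 => //; exact: expR_ge0.
have key := @concentration_inequality R n.+1 Omega (fun x => F (g x) ^+ 2) dw
  (fun x => u x ^+ 2 / dF x ^+ 2 * W (dF x)) D G (loss F C delta D Cz L m B' x0 n.+2) (`|p| + r) radius r x0 p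
  oO cF _ cdw dwM _ dw0 mR R0 (hardy u g hH10) (ltW D0) ls0 rad0 r0 (fun x h => OO x (rO x h)).
have : G * (radius *+ 2) ^+ n.+1 <= loss F C delta D Cz L m B' x0 n.+2 * (r *+ 2) ^+ n.+1.
  apply: key => [x h|x h|x Ox].
  - by rewrite g0 ?(finsler0 hF) ?expr0n//; exact: nO.
  - by apply: dwO => /OO.
  - have [Ox'|nOx] := pselect (O x).
      rewrite ge// /u zero_extE// dwE// (_ : \1_(ball p r) x = 1) ?mulr1; last first.
        by rewrite indicE mem_set//; case: Ox'.
      move: (win x Ox'); rewrite -/radius -/G.
      move: (D * _) (G * _) (D * _) (flux_grad _ _ _ _ _ _ _ _ _ _ _ _) (loss _ _ _ _ _ _ _ _ _ _).
      by clear=> *; lra.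
    rewrite g0// (finsler0 hF) /u zero_ext0// dwO// indicE memNset; last by move=> /rO.
    rewrite expr0n/= !mulr0 !mul0r !add0r mulr0 add0r.
    by apply: mulr_ge0 => //; rewrite ?indicE; exact: ler0n.
rewrite /loss -/K -/lc /radius /gain_radius -/kap.
have -> : - (n.+2%:R * log_depth delta D x0) = n.+2%:R * - tau x0 by rewrite mulrN.
rewrite expRM_natl -mulrnAl exprMn mulrA -/Y [lc * _ * _]mulrAC -/X -/tau.
rewrite [expR _ ^+ n.+2]exprS mulrA ler_pM2r ?exprn_gt0 ?expR_gt0//.
apply/negP; rewrite -ltNge expRN ltr_pdivrMr ?expR_gt0// -ltr_pdivrMl// mulrC.
apply: lt_le_trans (expR_ge1Dx _).
apply: (@le_lt_trans _ _ T); first by rewrite /T lerDr.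
by apply: le_lt_trans hT _; rewrite ltrDr.
Unshelve. all: by end_near. Qed.

End contradiction.

(** * The three bounds *)

Section hardy_weight.
Context {R : realType} {n : nat}.
Local Notation mu := (@lebesgue_rV R n.+1).

(** Gathers the two potential terms in one integral. If the first one were infinite
    while the energy is finite, the left side of the Hardy inequality would be
    -oo. *)
Lemma hardy_combined (F : 'rV[R]_n.+1 -> R) (Omega : set 'rV[R]_n.+1) (A B D gamma : R)
    (u : 'rV[R]_n.+1 -> R) (g : 'rV[R]_n.+1 -> 'rV[R]_n.+1) :
  strongly_convex_norm F -> open Omega -> boundary Omega !=set0 -> 0 < A -> 0 <= B ->
  measurable_fun Omega u ->
  let dF := anisotropic_dist F Omega in
  (\int[mu]_(x in Omega) (F (g x) ^+ 2)%:E
     - A%:E * \int[mu]_(x in Omega) (u x ^+ 2 / dF x ^+ 2)%:E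
   >= B%:E * \int[mu]_(x in Omega)
        (u x ^+ 2 / dF x ^+ 2 * (ln (D / dF x)) `^ (- gamma))%:E)%E ->
  (\int[mu]_(x in Omega) (u x ^+ 2 / dF x ^+ 2 * (A + B * (ln (D / dF x)) `^ (- gamma)))%:E <=
   \int[mu]_(x in Omega) (F (g x) ^+ 2)%:E)%E.
Proof.
move=> hF oO hb A0 B0 mu_ dF h.
have mO : measurable Omega by exact: open_measurable_rV.
have mdF : measurable_fun setT dF by apply: continuous_measurable_rV; exact: dist_continuous.
pose f1 x := u x ^+ 2 / dF x ^+ 2.
pose f2 x := f1 x * (ln (D / dF x)) `^ (- gamma).
have m1 : measurable_fun Omega f1.
  apply: measurable_funM; first exact: measurable_funX.
  apply: (@measurable_funS _ _ _ _ setT) => //.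
  by apply: (measurableT_comp measurable_inverse); exact: measurable_funX.
have m2 : measurable_fun Omega f2.
  apply: measurable_funM => //; apply: (@measurable_funS _ _ _ _ setT) => //.
  apply: (measurableT_comp (measurable_powR (- gamma))).
  apply: (measurableT_comp (@measurable_ln R)).
  by apply: measurable_funM => //; exact: (measurableT_comp measurable_inverse).
have f10 x : 0 <= f1 x by rewrite divr_ge0 ?sqr_ge0.
have f20 x : 0 <= f2 x by rewrite mulr_ge0// powR_ge0.
have e : (\int[mu]_(x in Omega) (u x ^+ 2 / dF x ^+ 2 * (A + B * (ln (D / dF x)) `^ (- gamma)))%:E =
    A%:E * \int[mu]_(x in Omega) (f1 x)%:E + B%:E * \int[mu]_(x in Omega) (f2 x)%:E)%E.
  rewrite -!ge0_integralZl//; try by [move=> x _; rewrite lee_fin|exact/measurable_EFinP|rewrite lee_fin ltW].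
  rewrite -ge0_integralD//.
  - by apply: eq_integral => x _; rewrite -!EFinM -EFinD /f2 -/(f1 x); congr EFin; ring.
  - by move=> x _; rewrite -EFinM lee_fin mulr_ge0// ltW.
  - by apply: measurable_funeM; exact/measurable_EFinP.
  - by move=> x _; rewrite -EFinM lee_fin mulr_ge0.
  - by apply: measurable_funeM; exact/measurable_EFinP.
rewrite e; move: h; rewrite -[X in (B%:E * X)%E]/(\int[mu]_(x in Omega) (f2 x)%:E)%E.
have I10 : (0 <= \int[mu]_(x in Omega) (f1 x)%:E)%E by apply: integral_ge0 => x _; rewrite lee_fin.
have I20 : (0 <= \int[mu]_(x in Omega) (f2 x)%:E)%E by apply: integral_ge0 => x _; rewrite lee_fin.
have J10 : (0 <= A%:E * \int[mu]_(x in Omega) (f1 x)%:E)%E by rewrite mule_ge0// lee_fin ltW.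
have J20 : (0 <= B%:E * \int[mu]_(x in Omega) (f2 x)%:E)%E by rewrite mule_ge0.
have I0 : (0 <= \int[mu]_(x in Omega) (F (g x) ^+ 2)%:E)%E.
  by apply: integral_ge0 => x _; rewrite lee_fin sqr_ge0.
move: J10 J20 I0; rewrite -/f1.
move: (A%:E * _)%E (B%:E * _)%E (\int[mu]_(x in Omega) (F (g x) ^+ 2)%:E)%E => a b c.
move: a b c => [a||] [b||] [c||]//=; rewrite -?EFinB -?EFinD ?lee_fin ?leey// => *; lra.
Qed.

End hardy_weight.

Section weights.
Context {R : realType}.

(** With t = ln l, the quotient of the two sides is B exp((2 - gamma) t). *)
Lemma inv_sq_le_powR (B gamma l : R) : 0 < B -> gamma < 2 -> 0 < l ->
  expR (1 / (B * (2 - gamma))) <= l -> (l ^+ 2)^-1 <= B * l `^ (- gamma).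
Proof.
move=> B0 g2 l0 hl; have s0 : 0 < 2 - gamma by lra.
have Bs : 0 < B * (2 - gamma) by exact: mulr_gt0.
have hln : 1 / (B * (2 - gamma)) <= ln l by rewrite -[leLHS]expRK ler_ln ?posrE ?expR_gt0.
have e : l `^ (- gamma) = expR ((2 - gamma) * ln l) / l ^+ 2.
  have -> : l ^+ 2 = expR (2%:R * ln l) by rewrite expRM_natl lnK.
  by rewrite /powR gt_eqF// -expRN -expRD; congr expR; ring.
rewrite e mulrA ler_peMl ?invr_ge0 ?exprn_ge0 ?(ltW l0)//.
rewrite -ler_pdivrMl// mulr1.
have h : B^-1 <= (2 - gamma) * ln l.
  rewrite -[leLHS]div1r ler_pdivrMr//; move: hln; rewrite ler_pdivrMr//.
  by rewrite (_ : ln l * (B * (2 - gamma)) = (2 - gamma) * ln l * B)//; ring.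
by apply: le_trans h _; apply: le_trans (expR_ge1Dx _); rewrite lerDr.
Qed.

End weights.

Theorem theorem5p1 (R : realType) (n : nat) (F : 'rV[R]_n -> R)
  (Omega : set 'rV[R]_n)
  (hF : strongly_convex_norm F)
  (hopen : open Omega) (hconn : connected Omega)
  (hpw : piecewise_C2 (boundary Omega))
  (hbd : boundary Omega !=set0)
  (dF := anisotropic_dist F Omega)
  (hsup : has_ubound [set dF x | x in Omega])
  (D := expR 1 * sup [set dF x | x in Omega])
  (A B gamma : R) (hA : 0 < A) (hB : 0 <= B) (hgamma : 0 < gamma)
  (hHardy : forall (u : 'rV[R]_n -> R) (gradu : 'rV[R]_n -> 'rV[R]_n),
    H10 Omega u gradu ->
    (\int[lebesgue_rV n]_(x in Omega) (F (gradu x) ^+ 2)%:E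
       - A%:E * \int[lebesgue_rV n]_(x in Omega) (u x ^+ 2 / dF x ^+ 2)%:E
     >= B%:E * \int[lebesgue_rV n]_(x in Omega)
          (u x ^+ 2 / dF x ^+ 2 * (ln (D / dF x)) `^ (- gamma))%:E)%E) :
  [/\ A <= 1 / 4,
      A = 1 / 4 -> 0 < B -> 2 <= gamma
    & A = 1 / 4 -> gamma = 2 -> B <= 1 / 4].
Proof.
have OmegaN0 : Omega !=set0.
  by have [p [clp _]] := hbd; have [x [Ox _]] := clp setT filterT; exists x.
case: n => [|n] in F Omega hF hopen hconn hpw hbd dF hsup D hHardy OmegaN0 *.
  (* R^0 is a point: a nonempty open set has empty boundary. *)
  exfalso; have [p [_ nip]] := hbd; have [x0 Ox0] := OmegaN0; apply: nip.
  have -> : Omega = setT by apply/seteqP; split=> // y _; rewrite (_ : y = x0)//; apply/rowP => -[].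
  by rewrite interiorT.
have [S [eS hS _ _]] := hpw.
have [p [k Skp]] : exists p, exists k, S k p.
  have [q] := hbd; rewrite eS => -[k _ /(_ setT filterT)[p [Skp _]]].
  by exists p, k.
have [U [rho [Up hdef eSU eU]]] := hS k p Skp.
have bp : boundary Omega p.
  have : (S k `&` U) p by [].
  by rewrite eSU => -[].
have hbU x : U x -> boundary Omega x <-> rho x = 0.
  move=> Ux; split=> [bx|rx].
    have : (boundary Omega `&` U) x by [].
    by rewrite eU => -[].
  have : (U `&` [set x | rho x = 0]) x by [].
  by rewrite -eU => -[].
have D0 : 0 < D.
  have [x Ox] := OmegaN0; rewrite /D mulr_gt0 ?expR_gt0//.
  apply: (lt_le_trans (dist_gt0 hF hopen hbd Ox)).
  by apply: ub_le_sup => //; exists x.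
have key (B' T0 : R) : 1 / 4 < B' ->
    (forall l, T0 <= l -> 1 <= l -> 1 / 4 + B' / l ^+ 2 <= A + B * l `^ (- gamma)) -> False.
  move=> hB' hl.
  (* Depths at least T correspond to distances at most d1, and T >= 1 keeps d1
     below D / e. *)
  pose T := Num.max T0 1.
  pose d1 := D * expR (- T).
  have T1 : 1 <= T by rewrite le_max lexx orbT.
  have d10 : 0 < d1 by rewrite mulr_gt0// expR_gt0.
  have d1D : d1 * expR 1 <= D.
    rewrite /d1 -mulrA -expRD ger_pMr// -[leRHS]expR0 ler_expR; lra.
  pose W d := A + B * (ln (D / d)) `^ (- gamma).
  have W0 d : 0 <= W d by rewrite addr_ge0 ?(ltW hA)// mulr_ge0// powR_ge0.
  have mW : measurable_fun setT W.
    apply: measurable_funD => //; apply: measurable_funM => //.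
    apply: (measurableT_comp (measurable_powR (- gamma))).
    apply: (measurableT_comp (@measurable_ln R)).
    by apply: measurable_funM => //; exact: measurable_inverse.
  have hW d : 0 < d -> d <= d1 -> 1 / 4 + B' / ln (D / d) ^+ 2 <= W d.
    move=> d0 dd1.
    have Tl : T <= ln (D / d).
      rewrite -[leLHS]expRK ler_ln ?posrE ?expR_gt0 ?divr_gt0//.
      by rewrite ler_pdivlMr// mulrC -ler_pdivlMr ?expR_gt0// -expRN.
    by apply: hl; apply: le_trans Tl => //; rewrite le_max lexx.
  apply: (no_hardy_beyond_quarter hF hopen hbd hdef Up bp hbU D0 d10 d1D hB' mW W0 hW).
  move=> u g hug; have [[[mu_ _] _ _] _] := hug.
  exact: (hardy_combined hF hopen hbd hA hB mu_ (hHardy u g hug)).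
split.
- rewrite leNgt; apply/negP => A14.
  have a0 : 0 < A - 1 / 4 by lra.
  apply: (@key 1 (1 / (A - 1 / 4))); first lra.
  move=> l hl l1; have l0 : 0 < l by exact: lt_le_trans l1.
  have h1 : 1 / l ^+ 2 <= A - 1 / 4.
    rewrite ler_pdivrMr ?exprn_gt0//; move: hl; rewrite ler_pdivrMr// mulrC => hl.
    by apply: le_trans hl _; rewrite ler_pM2l// expr2 ler_peMr// ltW.
  have h2 : 0 <= B * l `^ (- gamma) by rewrite mulr_ge0// powR_ge0.
  lra.
- move=> eA B0; rewrite leNgt; apply/negP => g2.
  apply: (@key 1 (expR (1 / (B * (2 - gamma))))); first lra.
  move=> l hl l1; have l0 : 0 < l by exact: lt_le_trans l1.
  by rewrite eA lerD2l div1r; exact: inv_sq_le_powR.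
- move=> eA eg; rewrite leNgt; apply/negP => B14.
  apply: (@key B 1) => // l _ l1; have l0 : 0 <= l by exact: le_trans l1.
  by rewrite eA eg lerD2l -[(2 : R)]/(2%:R) powR_invn.
Qed.
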